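(* Let $L$ be a holomorphic line bundle on $\Delta^*$ and let $h$ be a smooth Hermitian metric on $L$ such that $-C\,\omega_P\le\sqrt{-1}\,\Theta_h(L)\le C\,\omega_P$ on $\Delta^*$ for some constant $C>0$. Then for every $a\in\mathbb{R}$, $$({}_aL)^\vee={}_{-a+1-\varepsilon}(L^\vee)$$ for all sufficiently small $\varepsilon>0$.
   Context: $\Delta=\{z\in\mathbb{C}: |z|<1\}$, $\Delta^*=\Delta\setminus\{0\}$, $j\colon\Delta^*\hookrightarrow\Delta$ is the inclusion, $\omega_P=\frac{\sqrt{-1}\,dz\wedge d\bar z}{|z|^2(-\log|z|^2)^2}$, and $\Theta_h(L)$ is the Chern curvature of $(L,h)$. For $a\in\mathbb{R}$ and a Hermitian line bundle $(L,h)$ as in the claim, ${}_aL$ is the sheaf of $\mathcal{O}_\Delta$-modules defined for open $U\subset\Delta$ by ${}_aL(U)=\{f\in L(U\setminus\{0\}) : |f|_h=O(|z|^{-(a+\varepsilon)})\text{ for every }\varepsilon>0\}$ (a growth condition as $z\to0$, vacuous if $0\notin U$). It is a holomorphic line bundle on $\Delta$. The dual $L^\vee$ carries the dual metric $h^\vee$, with respect to which ${}_b(L^\vee)$ is defined. Both sides of the equality are regarded as subsheaves of $j_*(L^\vee)$. *)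

(* Defs.v *)
From Stdlib Require Import Reals ClassicalEpsilon FunctionalExtensionality ProofIrrelevance.
From Coquelicot Require Import Coquelicot.

Open Scope R_scope.

Definition disc (z : C) : Prop := Cmod z < 1.
Definition puncture (U : C -> Prop) (z : C) : Prop := U z /\ z <> RtoC 0.
Definition punctured_disc : C -> Prop := puncture disc.

Definition included (V U : C -> Prop) : Prop := forall z, V z -> U z.

(* Functions on an open set are total functions of which only the values on
   that set are meaningful. *)
Definition holomorphic_on (U : C -> Prop) (f : C -> C) : Prop :=
  forall z, U z -> ex_derive (K := C_AbsRing) (V := C_NormedModule) f z.

Definition smooth_on (U : C -> Prop) (f : C -> R) : Prop :=
  forall z, U z -> forall n, ex_diff_n (fun x y => f (x, y)) n (Re z) (Im z).

(** * Holomorphic line bundles *)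

(* A holomorphic line bundle on [X] is a family of complex lines together with
   local frames, indexed by an arbitrary open cover of [X], which differ on
   overlaps by holomorphic functions.  The latter are automatically
   nowhere zero, since each frame is a basis of the fibre.  Fibres over points
   outside [X] play no role. *)
Record line_bundle (X : C -> Prop) : Type := {
  fiber : C -> ModuleSpace C_Ring;
  chart : Type;
  dom : chart -> C -> Prop;
  frame : forall (i : chart) (z : C), fiber z;
  dom_open : forall i, open (dom i);
  dom_cover : forall z, X z <-> exists i, dom i z;
  frame_basis : forall i z, dom i z ->
    forall v : fiber z, exists! c : C, v = scal c (frame i z);
  frame_transition : forall i j, exists g : C -> C,
    holomorphic_on (fun z => dom i z /\ dom j z) g /\
    forall z, dom i z -> dom j z -> frame j z = scal (g z) (frame i z)
}.

Arguments fiber {X} _ _.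
Arguments chart {X} _.
Arguments dom {X} _ _ _.
Arguments frame {X} _ _ _.
Arguments dom_open {X} _ _ _ _.
Arguments dom_cover {X} _ _.
Arguments frame_basis {X} _ _ _ _ _.
Arguments frame_transition {X} _ _ _.

Definition section {X} (L : line_bundle X) : Type := forall z, fiber L z.

Definition section_plus {X} {L : line_bundle X} (f g : section L) : section L :=
  fun z => plus (f z) (g z).
Definition section_scal {X} {L : line_bundle X} (c : C -> C) (f : section L)
  : section L := fun z => scal (c z) (f z).

(* [f] restricts to an element of [L(U)], for [U] open in [X]. *)
Definition holomorphic_section {X} (L : line_bundle X) (U : C -> Prop)
  (f : section L) : Prop :=
  forall i, exists c : C -> C,
    holomorphic_on (fun z => U z /\ dom L i z) c /\
    forall z, U z -> dom L i z -> f z = scal (c z) (frame L i z).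

(** * The dual line bundle *)

Record functional (E : ModuleSpace C_Ring) : Type := {
  eval :> E -> C;
  eval_plus : forall u v, eval (plus u v) = (eval u + eval v)%C;
  eval_scal : forall c v, eval (scal c v) = (c * eval v)%C
}.
Arguments eval {E} _ _.
Arguments eval_plus {E} _ _ _.
Arguments eval_scal {E} _ _ _.

Lemma functional_ext (E : ModuleSpace C_Ring) (p q : functional E) :
  (forall v, p v = q v) -> p = q.
Proof.
destruct p as [p p1 p2], q as [q q1 q2]; simpl; intros H.
assert (Hpq : p = q) by (apply functional_extensionality; exact H).
subst q; f_equal; apply proof_irrelevance.
Qed.

Section DualModule.
Variable E : ModuleSpace C_Ring.

Definition functional_zero : functional E.
Proof.
exists (fun _ => RtoC 0).
- abstract (intros; ring).
- abstract (intros; ring).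
Defined.

Definition functional_plus (p q : functional E) : functional E.
Proof.
exists (fun v => (p v + q v)%C).
- abstract (intros; rewrite !eval_plus; ring).
- abstract (intros; rewrite !eval_scal; ring).
Defined.

Definition functional_opp (p : functional E) : functional E.
Proof.
exists (fun v => (- p v)%C).
- abstract (intros; rewrite !eval_plus; ring).
- abstract (intros; rewrite !eval_scal; ring).
Defined.

Definition functional_scal (c : C) (p : functional E) : functional E.
Proof.
exists (fun v => (c * p v)%C).
- abstract (intros; rewrite !eval_plus; ring).
- abstract (intros; rewrite !eval_scal; ring).
Defined.

Definition functional_AbelianMonoid_mixin : AbelianMonoid.mixin_of (functional E).
Proof.
exists functional_plus functional_zero;
  abstract (intros; apply functional_ext; intros; simpl; ring).
Defined.
Canonical functional_AbelianMonoid :=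
  AbelianMonoid.Pack _ functional_AbelianMonoid_mixin (functional E).

Definition functional_AbelianGroup_mixin :
  AbelianGroup.mixin_of functional_AbelianMonoid.
Proof.
exists functional_opp;
  abstract (intros; apply functional_ext; intros v;
            change (x v + - x v = 0)%C; ring).
Defined.
Canonical functional_AbelianGroup :=
  AbelianGroup.Pack _
    (AbelianGroup.Class _ _ functional_AbelianGroup_mixin) (functional E).

Definition functional_ModuleSpace_mixin :
  ModuleSpace.mixin_of C_Ring functional_AbelianGroup.
Proof.
exists functional_scal.
- abstract (intros x y u; apply functional_ext; intros v;
            change (x * (y * u v) = (x * y) * u v)%C; ring).
- abstract (intros u; apply functional_ext; intros v;
            change (1 * u v = u v)%C; ring).
- abstract (intros x u w; apply functional_ext; intros v;
            change (x * (u v + w v) = x * u v + x * w v)%C; ring).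
- abstract (intros x y u; apply functional_ext; intros v;
            change ((x + y) * u v = x * u v + y * u v)%C; ring).
Defined.
Canonical dual_space : ModuleSpace C_Ring :=
  ModuleSpace.Pack C_Ring _
    (ModuleSpace.Class _ _ _ functional_ModuleSpace_mixin) (functional E).

End DualModule.

Section DualBundle.
Context {X : C -> Prop} (L : line_bundle X).

Definition dual_frame (i : chart L) (z : C) : dual_space (fiber L z) :=
  epsilon (inhabits (functional_zero (fiber L z)))
          (fun xi : functional (fiber L z) => xi (frame L i z) = RtoC 1).

Lemma dual_frame_spec i z : dom L i z ->
  eval (dual_frame i z) (frame L i z) = RtoC 1.
Proof.
intros Hz; unfold dual_frame; apply epsilon_spec.
set (e := frame L i z).
pose (P := fun (v : fiber L z) (c : C) => v = scal c e).
pose (co := fun v => epsilon (inhabits (RtoC 0)) (P v)).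
assert (Hex : forall v, v = scal (co v) e).
{ intros v; apply (epsilon_spec (inhabits (RtoC 0)) (P v)).
  destruct (frame_basis L i z Hz v) as [c [Hc _]]; exists c; exact Hc. }
assert (Huniq : forall c d : C, scal c e = scal d e -> c = d).
{ intros c d H; destruct (frame_basis L i z Hz (scal c e)) as [b [_ Hb]].
  transitivity b; [symmetry; apply (Hb c eq_refl) | apply (Hb d H)]. }
unshelve eexists.
- exists co.
  + intros u v; apply Huniq; rewrite <- Hex.
    etransitivity; [ | symmetry; apply (scal_distr_r (K := C_Ring)) ].
    rewrite <- !Hex; reflexivity.
  + intros c v; apply Huniq; rewrite <- Hex.
    etransitivity; [ | apply (scal_assoc (K := C_Ring)) ].
    rewrite <- Hex; reflexivity.
- simpl; apply Huniq; rewrite <- Hex; symmetry; apply (scal_one (K := C_Ring)).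
Qed.

Definition dual_bundle : line_bundle X.
Proof.
refine {| fiber := fun z => dual_space (fiber L z);
          chart := chart L;
          dom := dom L;
          frame := dual_frame;
          dom_open := dom_open L;
          dom_cover := dom_cover L |}.
- abstract (
  intros i z Hz v; exists (eval v (frame L i z)); split;
  [ apply functional_ext; intros w;
    destruct (frame_basis L i z Hz w) as [c [-> _]];
    change (eval v (scal c (frame L i z)) =
      eval v (frame L i z) * eval (dual_frame i z) (scal c (frame L i z)))%C;
    rewrite !eval_scal, (dual_frame_spec i z Hz); ring
  | intros c ->;
    change (c * eval (dual_frame i z) (frame L i z) = c)%C;
    rewrite (dual_frame_spec i z Hz); ring ]).
- abstract (
  intros i j; destruct (frame_transition L j i) as [g [Hg Htr]];
  exists g; split;
  [ intros z [Hi Hj]; apply Hg; split; assumption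
  | intros z Hi Hj; apply functional_ext; intros w;
    destruct (frame_basis L i z Hi w) as [c [-> _]];
    change (eval (dual_frame j z) (scal c (frame L i z)) =
      g z * eval (dual_frame i z) (scal c (frame L i z)))%C;
    rewrite !eval_scal, (dual_frame_spec i z Hi);
    rewrite (Htr z Hj Hi), eval_scal, (dual_frame_spec j z Hj); ring ]).
Defined.

End DualBundle.

(** * Hermitian metrics and curvature *)

Record hermitian_metric {X} (L : line_bundle X) : Type := {
  form : forall z, fiber L z -> fiber L z -> C;
  form_plus : forall z, X z -> forall u v w,
    form z (plus u v) w = (form z u w + form z v w)%C;
  form_scal : forall z, X z -> forall c u w,
    form z (scal c u) w = (c * form z u w)%C;
  form_conj : forall z, X z -> forall u w, form z w u = Cconj (form z u w);
  form_pos : forall z, X z -> forall v, v <> zero -> 0 < Re (form z v v);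
  form_smooth : forall i,
    smooth_on (dom L i) (fun z => Re (form z (frame L i z) (frame L i z)))
}.
Arguments form {X L} _ _ _ _.

Definition metric_norm {X} {L : line_bundle X} (h : hermitian_metric L)
  (z : C) (v : fiber L z) : R := sqrt (Re (form h z v v)).

(* The norm of the dual metric: |xi| = sup { |xi(v)| : |v|_h <= 1 }. *)
Definition dual_metric_norm {X} {L : line_bundle X} (h : hermitian_metric L)
  (z : C) (xi : fiber (dual_bundle L) z) : R :=
  real (Lub_Rbar (fun r : R => exists v : fiber L z,
    metric_norm h z v <= 1 /\ r = Cmod (eval xi v))).

Definition partial_x (f : C -> C) (z : C) : C :=
  (Derive (fun t => Re (f (t, Im z))) (Re z),
   Derive (fun t => Im (f (t, Im z))) (Re z)).
Definition partial_y (f : C -> C) (z : C) : C :=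
  (Derive (fun t => Re (f (Re z, t))) (Im z),
   Derive (fun t => Im (f (Re z, t))) (Im z)).

(* The Wirtinger derivatives d/dz and d/d(bar z). *)
Definition partial_z (f : C -> C) (z : C) : C :=
  ((partial_x f z - Ci * partial_y f z) / 2)%C.
Definition partial_zbar (f : C -> C) (z : C) : C :=
  ((partial_x f z + Ci * partial_y f z) / 2)%C.

(* The coefficient of dz /\ d(bar z) in the curvature
   d(theta) = (dbar) (theta) of the Chern connection form
   theta = d/dz (log |e|_h^2) dz, where e is the i-th local frame.
   As d(bar z) /\ dz = - dz /\ d(bar z), a minus sign appears. *)
Definition chern_curvature {X} {L : line_bundle X} (h : hermitian_metric L)
  (i : chart L) : C -> C :=
  fun z => Copp (partial_zbar (partial_z (fun w =>
    RtoC (ln (Re (form h w (frame L i w) (frame L i w)))))) z).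

(* The coefficient of sqrt(-1) dz /\ d(bar z) in the Poincare form. *)
Definition poincare (z : C) : R :=
  1 / (Cmod z ^ 2 * (- ln (Cmod z ^ 2)) ^ 2).

(* - K omega_P <= sqrt(-1) Theta_h(L) <= K omega_P.  The three forms are real
   multiples of the positive form sqrt(-1) dz /\ d(bar z), so that the
   inequalities are those between the coefficients. *)
Definition curvature_bounded {X} {L : line_bundle X} (h : hermitian_metric L)
  (K : R) : Prop :=
  forall i z, dom L i z ->
    - K * poincare z <= Re (chern_curvature h i z) <= K * poincare z.

(** * Subsheaves of the direct image of a line bundle on the punctured disc *)

(* A presheaf of sections of [j_* L]: [F U f] means that [f], restricted to the
   complement of 0 in [U], belongs to [F(U)]. *)
Definition subpresheaf (L : line_bundle punctured_disc) : Type :=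
  (C -> Prop) -> section L -> Prop.

(* The prolongation [_a L] with respect to a fibrewise norm. *)
Definition prolongation (L : line_bundle punctured_disc)
  (norm : forall z, fiber L z -> R) (a : R) : subpresheaf L :=
  fun U f =>
    holomorphic_section L (puncture U) f /\
    (U (RtoC 0) -> forall eps : R, 0 < eps -> exists M : R,
       locally' (RtoC 0) (fun z =>
         norm z (f z) <= M * Rpower (Cmod z) (- (a + eps)))).

(* [phi] is a morphism of sheaves of O-modules from [F|_U] to [O_U], i.e. a
   section over [U] of the sheaf Hom(F, O).  As sections over [V] are
   represented by total functions, [restrict] expresses at the same time
   compatibility with restrictions and independence of the representative. *)
Record sheaf_hom {L : line_bundle punctured_disc} (F : subpresheaf L)
  (U : C -> Prop) (phi : (C -> Prop) -> section L -> C -> C) : Prop := {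
  hom_holomorphic : forall V f, open V -> included V U -> F V f ->
    holomorphic_on V (phi V f);
  hom_restrict : forall V W f g,
    open V -> open W -> included V U -> included W V -> F V f -> F W g ->
    (forall z, puncture W z -> f z = g z) ->
    forall z, W z -> phi V f z = phi W g z;
  hom_plus : forall V f g, open V -> included V U -> F V f -> F V g ->
    forall z, V z -> phi V (section_plus f g) z = (phi V f z + phi V g z)%C;
  hom_scal : forall V c f, open V -> included V U -> holomorphic_on V c ->
    F V f -> forall z, V z -> phi V (section_scal c f) z = (c z * phi V f z)%C
}.

(* The dual Hom(F, O) as a subsheaf of [j_* (L^dual)], for a sheaf of
   O-modules [F] contained in [j_* L] and equal to [L] away from 0: its
   sections over [U] are the sections of the dual bundle off 0 which come, by
   restriction, from morphisms [F|_U -> O_U]. *)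
Definition dual_sheaf {L : line_bundle punctured_disc} (F : subpresheaf L)
  : subpresheaf (dual_bundle L) :=
  fun U s =>
    holomorphic_section (dual_bundle L) (puncture U) s /\
    exists phi, sheaf_hom F U phi /\
      forall V f, open V -> included V (puncture U) -> F V f ->
        forall z, V z -> phi V f z = eval (s z) (f z).

Definition same_subsheaf {L : line_bundle punctured_disc}
  (F G : subpresheaf L) : Prop :=
  forall U, open U -> included U disc -> forall s : section L, F U s <-> G U s.

(* Main.v *)
Require Import Defs.
From Stdlib Require Import Reals ZArith Lra Lia ClassicalEpsilon Classical.
From Coquelicot Require Import Coquelicot.
Open Scope R_scope.

(** On the punctured disc, put [u = log |e|^2] for a local frame [e].  The
    bounded density [dbar d u] is a global function, and the equation
    [dbar Q = z dbar d u] has a solution [Q] which is continuous at 0 and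
    vanishes there: it is a limit of Cauchy transforms over annuli shrinking
    to 0, each dyadic annulus [|z| ~ 2^-n] contributing [O(1/n^2)].  Then
    [Q/z - du] is holomorphic, so that locally there are holomorphic sections
    [f] with [d log |f|^2 = Q/z dz]; they are unique up to constants, hence
    glue up to a monodromy which is removed by a factor [z^mu].  The resulting
    nowhere vanishing section has [log |f| = (Re mu) log |z| + o(log |z|)],
    where [Re mu] can be chosen in [[-a, -a+1)].  It generates [_a L]: a
    section [s] of the dual is bounded by [|s(f)| / |f|].  Conversely, for [s]
    in the right-hand side and [f] in [_a L], [s(f) = O(|z|^(-1+eps/2))] has a
    removable singularity. *)

(** The curvature bound lets the density grow like [4^n / n^2] on [|z| ~ 2^-n], and the Cauchy
    transform of a function supported in a disc gains only the radius of that disc: without a weight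
    the pieces would have size [2^n / n^2]. The factor [z] supplies the missing [2^-n]. Its price is
    the division in [Q/z]; once [Q] is normalised to vanish at 0, [Q/z = o(1/|z|)], which integrates
    along rays to [o(log |z|)]. The limit [Q] itself is never differentiated: off 0 it is a locally
    uniform limit of exact solutions, and [Q - z du] is holomorphic as a uniform limit of
    holomorphic functions. The exponent [sg = Re mu] determines [eps0]. The inequality [- a <= sg]
    puts the section in [_a L], while a section of the dual sheaf is [O(|z|^-(sg + del))] for every
    [del > 0], which is the growth allowed on the right-hand side as soon as [eps < - a + 1 - sg].
    The interval for [Re mu] is open on the right so that this threshold is positive. *)

Lemma Cmod_sub_sym (x y : C) : Cmod (x - y) = Cmod (y - x).
Proof. rewrite <- Cmod_opp; f_equal; ring. Qed.

Lemma Cmod_sub_triangle (x y z : C) : Cmod (x - z) <= Cmod (x - y) + Cmod (y - z).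
Proof. replace (x - z)%C with ((x - y) + (y - z))%C by ring; apply Cmod_triangle. Qed.

Lemma Cmod_le_Re_Im (z : C) : Cmod z <= Rabs (Re z) + Rabs (Im z).
Proof.
apply Rsqr_incr_0_var; [|assert (H := Rabs_pos (Re z)); assert (H' := Rabs_pos (Im z)); lra].
rewrite !Rsqr_pow2, Cmod2_alt.
assert (H := Rabs_pos (Re z)); assert (H' := Rabs_pos (Im z)).
rewrite <- (pow2_abs (Re z)), <- (pow2_abs (Im z)); nra.
Qed.

Lemma im_le_Cmod (z : C) : Rabs (Im z) <= Cmod z.
Proof. eapply Rle_trans; [|apply Rmax_Cmod]; apply Rmax_r. Qed.

Lemma Cmod_R_nonneg (x : R) : 0 <= x -> Cmod (RtoC x) = x.
Proof. intros H; rewrite Cmod_R; apply Rabs_pos_eq, H. Qed.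

Lemma Cmod_ge_sub (x y : C) : Cmod x - Cmod (y - x) <= Cmod y.
Proof.
replace x with (y - (y - x))%C at 1 by ring.
assert (H := Cmod_triangle y (- (y - x))); rewrite Cmod_opp in H.
replace (y - (y - x))%C with (y + - (y - x))%C by ring; lra.
Qed.

Lemma C_eq (x y : C) : Re x = Re y -> Im x = Im y -> x = y.
Proof. destruct x, y; simpl; intros -> ->; reflexivity. Qed.

Lemma re_minus (x y : C) : Re (x - y) = Re x - Re y.
Proof. unfold Re; simpl; ring. Qed.

Lemma im_minus (x y : C) : Im (x - y) = Im x - Im y.
Proof. unfold Im; simpl; ring. Qed.

Lemma re_minus_le (x y : C) : Rabs (Re x - Re y) <= Cmod (x - y).
Proof. rewrite <- re_minus; apply re_le_Cmod. Qed.

Lemma im_minus_le (x y : C) : Rabs (Im x - Im y) <= Cmod (x - y).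
Proof. rewrite <- im_minus; apply im_le_Cmod. Qed.

Lemma Cconj_RtoC (x : R) : Cconj (RtoC x) = RtoC x.
Proof. apply C_eq; simpl; ring. Qed.

Lemma Cconj_Ci : Cconj Ci = (- Ci)%C.
Proof. apply C_eq; simpl; ring. Qed.

Lemma Ci_sqr : (Ci * Ci)%C = (- (1))%C.
Proof. apply C_eq; simpl; ring. Qed.

Lemma RtoC_neq_0 (x : R) : x <> 0 -> RtoC x <> 0.
Proof. intros H X; now apply RtoC_inj in X. Qed.

Ltac conj_simpl :=
  repeat (rewrite Cplus_conj || rewrite Cminus_conj || rewrite Cmult_conj ||
          rewrite Copp_conj || rewrite Cconj_conj).

(** * Real differentiability in Wirtinger form *)

(** The balls of [C_UniformSpace] are squares. Round discs let estimates on [Cmod] be used as they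
    are; [near_locally] compares the two. *)
Definition near (z : C) (P : C -> Prop) : Prop :=
  exists d, 0 < d /\ forall w, Cmod (w - z) < d -> P w.

Definition ccont (f : C -> C) (z : C) : Prop :=
  forall eps, 0 < eps -> near z (fun w => Cmod (f w - f z) < eps).

(** Real differentiability at one point, with [A] and [B] the Wirtinger derivatives. Complex
    differentiability is the case [B = 0], so that one calculus serves both holomorphic functions
    and the metric. *)
Definition wdiff (f : C -> C) (z A B : C) : Prop :=
  forall eps, 0 < eps -> near z (fun w =>
    Cmod (f w - f z - A * (w - z) - B * Cconj (w - z)) <= eps * Cmod (w - z)).

Lemma near_and z P Q : near z P -> near z Q -> near z (fun w => P w /\ Q w).
Proof.
intros (d & Hd & H) (d' & Hd' & H'); exists (Rmin d d'); split.
- now apply Rmin_glb_lt.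
- intros w Hw; split; [apply H|apply H']; eapply Rlt_le_trans; eauto using Rmin_l, Rmin_r.
Qed.

Lemma near_imp (z : C) (P Q : C -> Prop) : (forall w, P w -> Q w) -> near z P -> near z Q.
Proof. intros H (d & Hd & H'); exists d; split; auto. Qed.

Lemma near_self z P : near z P -> P z.
Proof.
intros (d & Hd & H); apply H; replace (z - z)%C with (RtoC 0) by ring; now rewrite Cmod_0.
Qed.

Lemma near_locally (z : C) (P : C -> Prop) : near z P <-> locally (T := C_UniformSpace) z P.
Proof.
split.
- intros (d & Hd & H).
  exists (mkposreal (d / 2) ltac:(lra)); intros w [H1 H2]; apply H.
  eapply Rle_lt_trans; [apply Cmod_le_Re_Im|].
  change (Rabs (Re (w - z)) < d / 2) in H1; change (Rabs (Im (w - z)) < d / 2) in H2; lra.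
- intros [d H]; exists d; split; [apply cond_pos|].
  intros w Hw; apply H; split.
  + change (Rabs (Re (w - z)) < d); eapply Rle_lt_trans; [apply re_le_Cmod|]; easy.
  + change (Rabs (Im (w - z)) < d); eapply Rle_lt_trans; [apply im_le_Cmod|]; easy.
Qed.

Lemma near_near z P : near z P -> near z (fun w => near w P).
Proof.
intros (d & Hd & H); exists d; split; [easy|]; intros w Hw.
exists (d - Cmod (w - z)); split; [lra|]; intros v Hv; apply H.
assert (T := Cmod_sub_triangle v w z); lra.
Qed.

Lemma open_near (U : C -> Prop) (z : C) : open U -> U z -> near z U.
Proof. intros HU Hz; apply near_locally, HU, Hz. Qed.

Lemma ccont_ext_near f g z : near z (fun w => f w = g w) -> ccont f z -> ccont g z.
Proof.
intros H Hf eps He; specialize (Hf eps He).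
apply (near_imp z (fun w => Cmod (f w - f z) < eps /\ f w = g w)); [|now apply near_and].
intros w [H1 H2]; rewrite <- H2, <- (near_self _ _ H); exact H1.
Qed.

Lemma wdiff_ext_near f g z A B :
  near z (fun w => f w = g w) -> wdiff f z A B -> wdiff g z A B.
Proof.
intros H Hf eps He; specialize (Hf eps He).
eapply near_imp; [|apply (near_and _ _ _ Hf H)].
intros w [H1 H2]; cbv beta in *; rewrite <- H2, <- (near_self _ _ H); exact H1.
Qed.

Lemma wdiff_ext f g z A B : (forall w, f w = g w) -> wdiff f z A B -> wdiff g z A B.
Proof. intros H; apply wdiff_ext_near; exists 1; split; [lra|auto]. Qed.

Lemma wdiff_eq f z A B A' B' : wdiff f z A B -> A = A' -> B = B' -> wdiff f z A' B'.
Proof. now intros H <- <-. Qed.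

Lemma wdiff_lipschitz f z A B : wdiff f z A B ->
  near z (fun w => Cmod (f w - f z) <= (Cmod A + Cmod B + 1) * Cmod (w - z)).
Proof.
intros H; specialize (H 1 Rlt_0_1); eapply near_imp; [|exact H]; intros w Hw.
replace (f w - f z)%C with
  ((f w - f z - A * (w - z) - B * Cconj (w - z)) + (A * (w - z) + B * Cconj (w - z)))%C by ring.
eapply Rle_trans; [apply Cmod_triangle|].
assert (T := Cmod_triangle (A * (w - z)) (B * Cconj (w - z))).
rewrite !Cmod_mult, Cmod_conj in T; lra.
Qed.

Lemma wdiff_ccont f z A B : wdiff f z A B -> ccont f z.
Proof.
intros H eps He; destruct (wdiff_lipschitz _ _ _ _ H) as (d & Hd & H').
set (K := Cmod A + Cmod B + 1) in *.
assert (HK : 0 < K) by (unfold K; assert (X := Cmod_ge_0 A); assert (Y := Cmod_ge_0 B); lra).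
exists (Rmin d (eps / K)); split; [apply Rmin_glb_lt; [easy|now apply Rdiv_lt_0_compat]|].
intros w Hw; assert (Hw1 := Rlt_le_trans _ _ _ Hw (Rmin_l _ _)).
assert (Hw2 := Rlt_le_trans _ _ _ Hw (Rmin_r _ _)).
eapply Rle_lt_trans; [apply (H' w Hw1)|].
apply Rlt_div_r in Hw2; [|easy]; lra.
Qed.

Lemma ccont_const c z : ccont (fun _ => c) z.
Proof.
intros eps He; exists 1; split; [lra|]; intros w _.
replace (c - c)%C with (RtoC 0) by ring; now rewrite Cmod_0.
Qed.

Lemma ccont_plus f g z : ccont f z -> ccont g z -> ccont (fun w => f w + g w)%C z.
Proof.
intros Hf Hg eps He; assert (He' : 0 < eps / 2) by lra.
eapply near_imp; [|apply (near_and _ _ _ (Hf _ He') (Hg _ He'))]; intros w [H1 H2]; cbv beta in *.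
replace (f w + g w - (f z + g z))%C with ((f w - f z) + (g w - g z))%C by ring.
eapply Rle_lt_trans; [apply Cmod_triangle|]; lra.
Qed.

Lemma ccont_mult f g z : ccont f z -> ccont g z -> ccont (fun w => f w * g w)%C z.
Proof.
intros Hf Hg eps He.
assert (X := Cmod_ge_0 (f z)); assert (Y := Cmod_ge_0 (g z)).
set (M := Cmod (f z) + Cmod (g z) + 1).
set (e := Rmin 1 (eps / (2 * M))).
assert (HM : 0 < 2 * M) by (unfold M; lra).
assert (He' : 0 < e) by (apply Rmin_glb_lt; [lra|now apply Rdiv_lt_0_compat]).
assert (He1 : e <= 1) by apply Rmin_l.
assert (He2 : e * (2 * M) <= eps).
{ apply Rle_div_r; [easy|apply Rmin_r]. }
eapply near_imp; [|apply (near_and _ _ _ (Hf _ He') (Hg _ He'))]; intros w [H1 H2]; cbv beta in *.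
replace (f w * g w - f z * g z)%C with
  ((f w - f z) * (g w - g z) + ((f w - f z) * g z + f z * (g w - g z)))%C by ring.
eapply Rle_lt_trans; [apply Cmod_triangle|].
assert (T := Cmod_triangle ((f w - f z) * g z) (f z * (g w - g z))).
rewrite !Cmod_mult in *.
assert (P1 := Cmod_ge_0 (f w - f z)); assert (P2 := Cmod_ge_0 (g w - g z)).
unfold M in *; nra.
Qed.

Lemma ccont_comp f g z : ccont f z -> ccont g (f z) -> ccont (fun w => g (f w)) z.
Proof.
intros Hf Hg eps He; destruct (Hg eps He) as (d & Hd & H).
eapply near_imp; [|exact (Hf d Hd)]; intros w Hw; now apply H.
Qed.

Lemma wdiff_const c z : wdiff (fun _ => c) z 0 0.
Proof.
intros eps He; exists 1; split; [lra|]; intros w _.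
replace (c - c - 0 * (w - z) - 0 * Cconj (w - z))%C with (RtoC 0) by ring.
rewrite Cmod_0; assert (X := Cmod_ge_0 (w - z)); nra.
Qed.

Lemma wdiff_id z : wdiff (fun w => w) z 1 0.
Proof.
intros eps He; exists 1; split; [lra|]; intros w _.
replace (w - z - 1 * (w - z) - 0 * Cconj (w - z))%C with (RtoC 0) by ring.
rewrite Cmod_0; assert (X := Cmod_ge_0 (w - z)); nra.
Qed.

Lemma wdiff_conj_id z : wdiff Cconj z 0 1.
Proof.
intros eps He; exists 1; split; [lra|]; intros w _.
rewrite Cminus_conj.
replace (_ - _ - _ - _)%C with (RtoC 0) by ring.
rewrite Cmod_0; assert (X := Cmod_ge_0 (w - z)); nra.
Qed.

Lemma wdiff_plus f g z A B A' B' : wdiff f z A B -> wdiff g z A' B' ->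
  wdiff (fun w => f w + g w)%C z (A + A') (B + B').
Proof.
intros Hf Hg eps He; assert (He' : 0 < eps / 2) by lra.
eapply near_imp; [|apply (near_and _ _ _ (Hf _ He') (Hg _ He'))]; intros w [H1 H2]; cbv beta in *.
replace (_ - _ - _ - _)%C with ((f w - f z - A * (w - z) - B * Cconj (w - z)) +
  (g w - g z - A' * (w - z) - B' * Cconj (w - z)))%C by ring.
eapply Rle_trans; [apply Cmod_triangle|]; lra.
Qed.

Lemma wdiff_comp f g z A B P Q : wdiff f z A B -> wdiff g (f z) P Q ->
  wdiff (fun w => g (f w)) z (P * A + Q * Cconj B) (P * B + Q * Cconj A).
Proof.
intros Hf Hg eps He.
set (K := Cmod A + Cmod B + 1); set (M := Cmod P + Cmod Q + 1).
assert (HK : 0 < K) by (unfold K; assert (X := Cmod_ge_0 A); assert (Y := Cmod_ge_0 B); lra).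
assert (HM : 0 < M) by (unfold M; assert (X := Cmod_ge_0 P); assert (Y := Cmod_ge_0 Q); lra).
set (e1 := eps / (2 * K)); set (e2 := eps / (2 * M)).
assert (He1 : 0 < e1) by (apply Rdiv_lt_0_compat; lra).
assert (He2 : 0 < e2) by (apply Rdiv_lt_0_compat; lra).
destruct (Hg e1 He1) as (d & Hd & Hg').
pose proof (wdiff_ccont _ _ _ _ Hf d Hd) as Hc.
pose proof (wdiff_lipschitz _ _ _ _ Hf) as Hl.
specialize (Hf e2 He2).
eapply near_imp; [|apply (near_and _ _ _ Hc (near_and _ _ _ Hl Hf))].
intros w (H1 & H2 & H3); cbv beta in *; fold K in H2.
specialize (Hg' (f w) H1).
set (D := (f w - f z)%C) in *.
set (r := (D - A * (w - z) - B * Cconj (w - z))%C) in *.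
replace (_ - _ - _ - _)%C with ((g (f w) - g (f z) - P * D - Q * Cconj D)
  + (P * r + Q * Cconj r))%C by (unfold r; conj_simpl; ring).
eapply Rle_trans; [apply Cmod_triangle|].
assert (T := Cmod_triangle (P * r) (Q * Cconj r)); rewrite !Cmod_mult, Cmod_conj in T.
assert (E1 : e1 * (2 * K) = eps) by (unfold e1; field; lra).
assert (E2 : e2 * (2 * M) = eps) by (unfold e2; field; lra).
assert (X := Cmod_ge_0 (w - z)); assert (Y := Cmod_ge_0 r); assert (Z := Cmod_ge_0 D).
assert (e1 * Cmod D <= e1 * (K * Cmod (w - z))) by (apply Rmult_le_compat_l; lra).
assert (M * Cmod r <= M * (e2 * Cmod (w - z))) by (apply Rmult_le_compat_l; lra).
unfold M in *; nra.
Qed.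

Lemma wdiff_mult f g z A B A' B' : wdiff f z A B -> wdiff g z A' B' ->
  wdiff (fun w => f w * g w)%C z (A * g z + f z * A') (B * g z + f z * B').
Proof.
intros Hf Hg eps He.
pose proof (wdiff_lipschitz _ _ _ _ Hf) as Hl.
set (K := Cmod A + Cmod B + 1) in Hl.
assert (HK : 0 < K) by (unfold K; assert (X := Cmod_ge_0 A); assert (Y := Cmod_ge_0 B); lra).
set (M := Cmod (f z) + Cmod (g z) + 1).
assert (HM : 0 < M) by (unfold M; assert (X := Cmod_ge_0 (f z)); assert (Y := Cmod_ge_0 (g z)); lra).
set (e1 := eps / (2 * K)); set (e2 := eps / (2 * M)).
assert (He1 : 0 < e1) by (apply Rdiv_lt_0_compat; lra).
assert (He2 : 0 < e2) by (apply Rdiv_lt_0_compat; lra).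
pose proof (wdiff_ccont _ _ _ _ Hg e1 He1) as Hc.
specialize (Hf e2 He2); specialize (Hg e2 He2).
eapply near_imp; [|apply (near_and _ _ _ (near_and _ _ _ Hl Hc) (near_and _ _ _ Hf Hg))].
intros w ((H1 & H2) & H3 & H4); cbv beta in *.
set (r := (f w - f z - A * (w - z) - B * Cconj (w - z))%C) in *.
set (s := (g w - g z - A' * (w - z) - B' * Cconj (w - z))%C) in *.
replace (_ - _ - _ - _)%C with ((f w - f z) * (g w - g z) + (r * g z + f z * s))%C
 by (unfold r, s; ring).
eapply Rle_trans; [apply Cmod_triangle|].
assert (T := Cmod_triangle (r * g z) (f z * s)); rewrite !Cmod_mult in *.
assert (E1 : e1 * (2 * K) = eps) by (unfold e1; field; lra).
assert (E2 : e2 * (2 * M) = eps) by (unfold e2; field; lra).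
assert (X := Cmod_ge_0 (w - z)); assert (Y := Cmod_ge_0 r); assert (Z := Cmod_ge_0 s).
assert (X1 := Cmod_ge_0 (f w - f z)); assert (X2 := Cmod_ge_0 (g w - g z)).
assert (X3 := Cmod_ge_0 (f z)); assert (X4 := Cmod_ge_0 (g z)).
assert (Cmod (f w - f z) * Cmod (g w - g z) <= K * Cmod (w - z) * e1)
  by (apply Rmult_le_compat; lra).
assert (Cmod r * Cmod (g z) <= e2 * Cmod (w - z) * Cmod (g z)) by (apply Rmult_le_compat_r; lra).
assert (Cmod (f z) * Cmod s <= Cmod (f z) * (e2 * Cmod (w - z))) by (apply Rmult_le_compat_l; lra).
assert (0 <= e2 * Cmod (w - z)) by (apply Rmult_le_pos; lra).
unfold M in *; nra.
Qed.

Lemma wdiff_conj f z A B : wdiff f z A B -> wdiff (fun w => Cconj (f w)) z (Cconj B) (Cconj A).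
Proof.
intros H.
replace (Cconj B) with (0 * A + 1 * Cconj B)%C by ring.
replace (Cconj A) with (0 * B + 1 * Cconj A)%C by ring.
apply (wdiff_comp f Cconj); [easy|apply wdiff_conj_id].
Qed.

Lemma wdiff_cmult c f z A B : wdiff f z A B -> wdiff (fun w => c * f w)%C z (c * A) (c * B).
Proof.
intros H; replace (c * A)%C with (0 * f z + c * A)%C by ring.
replace (c * B)%C with (0 * f z + c * B)%C by ring.
apply (wdiff_mult (fun _ => c)); [apply wdiff_const|easy].
Qed.

Lemma wdiff_opp f z A B : wdiff f z A B -> wdiff (fun w => - f w)%C z (- A) (- B).
Proof.
intros H; replace (- A)%C with (- (1) * A)%C by ring.
replace (- B)%C with (- (1) * B)%C by ring.
apply (wdiff_ext (fun w => - (1) * f w)%C); [intros; ring|now apply wdiff_cmult].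
Qed.

Lemma wdiff_minus f g z A B A' B' : wdiff f z A B -> wdiff g z A' B' ->
  wdiff (fun w => f w - g w)%C z (A - A') (B - B').
Proof. intros Hf Hg; apply wdiff_plus; [easy|now apply wdiff_opp]. Qed.

Lemma wdiff_unique f z A B A' B' : wdiff f z A B -> wdiff f z A' B' -> A = A' /\ B = B'.
Proof.
intros H H'.
assert (D : wdiff (fun _ => RtoC 0) z (A - A') (B - B')).
{ eapply wdiff_ext; [|apply (wdiff_minus _ _ _ _ _ _ _ H H')]; intros; simpl; ring. }
assert (E : forall v : C, Cmod v = 1 -> ((A - A') * v + (B - B') * Cconj v = 0)%C).
{ intros v Hv; apply Cmod_eq_0.
  apply Rle_antisym; [|apply Cmod_ge_0]; apply Rnot_lt_le; intros Hp.
  destruct (D (Cmod ((A - A') * v + (B - B') * Cconj v) / 2) ltac:(lra)) as (d & Hd & HD).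
  specialize (HD (z + RtoC (d / 2) * v)%C).
  replace (z + RtoC (d / 2) * v - z)%C with (RtoC (d / 2) * v)%C in HD by ring.
  rewrite Cmod_mult, Cmod_R_nonneg, Hv in HD by lra.
  specialize (HD ltac:(lra)).
  replace (_ - _ - _ - _)%C with (- (RtoC (d / 2) * ((A - A') * v + (B - B') * Cconj v)))%C in HD.
  2:{ rewrite Cmult_conj. replace (Cconj (RtoC (d/2))) with (RtoC (d / 2)); [ring|].
      apply C_eq; simpl; ring. }
  rewrite Cmod_opp, Cmod_mult, Cmod_R_nonneg in HD by lra.
  nra. }
(* The directions [1] and [Ci] yield the sum and the difference of [A - A'] and [B - B']. *)
assert (E1 := E 1 Cmod_1); assert (E2 := E Ci Cmod_Ci).
rewrite Cconj_RtoC in E1.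
rewrite Cconj_Ci in E2.
assert (E3 : ((A - A') - (B - B') = 0)%C).
{ transitivity (- (Ci * ((A - A') * Ci + (B - B') * - Ci)))%C; [|rewrite E2; ring].
  transitivity (- (Ci * Ci) * ((A - A') - (B - B')))%C; [rewrite Ci_sqr; ring|ring]. }
clear H H' D E E2; destruct A, B, A', B'.
assert (R1 := f_equal Re E1); assert (I1 := f_equal Im E1).
assert (R3 := f_equal Re E3); assert (I3 := f_equal Im E3).
simpl in R1, I1, R3, I3.
split; apply C_eq; simpl; lra.
Qed.

Lemma Cinv_wdiff (z : C) : z <> 0 -> wdiff Cinv z (- (/ z * / z)) 0.
Proof.
intros Hz eps He; assert (Hp := proj1 (Cmod_gt_0 z) Hz).
set (m := Cmod z) in *.
(* The first radius keeps [|w| > m / 2]. The remainder is [(w - z)^2 / (w z^2)], at most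
   [2 |w - z|^2 / m^3], and the second radius makes this at most [eps |w - z|]. *)
exists (Rmin (m / 2) (eps * (m * m * m) / 2)).
assert (Hm3 : 0 < m * m * m) by (repeat apply Rmult_lt_0_compat; easy).
split; [apply Rmin_glb_lt; [lra|]; apply Rdiv_lt_0_compat; [nra|lra]|].
intros w Hw; assert (Hw1 := Rlt_le_trans _ _ _ Hw (Rmin_l _ _)).
assert (Hw2 := Rlt_le_trans _ _ _ Hw (Rmin_r _ _)).
assert (Hwm : m / 2 < Cmod w) by (assert (T := Cmod_ge_sub z w); fold m in T; lra).
assert (Hw0 : w <> 0) by (apply Cmod_gt_0; lra).
replace (_ - _ - _ - _)%C with ((w - z) * (w - z) * (/ w * / z * / z))%C
  by (field; now split).
rewrite !Cmod_mult, !Cmod_inv by easy; fold m.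
assert (X := Cmod_ge_0 (w - z)).
assert (Hi : / Cmod w <= 2 / m).
{ replace (2 / m) with (/ (m / 2)) by (field; lra). apply Rinv_le_contravar; lra. }
assert (Hi0 : 0 < / m) by now apply Rinv_0_lt_compat.
assert (Hi1 : 0 < / Cmod w) by (apply Rinv_0_lt_compat; lra).
assert (Hq : Cmod (w - z) * (/ Cmod w * / m * / m) <= eps).
{ apply Rle_trans with (eps * (m * m * m) / 2 * (2 / m * / m * / m)).
  - apply Rmult_le_compat; [easy| |lra|].
    + repeat apply Rmult_le_pos; lra.
    + apply Rmult_le_compat_r; [lra|]; apply Rmult_le_compat_r; lra.
  - right; field; lra. }
nra.
Qed.

Lemma wdiff_inv (f : C -> C) z A B : f z <> 0 -> wdiff f z A B ->
  wdiff (fun w => / f w)%C z (- (A * (/ f z * / f z))) (- (B * (/ f z * / f z))).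
Proof.
intros Hz H; assert (X := wdiff_comp _ _ _ _ _ _ _ H (Cinv_wdiff _ Hz)).
replace (- (A * _))%C with (- (/ f z * / f z) * A + 0 * Cconj B)%C by ring.
replace (- (B * _))%C with (- (/ f z * / f z) * B + 0 * Cconj A)%C by ring.
exact X.
Qed.

Lemma ccont_inv (f : C -> C) z : f z <> 0 -> ccont f z -> ccont (fun w => / f w)%C z.
Proof.
intros Hz H; apply (ccont_comp f Cinv); [easy|]; eapply wdiff_ccont, Cinv_wdiff, Hz.
Qed.

Lemma ccont_opp f z : ccont f z -> ccont (fun w => - f w)%C z.
Proof.
intros H; apply (ccont_comp f Copp); [easy|]; eapply wdiff_ccont, wdiff_opp, wdiff_id.
Qed.

Lemma ccont_minus f g z : ccont f z -> ccont g z -> ccont (fun w => f w - g w)%C z.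
Proof. intros Hf Hg; apply ccont_plus; [easy|now apply ccont_opp]. Qed.

Lemma ccont_conj f z : ccont f z -> ccont (fun w => Cconj (f w)) z.
Proof.
intros H; apply (ccont_comp f Cconj); [easy|]; eapply wdiff_ccont, wdiff_conj_id.
Qed.

Lemma wdiff_Re z : wdiff (fun w => RtoC (Re w)) z (/ 2) (/ 2).
Proof.
apply (wdiff_ext (fun w => / 2 * (w + Cconj w))%C).
{ intros [x y]; apply C_eq; simpl; field. }
eapply wdiff_eq.
- apply wdiff_cmult, wdiff_plus; [apply wdiff_id|apply wdiff_conj_id].
- ring.
- ring.
Qed.

Lemma half_conj : Cconj (/ 2) = (/ 2)%C.
Proof. apply C_eq; simpl; field. Qed.

(** The two Wirtinger derivatives of a real function are conjugate to each other. Keeping them in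
    the shape [A], [Cconj A] means that only the first one has to be computed. *)
Lemma wdiff_real_comp (phi : R -> R) (u : C -> R) z A (l : R) :
  wdiff (fun w => RtoC (u w)) z A (Cconj A) -> is_derive phi (u z) l ->
  wdiff (fun w => RtoC (phi (u w))) z (l * A) (Cconj (l * A)).
Proof.
intros Hu Hphi.
assert (Hp : wdiff (fun w => RtoC (phi (Re w))) (u z) (l * / 2) (l * / 2)).
{ intros eps He; apply is_derive_Reals in Hphi.
  destruct (Hphi eps He) as [d Hd]; exists d; split; [apply cond_pos|].
  intros w Hw; rewrite re_RtoC.
  replace (w - RtoC (u z))%C with ((Re w - u z, Im w)) in * by (destruct w; apply C_eq; simpl; ring).
  replace (_ - _ - _ - _)%C with (RtoC (phi (Re w) - phi (u z) - l * (Re w - u z)))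
    by (apply C_eq; simpl; field).
  rewrite Cmod_R.
  assert (Hr : Rabs (Re w - u z) <= Cmod (Re w - u z, Im w)) by apply (re_le_Cmod (_, _)).
  destruct (Req_dec (Re w - u z) 0) as [E|E].
  - replace (Re w) with (u z) by lra. replace (_ - _ - _) with 0 by ring.
    rewrite Rabs_R0; apply Rmult_le_pos; [lra|apply Cmod_ge_0].
  - specialize (Hd (Re w - u z) E ltac:(lra)).
    replace (u z + (Re w - u z)) with (Re w) in Hd by ring.
    replace (_ - _ - _) with (((phi (Re w) - phi (u z)) / (Re w - u z) - l) * (Re w - u z)) by (field; lra).
    rewrite Rabs_mult; apply Rmult_le_compat; auto using Rabs_pos; lra. }
assert (X := wdiff_comp _ _ _ _ _ _ _ Hu Hp); cbv beta in X.
eapply wdiff_eq; [exact X| |].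
- rewrite Cconj_conj; field.
- rewrite Cmult_conj; rewrite Cconj_RtoC; field.
Qed.

(** * Curves *)

Definition rderiv (g : R -> C) (t : R) (v : C) : Prop :=
  is_derive (fun s => Re (g s)) t (Re v) /\ is_derive (fun s => Im (g s)) t (Im v).

Lemma is_derive_eps (f : R -> R) (t l : R) :
  is_derive f t l <-> forall eps, 0 < eps -> exists d, 0 < d /\
    forall s, Rabs (s - t) < d -> Rabs (f s - f t - l * (s - t)) <= eps * Rabs (s - t).
Proof.
split.
- intros H eps He; apply is_derive_Reals in H; destruct (H eps He) as [d Hd].
  exists d; split; [apply cond_pos|]; intros s Hs.
  destruct (Req_dec s t) as [->|E].
  + replace (_ - _ - _) with 0 by ring; rewrite Rabs_R0; apply Rmult_le_pos; [lra|apply Rabs_pos].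
  + specialize (Hd (s - t) ltac:(lra) Hs); replace (t + (s - t)) with s in Hd by ring.
    replace (_ - _ - _) with (((f s - f t) / (s - t) - l) * (s - t)) by (field; lra).
    rewrite Rabs_mult; apply Rmult_le_compat_r; [apply Rabs_pos|lra].
- intros H; apply is_derive_Reals; intros eps He.
  destruct (H (eps / 2) ltac:(lra)) as (d & Hd & H').
  exists (mkposreal d Hd); intros h Hh Hhd; simpl in Hhd.
  specialize (H' (t + h)); replace (t + h - t) with h in H' by ring; specialize (H' Hhd).
  replace ((f (t + h) - f t) / h - l) with ((f (t + h) - f t - l * h) / h) by (field; easy).
  assert (Hp := Rabs_pos_lt h Hh); unfold Rdiv; rewrite Rabs_mult, Rabs_inv.
  apply Rle_lt_trans with (eps / 2); [|lra].
  apply Rle_div_l; easy.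
Qed.

Lemma rderiv_eps g t v : rderiv g t v <-> forall eps, 0 < eps -> exists d, 0 < d /\
    forall s, Rabs (s - t) < d -> Cmod (g s - g t - v * RtoC (s - t)) <= eps * Rabs (s - t).
Proof.
assert (ER : forall s, Re (g s - g t - v * RtoC (s - t)) = Re (g s) - Re (g t) - Re v * (s - t)).
{ intros; destruct (g s), (g t), v; simpl; ring. }
assert (EI : forall s, Im (g s - g t - v * RtoC (s - t)) = Im (g s) - Im (g t) - Im v * (s - t)).
{ intros; destruct (g s), (g t), v; simpl; ring. }
split.
- intros [H1 H2] eps He.
  destruct (proj1 (is_derive_eps _ _ _) H1 (eps / 2) ltac:(lra)) as (d1 & Hd1 & K1).
  destruct (proj1 (is_derive_eps _ _ _) H2 (eps / 2) ltac:(lra)) as (d2 & Hd2 & K2).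
  exists (Rmin d1 d2); split; [now apply Rmin_glb_lt|]; intros s Hs.
  eapply Rle_trans; [apply Cmod_le_Re_Im|]; rewrite ER, EI.
  specialize (K1 s (Rlt_le_trans _ _ _ Hs (Rmin_l _ _))).
  specialize (K2 s (Rlt_le_trans _ _ _ Hs (Rmin_r _ _))); lra.
- intros H; split; apply is_derive_eps; intros eps He; destruct (H eps He) as (d & Hd & H');
    exists d; split; auto; intros s Hs.
  + rewrite <- ER; eapply Rle_trans; [apply re_le_Cmod|]; auto.
  + rewrite <- EI; eapply Rle_trans; [apply im_le_Cmod|]; auto.
Qed.

(** A curve is viewed as a function of the real part of a complex variable, whose two Wirtinger
    derivatives are both half the velocity. In this way the rules for curves come from those for
    [wdiff]. *)
Lemma rderiv_wdiff h t u : rderiv h t u ->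
  wdiff (fun w => h (Re w)) t (u * / 2) (u * / 2).
Proof.
intros Hu eps He; destruct (proj1 (rderiv_eps _ _ _) Hu eps He) as (d & Hd & H).
exists d; split; [easy|]; intros w Hw; rewrite re_RtoC.
assert (Hr : Rabs (Re w - t) <= Cmod (w - t)).
{ replace (Re w - t) with (Re (w - t)) by (unfold Re; simpl; ring); apply re_le_Cmod. }
specialize (H (Re w) ltac:(lra)).
replace (_ - _ - _ - _)%C with (h (Re w) - h t - u * RtoC (Re w - t))%C.
- eapply Rle_trans; [exact H|]; apply Rmult_le_compat_l; lra.
- replace (RtoC (Re w - t)) with (/ 2 * ((w - t) + Cconj (w - t)))%C
    by (apply C_eq; unfold Re; simpl; field); field.
Qed.

Lemma wdiff_Re_rderiv h t A B : wdiff (fun w => h (Re w)) (RtoC t) A B -> rderiv h t (A + B).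
Proof.
intros X; apply rderiv_eps; intros eps He; destruct (X eps He) as (d & Hd & H).
exists d; split; [easy|]; intros s Hs.
assert (E : (RtoC s - RtoC t = RtoC (s - t))%C) by (apply C_eq; simpl; ring).
specialize (H (RtoC s)); rewrite E, Cmod_R, !re_RtoC in H; specialize (H Hs).
eapply Rle_trans; [right|exact H]; f_equal.
rewrite Cconj_RtoC; ring.
Qed.

Lemma wdiff_rderiv f g t v A B : rderiv g t v -> wdiff f (g t) A B ->
  rderiv (fun s => f (g s)) t (A * v + B * Cconj v).
Proof.
intros Hg Hf; apply rderiv_wdiff in Hg.
assert (X := wdiff_comp (fun w => g (Re w)) f (RtoC t) _ _ A B Hg Hf).
apply (wdiff_Re_rderiv (fun s => f (g s))) in X.
replace (A * v + B * Cconj v)%C with (A * (v * / 2) + B * Cconj (v * / 2) +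
  (A * (v * / 2) + B * Cconj (v * / 2)))%C; [exact X|].
rewrite Cmult_conj, half_conj; field.
Qed.

(** * Integrals of complex functions of a real variable *)

Definition rcont (g : R -> C) (t : R) : Prop := ccont (fun w => g (Re w)) (RtoC t).

Lemma rcont_eps g t : rcont g t <->
  (forall eps, 0 < eps -> exists d, 0 < d /\
     forall s, Rabs (s - t) < d -> Cmod (g s - g t) < eps).
Proof.
split; intros H eps He; destruct (H eps He) as (d & Hd & H'); exists d; split; auto.
- intros s Hs; apply (H' (RtoC s)); rewrite <- RtoC_minus, Cmod_R; exact Hs.
- intros w Hw; rewrite re_RtoC; apply H'; eapply Rle_lt_trans; [|exact Hw].
  replace (Re w - t) with (Re (w - t)) by (unfold Re; simpl; ring); apply re_le_Cmod.
Qed.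

Lemma rcont_comp f g t : ccont f (g t) -> rcont g t -> rcont (fun s => f (g s)) t.
Proof. intros Hf Hg; exact (ccont_comp (fun w => g (Re w)) f _ Hg Hf). Qed.

Lemma rcont_continuous g t : rcont g t ->
  continuous (fun s => Re (g s)) t /\ continuous (fun s => Im (g s)) t.
Proof.
intros H; split; apply continuity_pt_filterlim; intros eps He;
  destruct (proj1 (rcont_eps _ _) H eps He) as (d & Hd & H'); exists d; (split; [easy|]);
  intros s [_ Hs]; unfold dist in *; simpl in *; unfold R_dist in *; eapply Rle_lt_trans;
  [|apply (H' s Hs)| |apply (H' s Hs)].
- apply re_minus_le.
- apply im_minus_le.
Qed.

Lemma continuous_rcont g t :
  continuous (fun s => Re (g s)) t -> continuous (fun s => Im (g s)) t -> rcont g t.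
Proof.
intros H1 H2; apply continuity_pt_filterlim in H1; apply continuity_pt_filterlim in H2.
apply rcont_eps; intros eps He.
destruct (H1 (eps / 2) ltac:(lra)) as (d1 & Hd1 & K1).
destruct (H2 (eps / 2) ltac:(lra)) as (d2 & Hd2 & K2).
exists (Rmin d1 d2); split; [now apply Rmin_glb_lt|]; intros s Hs.
destruct (Req_dec t s) as [<-|E].
{ replace (g t - g t)%C with (RtoC 0) by ring; now rewrite Cmod_0. }
specialize (K1 s (conj (conj I E) (Rlt_le_trans _ _ _ Hs (Rmin_l _ _)))).
specialize (K2 s (conj (conj I E) (Rlt_le_trans _ _ _ Hs (Rmin_r _ _)))).
simpl in K1, K2; unfold R_dist in K1, K2.
eapply Rle_lt_trans; [apply Cmod_le_Re_Im|].
rewrite re_minus.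
rewrite im_minus.
lra.
Qed.

Lemma rderiv_rcont g t v : rderiv g t v -> rcont g t.
Proof.
intros [H1 H2]; apply continuous_rcont.
- apply (ex_derive_continuous (fun s => Re (g s))); eexists; exact H1.
- apply (ex_derive_continuous (fun s => Im (g s))); eexists; exact H2.
Qed.

Lemma rcont_const c t : rcont (fun _ => c) t.
Proof. apply ccont_const. Qed.

Lemma rcont_mult f g t : rcont f t -> rcont g t -> rcont (fun s => f s * g s)%C t.
Proof. intros Hf Hg; exact (ccont_mult (fun w => f (Re w)) (fun w => g (Re w)) _ Hf Hg). Qed.

Lemma rcont_plus f g t : rcont f t -> rcont g t -> rcont (fun s => f s + g s)%C t.
Proof. intros Hf Hg; exact (ccont_plus (fun w => f (Re w)) (fun w => g (Re w)) _ Hf Hg). Qed.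

Lemma rcont_minus f g t : rcont f t -> rcont g t -> rcont (fun s => f s - g s)%C t.
Proof. intros Hf Hg; exact (ccont_minus (fun w => f (Re w)) (fun w => g (Re w)) _ Hf Hg). Qed.

Definition icont (f : R -> C) (a b : R) : Prop :=
  forall t, Rmin a b <= t <= Rmax a b -> rcont f t.

Definition CInt (f : R -> C) (a b : R) : C :=
  (RInt (fun t => Re (f t)) a b, RInt (fun t => Im (f t)) a b).

Lemma icont_swap f a b : icont f a b -> icont f b a.
Proof. intros H t; rewrite Rmin_comm, Rmax_comm; apply H. Qed.

Lemma icont_ex_RInt f a b : icont f a b ->
  ex_RInt (fun t => Re (f t)) a b /\ ex_RInt (fun t => Im (f t)) a b.
Proof.
intros H; split; apply (ex_RInt_continuous (V := R_CompleteNormedModule)); intros t Ht; now apply rcont_continuous, H.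
Qed.

Lemma CInt_ext f g a b :
  (forall t, Rmin a b < t < Rmax a b -> f t = g t) -> CInt f a b = CInt g a b.
Proof.
intros H; unfold CInt; f_equal; apply RInt_ext; intros t Ht; now rewrite H.
Qed.

Lemma CInt_point f a : CInt f a a = 0.
Proof. unfold CInt; rewrite !RInt_point; reflexivity. Qed.

Lemma CInt_chasles f a b c : icont f a b -> icont f b c ->
  (CInt f a b + CInt f b c)%C = CInt f a c.
Proof.
intros H1 H2; apply icont_ex_RInt in H1; apply icont_ex_RInt in H2.
unfold CInt; rewrite <- (RInt_Chasles _ a b c (proj1 H1) (proj1 H2)).
rewrite <- (RInt_Chasles _ a b c (proj2 H1) (proj2 H2)); reflexivity.
Qed.

Lemma CInt_swap f a b : icont f a b -> CInt f b a = (- CInt f a b)%C.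
Proof.
intros H; assert (X := CInt_chasles f a b a H (icont_swap _ _ _ H)); rewrite CInt_point in X.
replace (CInt f b a) with (CInt f a b + CInt f b a - CInt f a b)%C by ring.
rewrite X; ring.
Qed.

Lemma CInt_plus f g a b : icont f a b -> icont g a b ->
  CInt (fun t => f t + g t)%C a b = (CInt f a b + CInt g a b)%C.
Proof.
intros Hf Hg; apply icont_ex_RInt in Hf; apply icont_ex_RInt in Hg.
apply C_eq; [exact (RInt_plus _ _ _ _ (proj1 Hf) (proj1 Hg))|].
exact (RInt_plus _ _ _ _ (proj2 Hf) (proj2 Hg)).
Qed.

Lemma CInt_cmult c f a b : icont f a b ->
  CInt (fun t => c * f t)%C a b = (c * CInt f a b)%C.
Proof.
intros Hf; apply icont_ex_RInt in Hf as [H1 H2].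
assert (S : forall k u, ex_RInt u a b -> ex_RInt (fun t => k * u t) a b /\
  RInt (fun t => k * u t) a b = k * RInt u a b).
{ intros k u Hu; split; [apply (ex_RInt_scal u a b k Hu)|apply (RInt_scal u a b k Hu)]. }
destruct c as [x y].
destruct (S x _ H1) as [A1 B1]; destruct (S y _ H1) as [A2 B2].
destruct (S x _ H2) as [A3 B3]; destruct (S y _ H2) as [A4 B4].
unfold CInt; apply C_eq; simpl.
- rewrite <- B1, <- B4; exact (RInt_minus _ _ a b A1 A4).
- rewrite <- B2, <- B3; exact (RInt_plus _ _ a b A3 A2).
Qed.

Lemma CInt_minus f g a b : icont f a b -> icont g a b ->
  CInt (fun t => f t - g t)%C a b = (CInt f a b - CInt g a b)%C.
Proof.
intros Hf Hg.
transitivity (CInt (fun t => f t + (- (1)) * g t)%C a b).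
{ apply CInt_ext; intros; ring. }
rewrite CInt_plus; [rewrite CInt_cmult; [ring|easy]|easy|].
intros t Ht; apply rcont_mult; [apply rcont_const|now apply Hg].
Qed.

Lemma CInt_const c a b : CInt (fun _ => c) a b = (c * RtoC (b - a))%C.
Proof.
unfold CInt; rewrite !RInt_const; apply C_eq; unfold Re, Im; simpl; unfold scal; simpl;
  unfold mult; simpl; ring.
Qed.

(** The factor 2 comes from estimating real and imaginary parts separately. It is harmless, since
    only orders of magnitude matter later. *)
Lemma CInt_bound f a b M : icont f a b ->
  (forall t, Rmin a b <= t <= Rmax a b -> Cmod (f t) <= M) ->
  Cmod (CInt f a b) <= 2 * M * Rabs (b - a).
Proof.
intros H HM.
assert (W : forall u v, u <= v -> icont f u v ->
  (forall t, u <= t <= v -> Cmod (f t) <= M) -> Cmod (CInt f u v) <= 2 * M * (v - u)).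
{ intros u v Huv Hc Hb; eapply Rle_trans; [apply Cmod_le_Re_Im|].
  apply icont_ex_RInt in Hc as [H1 H2]; unfold CInt; simpl.
  assert (K1 := abs_RInt_le_const _ u v M Huv H1
    (fun t Ht => Rle_trans _ _ _ (re_le_Cmod (f t)) (Hb t Ht))).
  assert (K2 := abs_RInt_le_const _ u v M Huv H2
    (fun t Ht => Rle_trans _ _ _ (im_le_Cmod (f t)) (Hb t Ht))).
  lra. }
destruct (Rle_dec a b) as [L|L].
- rewrite Rabs_pos_eq by lra; rewrite Rmin_left, Rmax_right in HM by lra; now apply W.
- rewrite CInt_swap by now apply icont_swap.
  rewrite Cmod_opp, Rabs_left1 by lra; rewrite Rmin_right, Rmax_left in HM by lra.
  replace (- (b - a)) with (a - b) by ring; apply W; [lra|now apply icont_swap|easy].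
Qed.

Lemma CInt_deriv g f a b :
  (forall t, Rmin a b <= t <= Rmax a b -> rderiv g t (f t)) -> icont f a b ->
  CInt f a b = (g b - g a)%C.
Proof.
intros Hd Hc; unfold CInt; apply C_eq; simpl.
- apply is_RInt_unique; apply (is_RInt_derive (fun t => Re (g t)) (fun t => Re (f t)) a b).
  + intros t Ht; apply Hd, Ht.
  + intros t Ht; apply rcont_continuous, Hc, Ht.
- apply is_RInt_unique; apply (is_RInt_derive (fun t => Im (g t)) (fun t => Im (f t)) a b).
  + intros t Ht; apply Hd, Ht.
  + intros t Ht; apply rcont_continuous, Hc, Ht.
Qed.

(** * Subdivision of rectangles *)

(** The supremum of the left ends is a common point, whether or not the lengths tend to 0. This
    serves both for bisection and, with intervals of length [2 * D / (n + 1)], for the convergence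
    of sequences. *)
Lemma nested_intervals (x l : nat -> R) :
  (forall n, x n <= x (S n)) -> (forall n, x (S n) + l (S n) <= x n + l n) ->
  (forall n, 0 <= l n) -> exists p, forall n, x n <= p <= x n + l n.
Proof.
intros H1 H2 H3.
assert (M : forall n k, x n <= x (n + k)%nat /\ x (n + k)%nat + l (n + k)%nat <= x n + l n).
{ intros n k; induction k as [|k IH]; [rewrite Nat.add_0_r; lra|].
  rewrite Nat.add_succ_r; specialize (H1 (n + k)%nat); specialize (H2 (n + k)%nat); lra. }
assert (B : forall n m, x m <= x n + l n).
{ intros n m; destruct (M n m) as [_ A1]; destruct (M m n) as [A2 _].
  rewrite Nat.add_comm in A2; specialize (H3 (n + m)%nat); lra. }
destruct (completeness (fun y => exists n, y = x n)) as [p [U L]].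
- exists (x 0%nat + l 0%nat); intros y [n ->]; apply B.
- now exists (x 0%nat), 0%nat.
- exists p; intros n; split; [apply U; now exists n|].
  apply L; intros y [m ->]; apply B.
Qed.

Lemma pow_half_small (w d : R) : 0 <= w -> 0 < d -> exists n, w / 2 ^ n < d.
Proof.
intros Hw Hd; destruct (pow_lt_1_zero (/ 2) ltac:(rewrite Rabs_pos_eq; lra) (d / (w + 1)))
  as [n Hn]; [apply Rdiv_lt_0_compat; lra|].
exists n; specialize (Hn n (Nat.le_refl n)).
rewrite pow_inv, Rabs_pos_eq in Hn by (apply Rlt_le, Rinv_0_lt_compat, pow_lt; lra).
apply (Rlt_div_r _ _ (w + 1)) in Hn; [|lra].
assert (0 < / 2 ^ n) by (apply Rinv_0_lt_compat, pow_lt; lra).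
unfold Rdiv; nra.
Qed.

(* The rectangle [x,z] * [u,v] of the local hypothesis is proportional to the
   whole one, as needed for Goursat's lemma. *)
Lemma rectangle_induction (P : R -> R -> R -> R -> Prop) (a b c d : R) :
  a <= b -> c <= d ->
  (forall x y z u v, a <= x -> x <= y -> y <= z -> z <= b -> c <= u -> u <= v -> v <= d ->
     P x y u v -> P y z u v -> P x z u v) ->
  (forall x z u t v, a <= x -> x <= z -> z <= b -> c <= u -> u <= t -> t <= v -> v <= d ->
     P x z u t -> P x z t v -> P x z u v) ->
  (forall p q, a <= p <= b -> c <= q <= d -> exists r, 0 < r /\
     forall n x z u v, a <= x -> x <= p <= z -> z <= b -> c <= u -> u <= q <= v -> v <= d ->
       z - x = (b - a) / 2 ^ n -> v - u = (d - c) / 2 ^ n -> z - x < r -> v - u < r ->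
       P x z u v) ->
  P a b c d.
Proof.
intros Hab Hcd Hh Hv Hl.
set (w := fun n => (b - a) / 2 ^ n); set (h := fun n => (d - c) / 2 ^ n).
assert (P2 : forall n, 0 < / 2 ^ n) by (intros; apply Rinv_0_lt_compat, pow_lt; lra).
assert (Sw : forall n, w n = w (S n) + w (S n)).
{ intros n; unfold w; simpl; field; apply pow_nonzero; lra. }
assert (Sh : forall n, h n = h (S n) + h (S n)).
{ intros n; unfold h; simpl; field; apply pow_nonzero; lra. }
assert (Pw : forall n, 0 <= w n) by (intros n; unfold w, Rdiv; specialize (P2 n); nra).
assert (Ph : forall n, 0 <= h n) by (intros n; unfold h, Rdiv; specialize (P2 n); nra).
apply NNPP; intros HP.
set (Inv := fun n (s : R * R) => a <= fst s /\ fst s + w n <= b /\ c <= snd s /\ snd s + h n <= d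
   /\ ~ P (fst s) (fst s + w n) (snd s) (snd s + h n)).
set (Nx := fun n (s s' : R * R) => Inv (S n) s' /\ fst s <= fst s' /\ snd s <= snd s' /\
   fst s' + w (S n) <= fst s + w n /\ snd s' + h (S n) <= snd s + h n).
assert (step : forall n s, Inv n s -> exists s', Nx n s s').
{ intros n [x u] (I1 & I2 & I3 & I4 & I5); simpl in *; apply NNPP; intros HN; apply I5.
  (* If [P] held on all four quarters, merging them into two rows and then stacking the rows would
     give [P] on the whole. *)
  assert (Pq : forall x' u', (x' = x \/ x' = x + w (S n)) -> (u' = u \/ u' = u + h (S n)) ->
    P x' (x' + w (S n)) u' (u' + h (S n))).
  { intros x' u' Hx Hu; apply NNPP; intros HQ; apply HN; exists (x', u'); unfold Nx, Inv; simpl.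
    assert (A := Sw n); assert (B := Sh n); assert (A' := Pw (S n)); assert (B' := Ph (S n)).
    destruct Hx as [-> | ->]; destruct Hu as [-> | ->]; repeat split; try easy; lra. }
  assert (A := Sw n); assert (B := Sh n); assert (A' := Pw (S n)); assert (B' := Ph (S n)).
  assert (row : forall u', (u' = u \/ u' = u + h (S n)) -> P x (x + w n) u' (u' + h (S n))).
  { intros u' Hu; apply (Hh x (x + w (S n)) (x + w n)); try (destruct Hu; subst; lra).
    - apply Pq; auto.
    - rewrite A, <- Rplus_assoc; apply Pq; auto. }
  apply (Hv x (x + w n) u (u + h (S n)) (u + h n)); try lra.
  - apply row; auto.
  - rewrite B, <- Rplus_assoc; apply row; auto. }
set (next := fun n s => epsilon (inhabits s) (Nx n s)).
set (sq := fix sq n := match n with O => (a, c) | S m => next m (sq m) end).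
assert (I : forall n, Inv n (sq n)).
{ induction n as [|n IH].
  - unfold Inv, w, h; simpl. replace (a + (b - a) / 1) with b by field.
    replace (c + (d - c) / 1) with d by field. repeat split; try lra; easy.
  - destruct (epsilon_spec (inhabits (sq n)) (Nx n (sq n)) (step n _ IH)) as [X _]; exact X. }
assert (N : forall n, Nx n (sq n) (sq (S n))).
{ intros n; apply (epsilon_spec (inhabits (sq n)) (Nx n (sq n))), step, I. }
destruct (nested_intervals (fun n => fst (sq n)) w) as [p Hp]; try easy; try (intros n; apply N).
destruct (nested_intervals (fun n => snd (sq n)) h) as [q Hq]; try easy; try (intros n; apply N).
destruct (Hl p q) as (r & Hr & HP').
{ specialize (Hp 0%nat); destruct (I 0%nat) as (I1 & I2 & _); lra. }
{ specialize (Hq 0%nat); destruct (I 0%nat) as (_ & _ & I1 & I2 & _); lra. }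
destruct (pow_half_small ((b - a) + (d - c)) r ltac:(lra) Hr) as [n Hn].
destruct (I n) as (I1 & I2 & I3 & I4 & I5); apply I5.
specialize (Hp n); specialize (Hq n); specialize (P2 n); simpl in Hp, Hq.
assert (E : (b - a + (d - c)) / 2 ^ n = w n + h n) by (unfold w, h; field; apply pow_nonzero; lra).
assert (X := Pw n); assert (Y := Ph n).
apply (HP' n); try lra; unfold w, h; ring.
Qed.

(** * Goursat's lemma *)

Definition rect (a b c d : R) (z : C) : Prop := a <= Re z <= b /\ c <= Im z <= d.

Definition hint (f : C -> C) (a b y : R) : C := CInt (fun t => f (t, y)) a b.
Definition vint (f : C -> C) (x c d : R) : C := (Ci * CInt (fun s => f (x, s)) c d)%C.

Definition rint (f : C -> C) (a b c d : R) : C :=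
  (hint f a b c + vint f b c d - hint f a b d - vint f a c d)%C.

Lemma hline_rderiv (y t : R) : rderiv (fun t => (t, y)) t 1.
Proof.
split; simpl; auto_derive; auto.
Qed.

Lemma vline_rderiv (x t : R) : rderiv (fun t => (x, t)) t Ci.
Proof.
split; simpl; auto_derive; auto.
Qed.

Lemma hline_icont f a b y :
  (forall t, Rmin a b <= t <= Rmax a b -> ccont f (t, y)) -> icont (fun t => f (t, y)) a b.
Proof.
intros H t Ht; apply (rcont_comp f (fun t => (t, y))); [now apply H|].
eapply rderiv_rcont, hline_rderiv.
Qed.

Lemma vline_icont f x c d :
  (forall t, Rmin c d <= t <= Rmax c d -> ccont f (x, t)) -> icont (fun t => f (x, t)) c d.
Proof.
intros H t Ht; apply (rcont_comp f (fun t => (x, t))); [now apply H|].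
eapply rderiv_rcont, vline_rderiv.
Qed.

Lemma hint_deriv (F f : C -> C) a b y :
  (forall t, Rmin a b <= t <= Rmax a b -> wdiff F (t, y) (f (t, y)) 0 /\ ccont f (t, y)) ->
  hint f a b y = (F (b, y) - F (a, y))%C.
Proof.
intros H; apply (CInt_deriv (fun t => F (t, y))).
- intros t Ht; replace (f (t, y)) with (f (t, y) * 1 + 0 * Cconj 1)%C by ring.
  apply (wdiff_rderiv F (fun t => (t, y))); [apply hline_rderiv|now apply H].
- apply hline_icont; intros t Ht; now apply H.
Qed.

Lemma vint_deriv (F f : C -> C) x c d :
  (forall t, Rmin c d <= t <= Rmax c d -> wdiff F (x, t) (f (x, t)) 0 /\ ccont f (x, t)) ->
  vint f x c d = (F (x, d) - F (x, c))%C.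
Proof.
intros H; unfold vint; rewrite <- CInt_cmult.
2: { apply vline_icont; intros t Ht; now apply H. }
apply (CInt_deriv (fun t => F (x, t))).
- intros t Ht; replace (Ci * f (x, t))%C with (f (x, t) * Ci + 0 * Cconj Ci)%C by ring.
  apply (wdiff_rderiv F (fun t => (x, t))); [apply vline_rderiv|now apply H].
- intros t Ht; apply rcont_mult; [apply rcont_const|].
  apply (vline_icont f x c d); [|easy]; intros s Hs; now apply H.
Qed.

Lemma rint_primitive (F f : C -> C) a b c d : a <= b -> c <= d ->
  (forall z, rect a b c d z -> wdiff F z (f z) 0 /\ ccont f z) -> rint f a b c d = 0.
Proof.
intros Hab Hcd H; unfold rint.
rewrite !(hint_deriv F f), !(vint_deriv F f); [ring| | | |];
  intros t; rewrite Rmin_left, Rmax_right by lra; intros Ht; apply H; split; simpl; lra.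
Qed.

Lemma rint_minus (f g : C -> C) a b c d : a <= b -> c <= d ->
  (forall z, rect a b c d z -> ccont f z /\ ccont g z) ->
  rint (fun z => f z - g z)%C a b c d = (rint f a b c d - rint g a b c d)%C.
Proof.
intros Hab Hcd H; unfold rint, hint, vint.
rewrite !CInt_minus; [ring| | | | | | | |];
  (apply hline_icont || apply vline_icont);
  intros t; rewrite Rmin_left, Rmax_right by lra; intros Ht; apply H; split; simpl; lra.
Qed.

Lemma rint_bound (f : C -> C) a b c d M : a <= b -> c <= d ->
  (forall z, rect a b c d z -> ccont f z /\ Cmod (f z) <= M) ->
  Cmod (rint f a b c d) <= 4 * M * ((b - a) + (d - c)).
Proof.
intros Hab Hcd H; unfold rint.
assert (HH : forall y, c <= y <= d -> Cmod (hint f a b y) <= 2 * M * (b - a)).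
{ intros y Hy; rewrite <- (Rabs_pos_eq (b - a)) by lra; apply CInt_bound;
  [apply hline_icont|]; intros t; rewrite Rmin_left, Rmax_right by lra; intros Ht; apply H;
  split; simpl; lra. }
assert (HV : forall x, a <= x <= b -> Cmod (vint f x c d) <= 2 * M * (d - c)).
{ intros x Hx; unfold vint; rewrite Cmod_mult, Cmod_Ci, Rmult_1_l.
  rewrite <- (Rabs_pos_eq (d - c)) by lra; apply CInt_bound;
  [apply vline_icont|]; intros t; rewrite Rmin_left, Rmax_right by lra; intros Ht; apply H;
  split; simpl; lra. }
assert (T1 := HH c ltac:(lra)); assert (T2 := HH d ltac:(lra)).
assert (T3 := HV a ltac:(lra)); assert (T4 := HV b ltac:(lra)).
assert (U1 := Cmod_triangle (hint f a b c + vint f b c d - hint f a b d) (- vint f a c d)).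
assert (U2 := Cmod_triangle (hint f a b c + vint f b c d) (- hint f a b d)).
assert (U3 := Cmod_triangle (hint f a b c) (vint f b c d)).
rewrite Cmod_opp in U1, U2; unfold Cminus in *; lra.
Qed.

Lemma rint_split_h (f : C -> C) x y z u v : x <= y -> y <= z -> u <= v ->
  (forall p, rect x z u v p -> ccont f p) ->
  rint f x z u v = (rint f x y u v + rint f y z u v)%C.
Proof.
intros Hxy Hyz Huv H; unfold rint.
assert (E : forall q, u <= q <= v -> (hint f x y q + hint f y z q)%C = hint f x z q).
{ intros q Hq; apply CInt_chasles; apply hline_icont; intros t; rewrite Rmin_left, Rmax_right by lra;
  intros Ht; apply H; split; simpl; lra. }
rewrite <- !E by lra; ring.
Qed.

Lemma rint_split_v (f : C -> C) x z u t v : x <= z -> u <= t -> t <= v ->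
  (forall p, rect x z u v p -> ccont f p) ->
  rint f x z u v = (rint f x z u t + rint f x z t v)%C.
Proof.
intros Hxz Hut Htv H; unfold rint.
assert (E : forall q, x <= q <= z -> (vint f q u t + vint f q t v)%C = vint f q u v).
{ intros q Hq; unfold vint; rewrite <- (CInt_chasles _ u t v); [ring| |];
  apply vline_icont; intros s; rewrite Rmin_left, Rmax_right by lra;
  intros Hs; apply H; split; simpl; lra. }
rewrite <- !E by lra; ring.
Qed.

(** Near a point of differentiability the affine part of [f] has a primitive and integrates to 0;
    what remains is at most a small multiple of diameter times perimeter, hence of the area, because
    the small rectangles are all similar to the given one. Such bounds add up under bisection, so
    the integral is at most [e] times the total area for every [e]. *)
Lemma goursat (f : C -> C) a b c d : a <= b -> c <= d ->
  (forall z, rect a b c d z -> exists l, wdiff f z l 0) -> rint f a b c d = 0.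
Proof.
intros Hab Hcd H.
assert (Hc : forall z, rect a b c d z -> ccont f z).
{ intros z Hz; destruct (H z Hz) as [l Hl]; eapply wdiff_ccont, Hl. }
destruct (Rle_lt_or_eq_dec a b Hab) as [Hab'|<-].
2: { unfold rint, hint; rewrite !CInt_point; ring. }
destruct (Rle_lt_or_eq_dec c d Hcd) as [Hcd'|<-].
2: { unfold rint, vint; rewrite !CInt_point; ring. }
apply Cmod_eq_0, Rle_antisym; [|apply Cmod_ge_0].
set (s := (b - a) + (d - c)).
(* [K] relates the square of the size of a rectangle proportional to the
   given one to its area. *)
set (K := s * s / ((b - a) * (d - c))).
assert (Har : 0 < (b - a) * (d - c)) by (apply Rmult_lt_0_compat; lra).
assert (Hs : 0 < s) by (unfold s; lra).
assert (HK : 0 < K) by (apply Rdiv_lt_0_compat; [nra|easy]).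
assert (Hall : forall e, 0 < e -> Cmod (rint f a b c d) <= e * ((b - a) * (d - c))).
{ intros e He.
  apply (rectangle_induction (fun x z u v => Cmod (rint f x z u v) <= e * ((z - x) * (v - u))));
    try easy.
  - intros x y z u v ? ? ? ? ? ? ? P1 P2.
    rewrite (rint_split_h f x y z u v); try lra.
    + eapply Rle_trans; [apply Cmod_triangle|]; nra.
    + intros p [? ?]; apply Hc; split; lra.
  - intros x z u t v ? ? ? ? ? ? ? P1 P2.
    rewrite (rint_split_v f x z u t v); try lra.
    + eapply Rle_trans; [apply Cmod_triangle|]; nra.
    + intros p [? ?]; apply Hc; split; lra.
  - intros p q Hp Hq.
    destruct (H (p, q)) as [l Hl]; [split; simpl; lra|].
    (* The 4 is the constant of [rint_bound], and [K] turns the square of the size into the area. *)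
    assert (He' : 0 < e / (4 * K)) by (apply Rdiv_lt_0_compat; lra).
    destruct (Hl _ He') as (r & Hr & Hw).
    exists (r / 2); split; [lra|].
    intros n x z u v ? Hpx ? ? Hqu ? Ew Eh Hx Hv.
    set (g := fun w : C => (f (p, q) + l * (w - (p, q)))%C).
    assert (Hg : forall w, wdiff g w l 0).
    { intros w; eapply wdiff_eq.
      - apply wdiff_plus; [apply wdiff_const|apply wdiff_cmult, wdiff_minus;
          [apply wdiff_id|apply wdiff_const]].
      - ring.
      - ring. }
    assert (Eg : rint g x z u v = 0).
    { apply (rint_primitive (fun w => f (p, q) * w + l * / 2 * ((w - (p, q)) * (w - (p, q))))%C); [lra|lra|].
      intros w _; split; [|eapply wdiff_ccont, Hg].
      eapply wdiff_eq.
      - apply wdiff_plus; [apply wdiff_cmult, wdiff_id|apply wdiff_cmult, wdiff_mult;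
         (apply wdiff_minus; [apply wdiff_id|apply wdiff_const])].
      - unfold g; field.
      - ring. }
    assert (Cg : forall w, rect x z u v w -> ccont f w /\ ccont g w).
    { intros w [? ?]; split; [apply Hc; split; lra|eapply wdiff_ccont, Hg]. }
    replace (rint f x z u v) with (rint (fun w => f w - g w)%C x z u v).
    2: { rewrite rint_minus by (auto; lra); rewrite Eg; ring. }
    set (t := (z - x) + (v - u)).
    apply Rle_trans with (4 * (e / (4 * K) * t) * t).
    + apply rint_bound; [lra|lra|]; intros w Hw'; destruct (Cg w Hw') as [C1 C2].
      split; [now apply ccont_minus|].
      assert (D : Cmod (w - (p, q)) <= t).
      { eapply Rle_trans; [apply Cmod_le_Re_Im|]; destruct w as [w1 w2], Hw' as [W1 W2]; simpl in *.
        unfold t; assert (Rabs (w1 + - p) <= z - x) by (apply Rabs_le; lra).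
        assert (Rabs (w2 + - q) <= v - u) by (apply Rabs_le; lra); lra. }
      specialize (Hw w ltac:(unfold t in *; lra)).
      replace (f w - g w)%C with (f w - f (p, q) - l * (w - (p, q)) - 0 * Cconj (w - (p, q)))%C
        by (unfold g; ring).
      eapply Rle_trans; [exact Hw|]; apply Rmult_le_compat_l; lra.
    + right; unfold t, K, s; rewrite Ew, Eh; field.
      repeat split; try lra; apply pow_nonzero; lra. }
apply Rnot_lt_le; intros Hpos.
(* For this [e] the bound says that the modulus is at most half of itself. *)
specialize (Hall (Cmod (rint f a b c d) / (2 * ((b - a) * (d - c))))).
assert (E : Cmod (rint f a b c d) / (2 * ((b - a) * (d - c))) * ((b - a) * (d - c))
  = Cmod (rint f a b c d) / 2) by (field; lra).
rewrite E in Hall; assert (Hall' := Hall ltac:(apply Rdiv_lt_0_compat; lra)); lra.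
Qed.

Lemma rderiv_eq g t v v' : rderiv g t v -> v = v' -> rderiv g t v'.
Proof. now intros H <-. Qed.

Lemma rderiv_mult f g t u v : rderiv f t u -> rderiv g t v ->
  rderiv (fun s => f s * g s)%C t (u * g t + f t * v).
Proof.
intros Hf Hg; apply rderiv_wdiff in Hf; apply rderiv_wdiff in Hg.
assert (X := wdiff_mult _ _ _ _ _ _ _ Hf Hg).
apply (wdiff_Re_rderiv (fun s => f s * g s)%C) in X; eapply rderiv_eq; [exact X|].
rewrite re_RtoC; field.
Qed.

Lemma rderiv_plus f g t u v : rderiv f t u -> rderiv g t v ->
  rderiv (fun s => f s + g s)%C t (u + v).
Proof.
intros Hf Hg; apply rderiv_wdiff in Hf; apply rderiv_wdiff in Hg.
assert (X := wdiff_plus _ _ _ _ _ _ _ Hf Hg).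
apply (wdiff_Re_rderiv (fun s => f s + g s)%C) in X; eapply rderiv_eq; [exact X|]; field.
Qed.

Lemma rderiv_const c t : rderiv (fun _ => c) t 0.
Proof. split; simpl; auto_derive; auto. Qed.

Lemma rderiv_cmult c f t u : rderiv f t u -> rderiv (fun s => c * f s)%C t (c * u).
Proof.
intros Hf; eapply rderiv_eq; [apply rderiv_mult; [apply rderiv_const|exact Hf]|cbv beta; ring].
Qed.

Lemma rderiv_RtoC (phi : R -> R) t (l : R) :
  is_derive phi t l -> rderiv (fun s => RtoC (phi s)) t l.
Proof. intros H; split; simpl; [exact H|auto_derive; auto]. Qed.

Lemma rderiv_zero g a b : (forall t, Rmin a b <= t <= Rmax a b -> rderiv g t 0) -> g a = g b.
Proof.
intros H.
assert (X := CInt_deriv g (fun _ => RtoC 0) a b H (fun t _ => rcont_const _ _)).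
rewrite CInt_const in X.
replace (g a) with (g b - (g b - g a))%C by ring; rewrite <- X; ring.
Qed.

(** * Compactness of discs *)

(** A property of pairs which holds near each point of the diagonal over a closed disc holds for all
    pairs at a uniform small distance. Uniform continuity, uniform differentiability and a uniform
    neighbourhood of the disc are all instances. *)
Lemma lebesgue_number (Q : C -> C -> Prop) (c : C) (rho : R) :
  (forall p, Cmod (p - c) <= rho -> exists d, 0 < d /\
     forall q q', Cmod (q - p) < d -> Cmod (q' - p) < d -> Q q q') ->
  exists d, 0 < d /\ forall p q, Cmod (p - c) <= rho -> Cmod (q - p) < d -> Q p q.
Proof.
intros H.
(* A point is only known to lie within [2 * d] of the centre of a selected square, and its partner
   within a further [d]: hence the factor 3. *)
set (Good := fun p d => 0 < d /\ forall q q', Cmod (q - c) <= rho ->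
  Cmod (q - p) < 3 * d -> Cmod (q' - p) < 3 * d -> Q q q').
assert (HG : forall p, exists d, Good p d).
{ intros p; destruct (Rle_dec (Cmod (p - c)) rho) as [L|L].
  - destruct (H p L) as (d & Hd & Hq); exists (d / 3); split; [lra|].
    intros q q' _ H1 H2; apply Hq; lra.
  (* Compactness is applied on the square around the disc, so a radius is needed at every point.
     Outside the disc it is chosen so small that the ball misses the disc, and the condition is
     empty. *)
  - exists ((Cmod (p - c) - rho) / 3); split; [lra|]; intros q q' Hq Hq' _.
    assert (T := Cmod_sub_triangle p q c); rewrite (Cmod_sub_sym p q) in T; lra. }
set (D := fun x y => epsilon (inhabits 1) (Good (x, y))).
assert (HD : forall x y, Good (x, y) (D x y)) by (intros; apply epsilon_spec, HG).
destruct (compactness_value_2d (Re c - rho) (Re c + rho) (Im c - rho) (Im c + rho)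
  (fun x y => mkposreal (D x y) (proj1 (HD x y)))) as [d Hd].
exists d; split; [apply cond_pos|]; intros p q Hp Hq.
assert (HRe := Rle_trans _ _ _ (re_le_Cmod (p - c)) Hp).
assert (HIm := Rle_trans _ _ _ (im_le_Cmod (p - c)) Hp).
apply Rabs_le_between in HRe; apply Rabs_le_between in HIm.
destruct p as [x y], c as [c1 c2]; simpl in HRe, HIm.
apply NNPP; intros HN; apply (Hd x y); simpl; try lra.
intros (u & v & Hu & Hv & Hxu & Hyv & Hduv); apply HN.
destruct (HD u v) as [Hpos HQ].
assert (B : Cmod ((x, y) - (u, v)) < 2 * D u v).
{ eapply Rle_lt_trans; [apply Cmod_le_Re_Im|]; simpl; unfold Rminus in *; lra. }
apply HQ; [easy|lra|].
assert (T := Cmod_sub_triangle q (x, y) (u, v)); lra.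
Qed.

Lemma unif_cont f c rho : (forall p, Cmod (p - c) <= rho -> ccont f p) ->
  forall eps, 0 < eps -> exists d, 0 < d /\ forall p q,
    Cmod (p - c) <= rho -> Cmod (q - p) < d -> Cmod (f q - f p) < eps.
Proof.
intros H eps He; apply (lebesgue_number (fun p q => Cmod (f q - f p) < eps)); intros p Hp.
destruct (H p Hp (eps / 2) ltac:(lra)) as (d & Hd & Hw); exists d; split; [easy|].
intros q q' Hq Hq'; assert (X := Hw q Hq); assert (Y := Hw q' Hq').
assert (T := Cmod_sub_triangle (f q') (f p) (f q)); rewrite (Cmod_sub_sym (f p)) in T; lra.
Qed.

Lemma mean_value_bound (h h' : R -> C) M :
  (forall t, 0 <= t <= 1 -> rderiv h t (h' t) /\ Cmod (h' t) <= M) ->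
  Cmod (h 1 - h 0) <= 2 * M.
Proof.
intros H.
assert (HB : forall k k' : R -> R,
  (forall t, 0 <= t <= 1 -> is_derive k t (k' t) /\ Rabs (k' t) <= M) -> Rabs (k 1 - k 0) <= M).
{ intros k k' Hk.
  (* [bounded_variation] asks for the derivative on an interval symmetric about the base point; from
     the midpoint it stays inside [[0, 1]]. *)
  assert (K : forall y, 0 <= y <= 1 -> Rabs (k y - k (1 / 2)) <= M * Rabs (y - 1 / 2)).
  { intros y Hy; apply (bounded_variation k k'); intros t Ht; apply Hk.
    assert (Rabs (y - 1 / 2) <= 1 / 2) by (apply Rabs_le; lra).
    assert (X : Rabs (t - 1 / 2) <= 1 / 2) by lra; apply Rabs_le_between in X; lra. }
  assert (K0 := K 0 ltac:(lra)); assert (K1 := K 1 ltac:(lra)).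
  rewrite Rabs_minus_sym in K0.
  replace (0 - 1 / 2) with (- (1 / 2)) in K0 by ring; rewrite Rabs_Ropp in K0.
  rewrite (Rabs_pos_eq (1 / 2)) in K0 by lra; rewrite (Rabs_pos_eq (1 - 1 / 2)) in K1 by lra.
  replace (k 1 - k 0) with ((k 1 - k (1 / 2)) + (k (1 / 2) - k 0)) by ring.
  eapply Rle_trans; [apply Rabs_triang|]; lra. }
eapply Rle_trans; [apply Cmod_le_Re_Im|].
assert (HR := HB (fun t => Re (h t)) (fun t => Re (h' t))).
assert (HI := HB (fun t => Im (h t)) (fun t => Im (h' t))).
rewrite re_minus.
rewrite im_minus.
apply Rle_trans with (M + M); [|lra]; apply Rplus_le_compat.
- apply HR; intros t Ht; destruct (H t Ht) as [[H1 H2] H3]; split; [exact H1|].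
  eapply Rle_trans; [apply re_le_Cmod|easy].
- apply HI; intros t Ht; destruct (H t Ht) as [[H1 H2] H3]; split; [exact H2|].
  eapply Rle_trans; [apply im_le_Cmod|easy].
Qed.

Lemma segment_rderiv p v t : rderiv (fun t => p + RtoC t * v)%C t v.
Proof.
eapply rderiv_eq.
- apply rderiv_plus; [apply rderiv_const|].
  apply rderiv_mult; [apply (rderiv_RtoC (fun s => s) t 1); auto_derive; auto|apply rderiv_const].
- cbv beta; ring.
Qed.

Definition uniform_wdiff (K : C -> Prop) (F A B : C -> C) : Prop :=
  forall eps, 0 < eps -> exists d, 0 < d /\ forall p v, K p -> Cmod v < d ->
    Cmod (F (p + v) - F p - A p * v - B p * Cconj v)%C <= eps * Cmod v.

(** The mean value inequality is applied on a segment to [F] minus its linear part at a nearby fixed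
    point; continuity of the coefficients bounds the derivative of the difference, and compactness
    removes the dependence on the point. *)
Lemma C1_uniform_wdiff (U : C -> Prop) F A B c rho :
  (forall p, U p -> wdiff F p (A p) (B p) /\ ccont A p /\ ccont B p) ->
  (forall p, Cmod (p - c) <= rho -> near p U) ->
  uniform_wdiff (fun p => Cmod (p - c) <= rho) F A B.
Proof.
intros HF HU eps He.
set (Q := fun p q => Cmod (F q - F p - A p * (q - p) - B p * Cconj (q - p)) <= eps * Cmod (q - p)).
destruct (lebesgue_number Q c rho) as (d & Hd & H).
- intros p Hp; destruct (HF p (near_self _ _ (HU p Hp))) as (_ & CA & CB).
  (* [6 = 4 + 2]: the mean value bound costs [2 * (2 * e)], and passing from the coefficients at [p]
     to those at [q] another [2 * e]. *)
  set (e := eps / 6); assert (He' : 0 < e) by (unfold e; lra).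
  destruct (near_and _ _ _ (HU p Hp) (near_and _ _ _ (CA e He') (CB e He'))) as (d & Hd & Hn).
  exists d; split; [easy|]; intros q q' Hq Hq'; unfold Q.
  set (v := (q' - q)%C).
  assert (Seg : forall t, 0 <= t <= 1 -> Cmod (q + RtoC t * v - p) < d).
  { intros t Ht.
    replace (q + RtoC t * v - p)%C with (RtoC (1 - t) * (q - p) + RtoC t * (q' - p))%C
      by (unfold v; rewrite RtoC_minus; ring).
    eapply Rle_lt_trans; [apply Cmod_triangle|].
    rewrite !Cmod_mult, !Cmod_R_nonneg by lra.
    destruct (Rle_lt_or_eq_dec 0 t (proj1 Ht)) as [Hp'|<-]; nra. }
  set (k := (- (A p * v + B p * Cconj v))%C).
  set (h := fun t : R => (F (q + RtoC t * v) + RtoC t * k)%C).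
  set (h' := fun t : R => ((A (q + RtoC t * v) * v + B (q + RtoC t * v) * Cconj v) + k)%C).
  assert (HX := Cmod_ge_0 v).
  assert (MV : Cmod (h 1 - h 0) <= 2 * (2 * e * Cmod v)).
  { apply (mean_value_bound h h'); intros t Ht; destruct (Hn _ (Seg t Ht)) as (N1 & N2 & N3).
    cbv beta in *; split.
    - unfold h, h'; apply rderiv_plus.
      + apply (wdiff_rderiv F (fun t => q + RtoC t * v)%C); [apply segment_rderiv|now apply HF].
      + eapply rderiv_eq; [apply rderiv_mult; [apply (rderiv_RtoC (fun s => s) t 1); auto_derive; auto|
          apply rderiv_const]|cbv beta; ring].
    - unfold h', k.
      replace (_ + _)%C with ((A (q + RtoC t * v) - A p) * v + (B (q + RtoC t * v) - B p) * Cconj v)%C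
        by ring.
      eapply Rle_trans; [apply Cmod_triangle|]; rewrite !Cmod_mult, Cmod_conj; nra. }
  assert (NA := Hn q Hq); destruct NA as (_ & N2 & N3); cbv beta in *.
  replace (_ - _ - _ - _)%C with ((h 1 - h 0) - ((A q - A p) * v + (B q - B p) * Cconj v))%C.
  2: { unfold h, k, v; replace (q + 1 * (q' - q))%C with q' by ring.
       replace (q + 0 * (q' - q))%C with q by ring; ring. }
  eapply Rle_trans; [apply Cmod_triangle|]; rewrite Cmod_opp.
  assert (T := Cmod_triangle ((A q - A p) * v) ((B q - B p) * Cconj v)).
  rewrite !Cmod_mult, Cmod_conj in T; unfold e in *; nra.
- exists d; split; [easy|]; intros p v Hp Hv.
  specialize (H p (p + v)%C Hp); unfold Q in H.
  replace (p + v - p)%C with v in H by ring; auto.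
Qed.

(** * Integrals over circles *)

(** The quantitative form of differentiation under the integral sign: a first-order expansion which
    is uniform in [t] may be integrated term by term. *)
Lemma CInt_linear_estimate (f g A B : R -> C) v a b M :
  icont f a b -> icont g a b -> icont A a b -> icont B a b ->
  (forall t, Rmin a b <= t <= Rmax a b ->
     Cmod (f t - g t - A t * v - B t * Cconj v) <= M) ->
  Cmod (CInt f a b - CInt g a b - CInt A a b * v - CInt B a b * Cconj v)
    <= 2 * M * Rabs (b - a).
Proof.
intros Hf Hg HA HB H.
assert (HA' : icont (fun t => v * A t)%C a b)
  by (intros t Ht; apply rcont_mult; [apply rcont_const|now apply HA]).
assert (HB' : icont (fun t => Cconj v * B t)%C a b)
  by (intros t Ht; apply rcont_mult; [apply rcont_const|now apply HB]).
assert (H1 : icont (fun t => f t - g t)%C a b)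
  by (intros t Ht; apply rcont_minus; auto).
assert (H2 : icont (fun t => f t - g t - v * A t)%C a b)
  by (intros t Ht; apply (rcont_minus (fun t => f t - g t)%C); auto).
replace (_ - _)%C with (CInt (fun t => f t - g t - v * A t - Cconj v * B t)%C a b).
- apply CInt_bound.
  + intros t Ht; apply (rcont_minus (fun t => f t - g t - v * A t)%C); auto.
  + intros t Ht; eapply Rle_trans; [right|exact (H t Ht)]; f_equal; ring.
- rewrite !CInt_minus, !CInt_cmult by easy; ring.
Qed.

Definition cis (t : R) : C := (cos t, sin t).

Lemma Cmod_cis t : Cmod (cis t) = 1.
Proof.
unfold Cmod, cis; simpl; rewrite !Rmult_1_r.
replace (cos t * cos t + sin t * sin t) with 1; [apply sqrt_1|].
assert (H := sin2_cos2 t); unfold Rsqr in H; lra.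
Qed.

Lemma cis_neg_mult t : (cis t * cis (- t))%C = 1.
Proof.
assert (H := sin2_cos2 t); unfold Rsqr in H; unfold cis; rewrite cos_neg, sin_neg.
apply C_eq; simpl; lra.
Qed.

Lemma Cconj_cis t : Cconj (cis t) = cis (- t).
Proof. unfold cis, Cconj; now rewrite cos_neg, sin_neg. Qed.

Lemma cis_rderiv t : rderiv cis t (Ci * cis t).
Proof.
split; unfold cis; simpl; auto_derive; auto; ring.
Qed.

Lemma cis_neg_rderiv t : rderiv (fun s => cis (- s)) t (- Ci * cis (- t)).
Proof.
split; unfold cis; simpl; auto_derive; auto; ring.
Qed.

Lemma cis_period t : cis (t + 2 * PI) = cis t.
Proof.
unfold cis; rewrite cos_plus, sin_plus, cos_2PI, sin_2PI; f_equal; ring.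
Qed.

Definition circ (z : C) (r t : R) : C := (z + RtoC r * cis t)%C.

Lemma circ_dist z r t : 0 <= r -> Cmod (circ z r t - z) = r.
Proof.
intros Hr; unfold circ; replace (_ - _)%C with (RtoC r * cis t)%C by ring.
rewrite Cmod_mult, Cmod_cis, Cmod_R_nonneg by easy; ring.
Qed.

Lemma circ_rderiv z r t : rderiv (circ z r) t (Ci * (RtoC r * cis t)).
Proof.
eapply rderiv_eq; [apply rderiv_plus; [apply rderiv_const|apply rderiv_cmult, cis_rderiv]|ring].
Qed.

Lemma radius_rderiv z r t : rderiv (fun s => circ z s t) r (cis t).
Proof. apply segment_rderiv. Qed.

(* The weight [w] is one of [1], [exp(it)], [exp(-it)]. *)
Definition circ_int (F : C -> C) (w : R -> C) (z : C) (r : R) : C :=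
  CInt (fun t => F (circ z r t) * w t)%C 0 (2 * PI).

Definition weight (w : R -> C) : Prop := forall t, rcont w t /\ Cmod (w t) <= 1.

Lemma weight_1 : weight (fun _ => RtoC 1).
Proof. intros t; split; [apply rcont_const|rewrite Cmod_1; lra]. Qed.

Lemma weight_cis : weight cis.
Proof. intros t; split; [eapply rderiv_rcont, cis_rderiv|rewrite Cmod_cis; lra]. Qed.

Lemma weight_cis_neg : weight (fun t => cis (- t)).
Proof. intros t; split; [eapply rderiv_rcont, cis_neg_rderiv|rewrite Cmod_cis; lra]. Qed.

Lemma circ_icont F w z r a b : weight w -> (forall t, ccont F (circ z r t)) ->
  icont (fun t => F (circ z r t) * w t)%C a b.
Proof.
intros Hw HF t _; apply rcont_mult; [|apply Hw].
apply (rcont_comp F (circ z r)); [apply HF|eapply rderiv_rcont, circ_rderiv].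
Qed.

Lemma circ_int_bound F w z r M : weight w -> (forall t, ccont F (circ z r t)) ->
  (forall t, Cmod (F (circ z r t)) <= M) -> Cmod (circ_int F w z r) <= 4 * PI * M.
Proof.
intros Hw HF HM; eapply Rle_trans.
- apply (CInt_bound _ _ _ M); [now apply circ_icont|]; intros t _.
  rewrite Cmod_mult; destruct (Hw t) as [_ Ht]; specialize (HM t).
  assert (X := Cmod_ge_0 (F (circ z r t))); assert (Y := Cmod_ge_0 (w t)); nra.
- assert (P := PI_RGT_0); rewrite Rabs_pos_eq by lra; lra.
Qed.

Lemma circ_int_minus F G w z r : weight w ->
  (forall t, ccont F (circ z r t) /\ ccont G (circ z r t)) ->
  circ_int (fun p => F p - G p)%C w z r = (circ_int F w z r - circ_int G w z r)%C.
Proof.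
intros Hw H; unfold circ_int; rewrite <- CInt_minus.
- apply CInt_ext; intros; ring.
- apply circ_icont; [easy|intros; apply H].
- apply circ_icont; [easy|intros; apply H].
Qed.

Lemma circ_int_close F w z r z' r' M : weight w ->
  (forall t, ccont F (circ z r t) /\ ccont F (circ z' r' t)) ->
  (forall t, Cmod (F (circ z' r' t) - F (circ z r t)) <= M) ->
  Cmod (circ_int F w z' r' - circ_int F w z r) <= 4 * PI * M.
Proof.
intros Hw HF HM; unfold circ_int; rewrite <- CInt_minus;
  try (apply circ_icont; [easy|intros; apply HF]).
eapply Rle_trans.
- apply (CInt_bound _ _ _ M).
  + intros t Ht; apply rcont_minus; (apply circ_icont with (a := 0) (b := 2 * PI);
      [easy|intros; apply HF|easy]).
  + intros t _.
    replace (_ - _)%C with ((F (circ z' r' t) - F (circ z r t)) * w t)%C by ring.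
    rewrite Cmod_mult; destruct (Hw t) as [_ Ht]; specialize (HM t).
    assert (X := Cmod_ge_0 (F (circ z' r' t) - F (circ z r t)));
      assert (Y := Cmod_ge_0 (w t)); nra.
- assert (P := PI_RGT_0); rewrite Rabs_pos_eq by lra; lra.
Qed.

Lemma circ_sub z r z' r' t :
  (circ z' r' t - circ z r t)%C = ((z' - z) + RtoC (r' - r) * cis t)%C.
Proof. unfold circ; rewrite RtoC_minus; ring. Qed.

Lemma circ_sub_bound z r z' r' t :
  Cmod (circ z' r' t - circ z r t) <= Cmod (z' - z) + Rabs (r' - r).
Proof.
rewrite circ_sub; eapply Rle_trans; [apply Cmod_triangle|].
rewrite Cmod_mult, Cmod_cis, Cmod_R; lra.
Qed.

Lemma circ_int_joint_cont F w z r : weight w -> 0 <= r ->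
  (forall p, Cmod (p - z) <= r -> near p (ccont F)) ->
  forall eps, 0 < eps -> exists d, 0 < d /\ forall z' r', Cmod (z' - z) + Rabs (r' - r) < d ->
    Cmod (circ_int F w z' r' - circ_int F w z r) < eps.
Proof.
intros Hw Hr HF eps He.
assert (P := PI_RGT_0).
set (Q := fun p q => ccont F q /\ Cmod (F q - F p) <= eps / (8 * PI)).
assert (He' : 0 < eps / (8 * PI)) by (apply Rdiv_lt_0_compat; lra).
destruct (unif_cont F z r) with (eps := eps / (8 * PI)) as (d1 & Hd1 & H1); auto.
{ intros p Hp; apply (near_self _ _ (HF p Hp)). }
destruct (lebesgue_number (fun _ q => ccont F q) z r) as (d2 & Hd2 & H2).
{ intros p Hp; destruct (HF p Hp) as (d & Hd & H); exists d; auto. }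
exists (Rmin d1 d2); split; [now apply Rmin_glb_lt|]; intros z' r' Hd.
assert (B := fun t => Rle_lt_trans _ _ _ (circ_sub_bound z r z' r' t) Hd).
assert (K : forall t, Cmod (circ z r t - z) <= r) by (intros; rewrite circ_dist; lra).
apply Rle_lt_trans with (4 * PI * (eps / (8 * PI))).
- apply circ_int_close; auto.
  + intros t; split; [apply (near_self _ _ (HF _ (K t)))|].
    apply (H2 (circ z r t)); auto; eapply Rlt_le_trans; [apply B|apply Rmin_r].
  + intros t; apply Rlt_le, H1; auto; eapply Rlt_le_trans; [apply B|apply Rmin_l].
- replace (4 * PI * (eps / (8 * PI))) with (eps / 2) by (field; lra); lra.
Qed.

Lemma circ_int_rcont F w z r : weight w -> 0 <= r ->
  (forall p, Cmod (p - z) <= r -> near p (ccont F)) -> rcont (circ_int F w z) r.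
Proof.
intros Hw Hr HF; apply rcont_eps; intros eps He.
destruct (circ_int_joint_cont F w z r Hw Hr HF eps He) as (d & Hd & H).
exists d; split; [easy|]; intros s Hs; apply H.
replace (z - z)%C with (RtoC 0) by ring; rewrite Cmod_0; lra.
Qed.

Lemma circ_int_ccont F w z r : weight w -> 0 <= r ->
  (forall p, Cmod (p - z) <= r -> near p (ccont F)) -> ccont (fun z => circ_int F w z r) z.
Proof.
intros Hw Hr HF eps He.
destruct (circ_int_joint_cont F w z r Hw Hr HF eps He) as (d & Hd & H).
exists d; split; [easy|]; intros z' Hz; apply H.
replace (r - r) with 0 by ring; rewrite Rabs_R0; lra.
Qed.

(** One expansion moves centre and radius together: [s = 0] gives the derivatives in the centre,
    [v = 0] the derivative in the radius. It is uniform in [r] because the Cauchy transform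
    integrates over the radius afterwards. *)
Lemma circ_int_uniform (U : C -> Prop) F A B w z rho : weight w ->
  (forall p, U p -> wdiff F p (A p) (B p) /\ ccont A p /\ ccont B p) ->
  (forall p, Cmod (p - z) <= rho -> near p U) ->
  forall eps, 0 < eps -> exists d, 0 < d /\ forall r v s, 0 <= r <= rho -> Cmod v + Rabs s < d ->
    Cmod (CInt (fun t => F (circ (z + v) (r + s) t) * w t) 0 (2 * PI) -
      circ_int F w z r - CInt (fun t => A (circ z r t) * ((v + RtoC s * cis t) * w t)) 0 (2 * PI)
       - CInt (fun t => B (circ z r t) * (Cconj (v + RtoC s * cis t) * w t)) 0 (2 * PI))%C
      <= 4 * PI * eps * (Cmod v + Rabs s).
Proof.
intros Hw HF HU eps He.
destruct (C1_uniform_wdiff U F A B z rho HF HU eps He) as (d1 & Hd1 & H1).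
destruct (lebesgue_number (fun _ q => U q) z rho) as (d2 & Hd2 & H2).
{ intros p Hp; destruct (HU p Hp) as (d & Hd & H); exists d; auto. }
exists (Rmin d1 d2); split; [now apply Rmin_glb_lt|]; intros r v s Hr Hd.
assert (K : forall t, Cmod (circ z r t - z) <= rho) by (intros; rewrite circ_dist; lra).
set (u := fun t => (v + RtoC s * cis t)%C).
assert (Eu : forall t, circ (z + v) (r + s) t = (circ z r t + u t)%C)
  by (intros; unfold circ, u; rewrite RtoC_plus; ring).
assert (Bu : forall t, Cmod (u t) <= Cmod v + Rabs s).
{ intros t; unfold u; eapply Rle_trans; [apply Cmod_triangle|].
  rewrite Cmod_mult, Cmod_cis, Cmod_R; lra. }
assert (Cu : forall t, rcont u t).
{ intros t; apply rcont_plus; [apply rcont_const|apply rcont_mult;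
   [apply rcont_const|eapply rderiv_rcont, cis_rderiv]]. }
assert (Hcirc : forall t, rcont (circ z r) t) by (intros; eapply rderiv_rcont, circ_rderiv).
assert (I1 : icont (fun t => F (circ (z + v) (r + s) t) * w t)%C 0 (2 * PI)).
{ apply circ_icont; [easy|]; intros t; rewrite Eu.
  eapply wdiff_ccont, HF, (H2 (circ z r t)); auto.
  replace (_ - _)%C with (u t) by ring.
  eapply Rle_lt_trans; [apply Bu|]; eapply Rlt_le_trans; [exact Hd|apply Rmin_r]. }
assert (I2 : icont (fun t => F (circ z r t) * w t)%C 0 (2 * PI)).
{ apply circ_icont; [easy|]; intros t; eapply wdiff_ccont, HF, near_self, HU, K. }
assert (I3 : icont (fun t => A (circ z r t) * (u t * w t))%C 0 (2 * PI)).
{ intros t _; apply rcont_mult; [|apply rcont_mult; [apply Cu|apply Hw]].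
  apply (rcont_comp A (circ z r)); [apply HF, near_self, HU, K|apply Hcirc]. }
assert (I4 : icont (fun t => B (circ z r t) * (Cconj (u t) * w t))%C 0 (2 * PI)).
{ intros t _; apply rcont_mult; [|apply rcont_mult; [|apply Hw]].
  - apply (rcont_comp B (circ z r)); [apply HF, near_self, HU, K|apply Hcirc].
  - apply (rcont_comp Cconj u); [eapply wdiff_ccont, wdiff_conj_id|apply Cu]. }
unfold circ_int; fold u.
(* The increment [u t] varies with [t], so it is absorbed into the coefficient functions and the
   estimate is used with increment 1. *)
assert (X := CInt_linear_estimate _ _ _ _ 1 0 (2 * PI) (eps * (Cmod v + Rabs s)) I1 I2 I3 I4).
rewrite Cconj_RtoC in X.
rewrite !Cmult_1_r in X; eapply Rle_trans; [apply X|].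
- intros t _; rewrite Eu, !Cmult_1_r.
  replace (_ - _ - _ - _)%C with
   ((F (circ z r t + u t) - F (circ z r t) - A (circ z r t) * u t - B (circ z r t) * Cconj (u t))
    * w t)%C by ring.
  rewrite Cmod_mult; destruct (Hw t) as [_ Ht].
  assert (Y := H1 (circ z r t) (u t) (K t)); specialize (Bu t).
  assert (Y' := Y ltac:(eapply Rle_lt_trans; [apply Bu|]; eapply Rlt_le_trans; [exact Hd|apply Rmin_l])).
  assert (Z := Cmod_ge_0 (w t)).
  assert (Z' := Cmod_ge_0 (F (circ z r t + u t)%C - F (circ z r t) - A (circ z r t) * u t
     - B (circ z r t) * Cconj (u t))).
  assert (0 <= eps * Cmod (u t)) by (apply Rmult_le_pos; [lra|apply Cmod_ge_0]).
  assert (eps * Cmod (u t) <= eps * (Cmod v + Rabs s)) by (apply Rmult_le_compat_l; lra).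
  rewrite <- (Rmult_1_r (eps * (Cmod v + Rabs s))); apply Rmult_le_compat; lra.
- assert (P := PI_RGT_0); rewrite (Rabs_pos_eq (2 * PI - 0)) by lra; right; ring.
Qed.

Lemma circ_int_uniform_center (U : C -> Prop) F A B w z rho : weight w ->
  (forall p, U p -> wdiff F p (A p) (B p) /\ ccont A p /\ ccont B p) ->
  (forall p, Cmod (p - z) <= rho -> near p U) ->
  forall eps, 0 < eps -> exists d, 0 < d /\ forall r z', 0 <= r <= rho -> Cmod (z' - z) < d ->
    Cmod (circ_int F w z' r - circ_int F w z r - circ_int A w z r * (z' - z)
      - circ_int B w z r * Cconj (z' - z)) <= eps * Cmod (z' - z).
Proof.
intros Hw HF HU eps He.
assert (P := PI_RGT_0).
destruct (circ_int_uniform U F A B w z rho Hw HF HU (eps / (4 * PI))) as (d & Hd & H).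
{ apply Rdiv_lt_0_compat; lra. }
exists d; split; [easy|]; intros r z' Hr Hz.
specialize (H r (z' - z)%C 0); rewrite Rabs_R0, !Rplus_0_r in H.
replace (z + (z' - z))%C with z' in H by ring.
assert (IA : icont (fun t => A (circ z r t) * w t)%C 0 (2 * PI)).
{ apply circ_icont; auto; intros t; apply HF, near_self, HU; rewrite circ_dist; lra. }
assert (IB : icont (fun t => B (circ z r t) * w t)%C 0 (2 * PI)).
{ apply circ_icont; auto; intros t; apply HF, near_self, HU; rewrite circ_dist; lra. }
specialize (H ltac:(lra) Hz).
replace (eps * Cmod (z' - z)) with (4 * PI * (eps / (4 * PI)) * Cmod (z' - z)) by (field; lra).
eapply Rle_trans; [right|exact H]; f_equal.
unfold circ_int; f_equal; [f_equal|].
- rewrite Cmult_comm, <- CInt_cmult by easy; apply CInt_ext; intros; ring.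
- rewrite Cmult_comm, <- CInt_cmult by easy; apply CInt_ext; intros t _.
  replace (z' - z + 0 * cis t)%C with (z' - z)%C by ring; ring.
Qed.

Lemma circ_int_wdiff (U : C -> Prop) F A B w z r : weight w -> 0 <= r ->
  (forall p, U p -> wdiff F p (A p) (B p) /\ ccont A p /\ ccont B p) ->
  (forall p, Cmod (p - z) <= r -> near p U) ->
  wdiff (fun z => circ_int F w z r) z (circ_int A w z r) (circ_int B w z r).
Proof.
intros Hw Hr HF HU eps He.
destruct (circ_int_uniform_center U F A B w z r Hw HF HU eps He) as (d & Hd & H).
exists d; split; [easy|]; intros z' Hz; apply H; [lra|easy].
Qed.

Lemma circ_int_rderiv (U : C -> Prop) F A B z r : 0 <= r ->
  (forall p, U p -> wdiff F p (A p) (B p) /\ ccont A p /\ ccont B p) ->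
  (forall p, Cmod (p - z) <= r -> near p U) ->
  forall w, weight w -> rderiv (circ_int F w z) r
    (CInt (fun t => A (circ z r t) * (cis t * w t) + B (circ z r t) * (cis (- t) * w t))%C 0 (2 * PI)).
Proof.
intros Hr HF HU w Hw; apply rderiv_eps; intros eps He.
assert (P := PI_RGT_0).
destruct (circ_int_uniform U F A B w z r Hw HF HU (eps / (4 * PI))) as (d & Hd & H).
{ apply Rdiv_lt_0_compat; lra. }
exists d; split; [easy|]; intros r' Hr'.
specialize (H r 0%C (r' - r)); rewrite Cmod_0, Rplus_0_l in H.
replace (r + (r' - r)) with r' in H by ring.
assert (Hc : forall t, U (circ z r t)).
{ intros t; apply near_self, HU; rewrite circ_dist; lra. }
assert (Hcirc : forall t, rcont (circ z r) t) by (intros; eapply rderiv_rcont, circ_rderiv).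
assert (IA : icont (fun t => A (circ z r t) * (cis t * w t))%C 0 (2 * PI)).
{ intros t _; apply rcont_mult; [|apply rcont_mult; [apply weight_cis|apply Hw]].
  apply (rcont_comp A (circ z r)); [apply HF, Hc|apply Hcirc]. }
assert (IB : icont (fun t => B (circ z r t) * (cis (- t) * w t))%C 0 (2 * PI)).
{ intros t _; apply rcont_mult; [|apply rcont_mult; [apply weight_cis_neg|apply Hw]].
  apply (rcont_comp B (circ z r)); [apply HF, Hc|apply Hcirc]. }
specialize (H ltac:(lra) Hr').
replace (eps * Rabs (r' - r)) with (4 * PI * (eps / (4 * PI)) * Rabs (r' - r)) by (field; lra).
eapply Rle_trans; [right|exact H]; f_equal.
rewrite CInt_plus by easy; unfold circ_int at 1.
replace (CInt (fun t => A (circ z r t) * ((0 + RtoC (r' - r) * cis t) * w t))%C 0 (2 * PI))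
  with (RtoC (r' - r) * CInt (fun t => A (circ z r t) * (cis t * w t))%C 0 (2 * PI))%C.
2: { rewrite <- CInt_cmult by easy; apply CInt_ext; intros; ring. }
replace (CInt (fun t => B (circ z r t) * (Cconj (0 + RtoC (r' - r) * cis t) * w t))%C 0 (2 * PI))
  with (RtoC (r' - r) * CInt (fun t => B (circ z r t) * (cis (- t) * w t))%C 0 (2 * PI))%C.
2: { rewrite <- CInt_cmult by easy; apply CInt_ext; intros; rewrite Cplus_conj, Cmult_conj, Cconj_cis.
  rewrite Cconj_RtoC.
  rewrite Cconj_RtoC; ring. }
rewrite (CInt_ext (fun t => F (circ (z + 0) r' t) * w t)%C (fun t => F (circ z r' t) * w t)%C).
- unfold circ_int; ring.
- intros t _; now rewrite Cplus_0_r.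
Qed.

(** * Holomorphic functions *)

Definition hol (U : C -> Prop) (f : C -> C) : Prop :=
  forall z, U z -> exists l, wdiff f z l 0.

Lemma cis_0 : cis 0 = 1.
Proof. unfold cis; rewrite cos_0, sin_0; reflexivity. Qed.

Lemma circ_2PI z r : circ z r (2 * PI) = circ z r 0.
Proof. unfold circ; rewrite <- (Rplus_0_l (2 * PI)), cis_period; reflexivity. Qed.

Lemma two_PI_neq_0 : RtoC (2 * PI) <> 0.
Proof. apply RtoC_neq_0; assert (P := PI_RGT_0); lra. Qed.

(* Integrating by parts over the circle gives [J s = s M s], and [J' = M];
   hence [J s / s] does not depend on [s], and its limit at 0 is [2 pi g p]. *)
Lemma cauchy_derivative_formula (U : C -> Prop) (G g : C -> C) p r : 0 < r ->
  (forall q, U q -> wdiff G q (g q) 0 /\ ccont g q) ->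
  (forall q, Cmod (q - p) <= r -> near q U) ->
  g p = (/ RtoC (2 * PI * r) * circ_int G (fun t => cis (- t)) p r)%C.
Proof.
intros Hr HG HU.
assert (HG' : forall q, U q -> wdiff G q (g q) 0 /\ ccont g q /\ ccont (fun _ => RtoC 0) q).
{ intros q Hq; destruct (HG q Hq); repeat split; auto; apply ccont_const. }
set (J := circ_int G (fun t => cis (- t)) p); set (M := circ_int g (fun _ => RtoC 1) p).
assert (Hin : forall s t, 0 <= s <= r -> U (circ p s t)).
{ intros s t Hs; apply near_self, HU; rewrite circ_dist; lra. }
assert (JM : forall s, 0 <= s <= r -> J s = (RtoC s * M s)%C).
{ intros s Hs; unfold J, M, circ_int.
  assert (I1 : icont (fun t => G (circ p s t) * cis (- t))%C 0 (2 * PI)).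
  { apply (circ_icont G (fun t => cis (- t))); [apply weight_cis_neg|].
    intros t; eapply wdiff_ccont, HG, Hin, Hs. }
  assert (I2 : icont (fun t => g (circ p s t) * 1)%C 0 (2 * PI)).
  { apply (circ_icont g (fun _ => RtoC 1)); [apply weight_1|]; intros t; apply HG, Hin, Hs. }
  assert (I3 : icont (fun t => RtoC s * (g (circ p s t) * 1))%C 0 (2 * PI)).
  { intros t Ht; apply rcont_mult; [apply rcont_const|now apply I2]. }
  rewrite <- CInt_cmult by easy.
  replace (CInt (fun t => G (circ p s t) * cis (- t))%C 0 (2 * PI)) with
    (CInt (fun t => G (circ p s t) * cis (- t))%C 0 (2 * PI) -
     CInt (fun t => RtoC s * (g (circ p s t) * 1))%C 0 (2 * PI) +
     CInt (fun t => RtoC s * (g (circ p s t) * 1))%C 0 (2 * PI))%C by ring.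
  rewrite <- CInt_minus by easy.
  rewrite (CInt_deriv (fun t => G (circ p s t) * (Ci * cis (- t)))%C).
  - rewrite circ_2PI.
    replace (cis (- (2 * PI))) with (cis (- 0)); [ring|].
    rewrite <- (cis_period (- (2 * PI))); f_equal; ring.
  - intros t _; eapply rderiv_eq.
    + apply rderiv_mult; [apply (wdiff_rderiv G (circ p s)); [apply circ_rderiv|apply HG, Hin, Hs]|].
      apply rderiv_cmult, cis_neg_rderiv.
    + cbv beta.
      transitivity ((Ci * Ci) * RtoC s * g (circ p s t) * (cis t * cis (- t))
        - (Ci * Ci) * G (circ p s t) * cis (- t))%C; [ring|].
      rewrite cis_neg_mult; rewrite Ci_sqr; ring.
  - intros t Ht; apply rcont_minus; [now apply I1|now apply I3]. }
assert (DJ : forall s, 0 < s <= r -> rderiv J s (M s)).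
{ intros s Hs; eapply rderiv_eq.
  - apply (circ_int_rderiv U G g (fun _ => RtoC 0)); [lra|easy| |apply weight_cis_neg].
    intros q Hq; apply HU; lra.
  - unfold M, circ_int; apply CInt_ext; intros t _; rewrite cis_neg_mult; ring. }
assert (Mconst : forall e, 0 < e <= r -> M e = M r).
{ intros e He.
  assert (X : (J e * RtoC (/ e) = J r * RtoC (/ r))%C).
  { apply (rderiv_zero (fun s => J s * RtoC (/ s))%C); intros s.
    rewrite Rmin_left, Rmax_right by lra; intros Hs.
    eapply rderiv_eq.
    - apply rderiv_mult; [apply DJ; lra|].
      apply (rderiv_RtoC Rinv s (- (/ s * / s))); auto_derive; [lra|field; lra].
    - cbv beta; rewrite JM, RtoC_opp, RtoC_mult, RtoC_inv by lra.
      field; apply RtoC_neq_0; lra. }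
  rewrite !JM, !RtoC_inv in X by lra.
  assert (e <> 0 :> C) by (apply RtoC_neq_0; lra).
  assert (r <> 0 :> C) by (apply RtoC_neq_0; lra).
  transitivity (RtoC e * M e * / RtoC e)%C; [field; easy|rewrite X; field; easy]. }
assert (M0 : M 0 = (RtoC (2 * PI) * g p)%C).
{ unfold M, circ_int.
  rewrite (CInt_ext _ (fun _ => g p)).
  - rewrite CInt_const, Rminus_0_r; ring.
  - intros t _; unfold circ; rewrite Cmult_0_l, Cplus_0_r; ring. }
assert (MC : M r = M 0).
{ assert (X : (M r - M 0 = 0)%C).
  { apply Cmod_eq_0, Rle_antisym; [|apply Cmod_ge_0]; apply Rnot_lt_le; intros Hp.
    assert (Hcont : rcont M 0).
    { apply circ_int_rcont; [apply weight_1|lra|]; intros q Hq.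
      eapply near_imp; [|apply HU; lra]; intros q' Hq'; now apply HG. }
    destruct (proj1 (rcont_eps _ _) Hcont _ Hp) as (d & Hd & H).
    set (s := Rmin (d / 2) r).
    assert (Hs : 0 < s) by (apply Rmin_glb_lt; lra).
    assert (Hs1 : s <= d / 2) by apply Rmin_l; assert (Hs2 : s <= r) by apply Rmin_r.
    specialize (H s); rewrite Rminus_0_r, Rabs_pos_eq in H by lra.
    rewrite Mconst in H by lra; specialize (H ltac:(lra)); lra. }
  replace (M r) with (M r - M 0 + M 0)%C by ring; rewrite X; ring. }
fold (J r); rewrite JM, MC, M0, RtoC_mult by lra.
assert (P := two_PI_neq_0).
field; split; [apply RtoC_neq_0; lra|easy].
Qed.

Lemma near_disc (p : C) U : near p U -> exists r, 0 < r /\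
  forall q q', Cmod (q - p) < r -> Cmod (q' - q) <= r -> near q' U.
Proof.
intros (d & Hd & Hn); exists (d / 4); split; [lra|]; intros q q' Hq Hq'.
exists (d / 4); split; [lra|]; intros u Hu; apply Hn.
assert (T1 := Cmod_sub_triangle u q' p); assert (T2 := Cmod_sub_triangle q' q p); lra.
Qed.

Lemma Cmod_diag (p : C) : Cmod (p - p) = 0.
Proof. replace (p - p)%C with (RtoC 0) by ring; apply Cmod_0. Qed.

(** For a fixed radius, [cauchy_derivative_formula] writes [g] as a weighted mean of [G] over a
    circle with moving centre, which can be differentiated under the integral. The derivative is
    given explicitly so that its continuity can be read off in [hol_Cder]. *)
Lemma derivative_wdiff (U : C -> Prop) (G g : C -> C) p : near p U ->
  (forall q, U q -> wdiff G q (g q) 0 /\ ccont g q) -> exists r, 0 < r /\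
    forall q, Cmod (q - p) < r ->
      wdiff g q (/ RtoC (2 * PI * r) * circ_int g (fun t => cis (- t)) q r) 0 /\
      forall q', Cmod (q' - q) <= r -> near q' U.
Proof.
intros HU HG; destruct (near_disc p U HU) as (r & Hr & HN); exists r; split; [easy|].
intros q Hq; split; [|intros q' Hq'; now apply (HN q)].
apply (wdiff_ext_near (fun q => / RtoC (2 * PI * r) * circ_int G (fun t => cis (- t)) q r)%C).
{ exists (r - Cmod (q - p)); split; [lra|]; intros q1 Hq1; symmetry.
  apply (cauchy_derivative_formula U G g); auto; intros q' Hq'; apply (HN q1); [|easy].
  assert (T := Cmod_sub_triangle q1 q p); lra. }
eapply wdiff_eq.
- apply wdiff_cmult, (circ_int_wdiff U G g (fun _ => RtoC 0)); [apply weight_cis_neg|lra| |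
    intros q' Hq'; now apply (HN q)].
  intros u Hu; destruct (HG u Hu); repeat split; auto; apply ccont_const.
- reflexivity.
- unfold circ_int; rewrite (CInt_ext _ (fun _ => RtoC 0)) by (intros; ring).
  rewrite CInt_const; ring.
Qed.

Lemma derivative_hol (U : C -> Prop) (G g : C -> C) p : near p U ->
  (forall q, U q -> wdiff G q (g q) 0 /\ ccont g q) -> exists l, wdiff g p l 0.
Proof.
intros HU HG; destruct (derivative_wdiff U G g p HU HG) as (r & Hr & H).
eexists; apply H; now rewrite Cmod_diag.
Qed.

(** * Morera's theorem and its consequences *)

Definition square (c : C) (rho : R) (z : C) : Prop :=
  Rabs (Re z - Re c) < rho /\ Rabs (Im z - Im c) < rho.

Definition box (z w p : C) : Prop :=
  rect (Rmin (Re z) (Re w)) (Rmax (Re z) (Re w)) (Rmin (Im z) (Im w)) (Rmax (Im z) (Im w)) p.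

Lemma between_square x y u rho t : Rabs (x - u) < rho -> Rabs (y - u) < rho ->
  Rmin x y <= t <= Rmax x y -> Rabs (t - u) < rho.
Proof.
intros Hx Hy Ht; apply Rabs_def2 in Hx; apply Rabs_def2 in Hy.
unfold Rmin, Rmax in Ht; destruct (Rle_dec x y); apply Rabs_def1; lra.
Qed.

Lemma box_square c rho z w p : square c rho z -> square c rho w -> box z w p -> square c rho p.
Proof.
intros [Z1 Z2] [W1 W2] [P1 P2]; split.
- exact (between_square (Re z) (Re w) (Re c) rho (Re p) Z1 W1 P1).
- exact (between_square (Im z) (Im w) (Im c) rho (Im p) Z2 W2 P2).
Qed.

Lemma square_near c rho z : square c rho z -> near z (square c rho).
Proof.
intros [H1 H2]; exists (Rmin (rho - Rabs (Re z - Re c)) (rho - Rabs (Im z - Im c))).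
split; [apply Rmin_glb_lt; lra|]; intros w Hw.
assert (A1 := Rle_lt_trans _ _ _ (re_le_Cmod (w - z)) (Rlt_le_trans _ _ _ Hw (Rmin_l _ _))).
assert (A2 := Rle_lt_trans _ _ _ (im_le_Cmod (w - z)) (Rlt_le_trans _ _ _ Hw (Rmin_r _ _))).
rewrite re_minus in A1.
rewrite im_minus in A2.
split.
- replace (Re w - Re c) with ((Re w - Re z) + (Re z - Re c)) by ring.
  eapply Rle_lt_trans; [apply Rabs_triang|]; lra.
- replace (Im w - Im c) with ((Im w - Im z) + (Im z - Im c)) by ring.
  eapply Rle_lt_trans; [apply Rabs_triang|]; lra.
Qed.

Lemma square_center c rho : 0 < rho -> square c rho c.
Proof. intros H; split; rewrite Rminus_diag, Rabs_R0; easy. Qed.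

Lemma near_square z P : near z P -> exists rho, 0 < rho /\ forall w, square z rho w -> P w.
Proof.
intros (d & Hd & H); exists (d / 2); split; [lra|]; intros w [W1 W2]; apply H.
eapply Rle_lt_trans; [apply Cmod_le_Re_Im|].
rewrite re_minus.
rewrite im_minus; lra.
Qed.

Lemma rint_swap_h (f : C -> C) a b c d :
  (forall z, box (a, c) (b, d) z -> ccont f z) -> rint f b a c d = (- rint f a b c d)%C.
Proof.
intros H; unfold rint, hint.
rewrite !(CInt_swap (fun t => f (t, _)) a b); [ring| |];
  apply hline_icont; intros t Ht; apply H; split; simpl; auto using Rmin_l, Rmin_r, Rmax_l, Rmax_r.
Qed.

Lemma rint_swap_v (f : C -> C) a b c d :
  (forall z, box (a, c) (b, d) z -> ccont f z) -> rint f a b d c = (- rint f a b c d)%C.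
Proof.
intros H; unfold rint, vint.
rewrite !(CInt_swap (fun t => f (_, t)) c d); [ring| |];
  apply vline_icont; intros t Ht; apply H; split; simpl; auto using Rmin_l, Rmin_r, Rmax_l, Rmax_r.
Qed.

Lemma rint_zero_wlog (f : C -> C) a b c d :
  (forall z, box (a, c) (b, d) z -> ccont f z) ->
  rint f (Rmin a b) (Rmax a b) (Rmin c d) (Rmax c d) = 0 -> rint f a b c d = 0.
Proof.
intros H.
assert (O : forall x : C, (- x = 0)%C -> x = 0).
{ intros x Hx; replace x with (- - x)%C by ring; rewrite Hx; ring. }
assert (B1 : forall z, box (b, c) (a, d) z -> ccont f z).
{ intros z [Z1 Z2]; apply H; split; simpl in *; [|easy]; now rewrite Rmin_comm, Rmax_comm. }
assert (B2 : forall z, box (a, d) (b, c) z -> ccont f z).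
{ intros z [Z1 Z2]; apply H; split; simpl in *; [easy|]; now rewrite (Rmin_comm c), (Rmax_comm c). }
unfold Rmin at 1, Rmax at 1; destruct (Rle_dec a b); unfold Rmin, Rmax; destruct (Rle_dec c d);
  intros E; auto.
- apply O; now rewrite <- rint_swap_v.
- apply O; now rewrite <- rint_swap_h.
- apply O; rewrite <- rint_swap_h by easy; apply O; now rewrite <- rint_swap_v.
Qed.

Lemma goursat_box (f : C -> C) c p :
  (forall z, box c p z -> exists l, wdiff f z l 0) ->
  rint f (Re c) (Re p) (Im c) (Im p) = 0.
Proof.
intros H; apply rint_zero_wlog.
- destruct c, p; intros z Hz; destruct (H z Hz) as [l Hl]; eapply wdiff_ccont, Hl.
- apply goursat; [apply Rminmax|apply Rminmax|exact H].
Qed.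

Lemma CInt_near_const f c a b e : icont f a b ->
  (forall t, Rmin a b <= t <= Rmax a b -> Cmod (f t - c) <= e) ->
  Cmod (CInt f a b - c * RtoC (b - a)) <= 2 * e * Rabs (b - a).
Proof.
intros Hf H; assert (Hk : icont (fun _ => c) a b) by (intros t _; apply rcont_const).
rewrite <- CInt_const, <- CInt_minus by easy.
apply CInt_bound; [|easy]; intros t Ht; apply rcont_minus; [now apply Hf|apply rcont_const].
Qed.

(** The primitive is the integral along a horizontal and then a vertical segment from the centre. By
    hypothesis the other order gives the same value, so that each increment can be computed with the
    path whose last segment points in its direction. *)
Lemma square_primitive (f : C -> C) c rho :
  (forall p, square c rho p -> ccont f p) ->
  (forall p, square c rho p -> rint f (Re c) (Re p) (Im c) (Im p) = 0) ->
  exists F, forall p, square c rho p -> wdiff F p (f p) 0.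
Proof.
intros Hc Hz.
set (F := fun p : C => (hint f (Re c) (Re p) (Im c) + vint f (Re p) (Im c) (Im p))%C).
assert (F' : forall p, square c rho p ->
  F p = (vint f (Re c) (Im c) (Im p) + hint f (Re c) (Re p) (Im p))%C).
{ intros p Hp; specialize (Hz p Hp); unfold rint in Hz; unfold F.
  match goal with |- ?l = ?r => replace l with (l - r + r)%C by ring end.
  match type of Hz with ?l = _ => match goal with |- (?k + _)%C = _ => replace k with l by ring end end.
  rewrite Hz; ring. }
exists F; intros p Hp eps He.
destruct (near_and _ _ _ (square_near _ _ _ Hp) (Hc p Hp (eps / 4) ltac:(lra))) as (d & Hd & Hn).
exists (d / 2); split; [lra|]; intros q Hq.
assert (X1 : Rabs (Re q - Re p) <= Cmod (q - p)).
{ apply re_minus_le. }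
assert (X2 : Rabs (Im q - Im p) <= Cmod (q - p)).
{ apply im_minus_le. }
(* The corner between [p] and [q]: the vertical step from [m] to [q] uses the definition of [F], the
   horizontal step from [p] to [m] the other formula [F']. *)
set (m := (Re q, Im p)).
assert (Hm : square c rho m).
{ apply (Hn m); eapply Rle_lt_trans; [apply Cmod_le_Re_Im|]; unfold m; simpl.
  replace (Im p + - snd p) with 0 by (unfold Im; ring); rewrite Rabs_R0.
  unfold Re, Rminus in *; lra. }
assert (Hsq : square c rho q) by (apply (Hn q); lra).
assert (C0 : square c rho c).
{ apply square_center; destruct Hp as [A _]; assert (T := Rabs_pos (Re p - Re c)); lra. }
assert (E1 : (F q - F m = vint f (Re q) (Im p) (Im q))%C).
{ unfold F, m; simpl; unfold vint.
  rewrite <- (CInt_chasles _ (Im c) (Im p) (Im q)); [ring| |].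
  - apply vline_icont; intros t Ht; apply Hc; split; [apply Hm|].
    exact (between_square _ _ _ _ _ (proj2 C0) (proj2 Hp) Ht).
  - apply vline_icont; intros t Ht; apply Hc; split; [apply Hm|].
    exact (between_square _ _ _ _ _ (proj2 Hp) (proj2 Hsq) Ht). }
assert (E2 : (F m - F p = hint f (Re p) (Re q) (Im p))%C).
{ rewrite !F' by easy; unfold m; simpl; unfold hint.
  rewrite <- (CInt_chasles _ (Re c) (Re p) (Re q)); [unfold vint; ring| |].
  - apply hline_icont; intros t Ht; apply Hc; split; [|apply Hp].
    exact (between_square _ _ _ _ _ (proj1 C0) (proj1 Hp) Ht).
  - apply hline_icont; intros t Ht; apply Hc; split; [|apply Hp].
    exact (between_square _ _ _ _ _ (proj1 Hp) (proj1 Hsq) Ht). }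
assert (K1 : Cmod (hint f (Re p) (Re q) (Im p) - f p * RtoC (Re q - Re p)) <= 2 * (eps / 4) * Rabs (Re q - Re p)).
{ assert (B : forall t, Rmin (Re p) (Re q) <= t <= Rmax (Re p) (Re q) ->
     square c rho (t, Im p) /\ Cmod (f (t, Im p) - f p) < eps / 4).
  { intros t Ht; apply Hn; eapply Rle_lt_trans; [apply Cmod_le_Re_Im|]; simpl.
    replace (Im p + - snd p) with 0 by (unfold Im; ring); rewrite Rabs_R0.
    assert (T := between_square (Re p) (Re q) (Re p) d t); unfold Re, Rminus in *.
    rewrite Rplus_opp_r, Rabs_R0 in T; specialize (T Hd ltac:(lra) Ht); lra. }
  apply CInt_near_const.
  - apply hline_icont; intros t Ht; now apply Hc, B.
  - intros t Ht; apply Rlt_le, B, Ht. }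
assert (K2 : Cmod (vint f (Re q) (Im p) (Im q) - Ci * f p * RtoC (Im q - Im p)) <= 2 * (eps / 4) * Rabs (Im q - Im p)).
{ assert (B : forall t, Rmin (Im p) (Im q) <= t <= Rmax (Im p) (Im q) ->
     square c rho (Re q, t) /\ Cmod (f (Re q, t) - f p) < eps / 4).
  { intros t Ht; apply Hn; eapply Rle_lt_trans; [apply Cmod_le_Re_Im|]; simpl.
    assert (T := between_square (Im p) (Im q) (Im p) (d / 2) t); unfold Re, Im, Rminus in *.
    rewrite Rplus_opp_r, Rabs_R0 in T; specialize (T ltac:(lra) ltac:(lra) Ht); lra. }
  unfold vint.
  replace (Ci * _ - Ci * _ * _)%C with (Ci * (CInt (fun s => f (Re q, s)) (Im p) (Im q) - f p * RtoC (Im q - Im p)))%C by ring.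
  rewrite Cmod_mult, Cmod_Ci, Rmult_1_l; apply CInt_near_const.
  - apply vline_icont; intros t Ht; now apply Hc, B.
  - intros t Ht; apply Rlt_le, B, Ht. }
replace (F q - F p - f p * (q - p) - 0 * Cconj (q - p))%C with
  ((F m - F p - f p * RtoC (Re q - Re p)) + (F q - F m - Ci * f p * RtoC (Im q - Im p)))%C.
2: { replace (q - p)%C with (RtoC (Re q - Re p) + Ci * RtoC (Im q - Im p))%C
      by (apply C_eq; unfold Re, Im; simpl; ring); ring. }
rewrite E1, E2; eapply Rle_trans; [apply Cmod_triangle|].
assert (H0 := Cmod_ge_0 (q - p)); nra.
Qed.

Lemma morera (f : C -> C) c rho :
  (forall p, square c rho p -> ccont f p) ->
  (forall p, square c rho p -> rint f (Re c) (Re p) (Im c) (Im p) = 0) ->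
  hol (square c rho) f.
Proof.
intros Hc Hz p Hp; destruct (square_primitive f c rho Hc Hz) as [F HF].
apply (derivative_hol (square c rho) F f p); [now apply square_near|auto].
Qed.

Definition Cder (f : C -> C) (z : C) : C := epsilon (inhabits (RtoC 0)) (fun l => wdiff f z l 0).

Lemma Cder_spec U f z : hol U f -> U z -> wdiff f z (Cder f z) 0.
Proof. intros H Hz; unfold Cder; apply epsilon_spec, H, Hz. Qed.

Lemma hol_ccont U f z : hol U f -> U z -> ccont f z.
Proof. intros H Hz; eapply wdiff_ccont, Cder_spec; eauto. Qed.

(** Continuity of the derivative is not assumed, so two passes are needed. By Goursat [f] is locally
    a derivative itself, and the resulting integral formula shows [Cder f] to be continuous; then
    [derivative_hol] applies to the pair [f], [Cder f]. *)
Lemma hol_Cder (U : C -> Prop) f : (forall z, U z -> near z U) -> hol U f -> hol U (Cder f).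
Proof.
intros HU Hf.
assert (HC : forall z, U z -> ccont (Cder f) z).
{ intros z Hz; destruct (near_square z U (HU z Hz)) as (rho & Hrho & Hsq).
  destruct (square_primitive f z rho) as [F HF].
  { intros p Hp; eapply hol_ccont; eauto. }
  { intros p Hp; apply goursat_box; intros q Hq; apply Hf, Hsq.
    eapply box_square; [now apply square_center|exact Hp|exact Hq]. }
  assert (HFf : forall q, square z rho q -> wdiff F q (f q) 0 /\ ccont f q).
  { intros q Hq; split; [now apply HF|]; eapply hol_ccont; eauto. }
  destruct (derivative_wdiff (square z rho) F f z) as (r & Hr & H);
    [now apply square_near, square_center|easy|].
  apply (ccont_ext_near (fun q => / RtoC (2 * PI * r) * circ_int f (fun t => cis (- t)) q r)%C).
  { exists r; split; [easy|]; intros q Hq; destruct (H q Hq) as [D HN].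
    assert (Uq : U q) by (apply Hsq, near_self, HN; rewrite Cmod_diag; lra).
    apply (wdiff_unique _ _ _ _ _ _ D (Cder_spec U f q Hf Uq)). }
  apply ccont_mult; [apply ccont_const|].
  apply circ_int_ccont; [apply weight_cis_neg|lra|]; intros p Hp.
  assert (Z0 : Cmod (z - z) < r) by now rewrite Cmod_diag.
  eapply near_imp; [|apply (proj2 (H z Z0) p Hp)]; intros q Hq; now apply HFf. }
intros z Hz; apply (derivative_hol U f (Cder f) z); [now apply HU|].
intros q Hq; split; [eapply Cder_spec; eauto|now apply HC].
Qed.

(** Weierstrass's theorem by way of Morera: a uniform limit is continuous, and the vanishing of
    integrals over rectangles passes to it. *)
Lemma hol_uniform_limit (f : C -> C) c rho : 0 < rho ->
  (forall eps, 0 < eps -> exists g, hol (square c rho) g /\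
     forall p, square c rho p -> Cmod (g p - f p) <= eps) ->
  hol (square c rho) f.
Proof.
intros Hrho H.
assert (Hc : forall p, square c rho p -> ccont f p).
{ intros p Hp eps He; destruct (H (eps / 3) ltac:(lra)) as (g & Hg & Hgf).
  assert (Cg := hol_ccont _ _ _ Hg Hp (eps / 3) ltac:(lra)).
  eapply near_imp; [|apply (near_and _ _ _ (square_near _ _ _ Hp) Cg)]; intros q [Q1 Q2]; cbv beta in *.
  assert (A := Hgf p Hp); assert (B := Hgf q Q1).
  replace (f q - f p)%C with (- (g q - f q) + ((g q - g p) + (g p - f p)))%C by ring.
  eapply Rle_lt_trans; [apply Cmod_triangle|]; rewrite Cmod_opp.
  assert (T := Cmod_triangle (g q - g p) (g p - f p)); lra. }
apply morera; [easy|]; intros p Hp.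
assert (Bx : forall q, box c p q -> square c rho q).
{ intros q Hq; eapply box_square; [now apply square_center|exact Hp|exact Hq]. }
apply rint_zero_wlog; [destruct c, p; auto|].
apply Cmod_eq_0, Rle_antisym; [|apply Cmod_ge_0]; apply Rnot_lt_le.
set (I := rint f _ _ _ _); intros HI.
set (a := Rmin (Re c) (Re p)) in *; set (b := Rmax (Re c) (Re p)) in *.
set (a' := Rmin (Im c) (Im p)) in *; set (b' := Rmax (Im c) (Im p)) in *.
assert (Hab : a <= b) by apply Rminmax; assert (Hab' : a' <= b') by apply Rminmax.
set (l := (b - a) + (b' - a') + 1).
(* With the constant 4 of [rint_bound], this accuracy bounds the modulus of [I] by half of itself.
   The [+ 1] in [l] keeps the denominator positive for degenerate rectangles. *)
destruct (H (Cmod I / (8 * l))) as (g & Hg & Hgf); [apply Rdiv_lt_0_compat; unfold l; lra|].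
assert (E : rint g a b a' b' = 0).
{ apply goursat; auto; intros z Hz; apply Hg, Bx, Hz. }
assert (Eq : rint (fun z => g z - f z)%C a b a' b' = (- I)%C).
{ rewrite rint_minus, E; auto; [unfold I; ring|].
  intros z Hz; split; [eapply hol_ccont; [exact Hg|now apply Bx]|apply Hc, Bx, Hz]. }
assert (Bd := rint_bound (fun z => g z - f z)%C a b a' b' (Cmod I / (8 * l)) Hab Hab').
rewrite Eq, Cmod_opp in Bd.
assert (Bd' : Cmod I <= 4 * (Cmod I / (8 * l)) * (b - a + (b' - a'))).
{ apply Bd; intros z Hz; split; [|apply Hgf, Bx, Hz].
  apply ccont_minus; [eapply hol_ccont; [exact Hg|now apply Bx]|apply Hc, Bx, Hz]. }
assert (X : 4 * (Cmod I / (8 * l)) * l = Cmod I / 2) by (field; unfold l; lra).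
assert (0 < Cmod I / (8 * l)) by (apply Rdiv_lt_0_compat; unfold l; lra).
unfold l in *; nra.
Qed.

(** Morera's condition only involves rectangles with a corner at 0. Cutting off an arbitrarily small
    one at that corner leaves pieces to which Goursat applies, and the small one has a small
    integral because [f] is bounded near 0. *)
Lemma hol_at_exceptional_point (f : C -> C) rho :
  (forall p, square 0 rho p -> ccont f p) ->
  (forall p, square 0 rho p -> p <> 0 -> exists l, wdiff f p l 0) ->
  hol (square 0 rho) f.
Proof.
intros Hc Hd; apply morera; [easy|]; intros [x y] [Hx Hy]; simpl in *.
rewrite Rminus_0_r in Hx, Hy.
assert (S : forall s t, Rabs s < rho -> Rabs t < rho -> square 0 rho (s, t)).
{ intros s t Hs Ht; split; simpl; now rewrite Rminus_0_r. }
assert (B : forall a b t, Rabs a < rho -> Rabs b < rho -> Rmin a b <= t <= Rmax a b -> Rabs t < rho).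
{ intros a b t Ha Hb Ht; rewrite <- (Rminus_0_r t); apply (between_square a b); [| |easy];
  now rewrite Rminus_0_r. }
assert (Ih : forall a b t, Rabs a < rho -> Rabs b < rho -> Rabs t < rho -> icont (fun s => f (s, t)) a b).
{ intros a b t Ha Hb Ht; apply hline_icont; intros s Hs; apply Hc, S; [eapply (B a b)|]; easy. }
assert (Iv : forall a b t, Rabs a < rho -> Rabs b < rho -> Rabs t < rho -> icont (fun s => f (t, s)) a b).
{ intros a b t Ha Hb Ht; apply vline_icont; intros s Hs; apply Hc, S; [|eapply (B a b)]; easy. }
assert (Z0 : Rabs 0 < rho) by (rewrite Rabs_R0; assert (T := Rabs_pos x); lra).
destruct (Req_dec x 0) as [->|Hx0]; [unfold rint, hint; rewrite !CInt_point; ring|].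
destruct (Req_dec y 0) as [->|Hy0]; [unfold rint, vint; rewrite !CInt_point; ring|].
assert (Sc : forall e u, 0 < e <= 1 -> Rabs u < rho -> Rabs (e * u) < rho).
{ intros e u He Hu; rewrite Rabs_mult, (Rabs_pos_eq e) by lra; assert (T := Rabs_pos u); nra. }
assert (Bx : forall e u t, 0 < e -> u <> 0 -> Rmin (e * u) u <= t <= Rmax (e * u) u -> e <= 1 -> t <> 0).
{ intros e u t He Hu Ht He1 ->; unfold Rmin, Rmax in Ht.
  destruct (Rle_dec (e * u) u); destruct (Rtotal_order u 0) as [|[|]]; try lra; nra. }
assert (Main : forall e, 0 < e <= 1 -> rint f 0 x 0 y = rint f 0 (e * x) 0 (e * y)).
{ intros e He; assert (Hex := Sc e x He Hx); assert (Hey := Sc e y He Hy).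
  assert (R1 : rint f (e * x) x 0 y = 0).
  { apply (goursat_box f (e * x, 0) (x, y)); intros [s t] [H1 H2]; simpl in H1, H2.
    apply Hd; [apply S; [eapply (B (e * x) x)|eapply (B 0 y)]; easy|].
    intros E; injection E as E1 E2; apply (Bx e x s); easy || lra. }
  assert (R2 : rint f 0 (e * x) (e * y) y = 0).
  { apply (goursat_box f (0, e * y) (e * x, y)); intros [s t] [H1 H2]; simpl in H1, H2.
    apply Hd; [apply S; [eapply (B 0 (e * x))|eapply (B (e * y) y)]; easy|].
    intros E; injection E as E1 E2; apply (Bx e y t); easy || lra. }
  transitivity (rint f 0 (e * x) 0 y + rint f (e * x) x 0 y)%C.
  { unfold rint, hint.
    rewrite <- (CInt_chasles (fun t => f (t, 0)) 0 (e * x) x), <- (CInt_chasles (fun t => f (t, y)) 0 (e * x) x)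
      by auto; ring. }
  rewrite R1, Cplus_0_r.
  transitivity (rint f 0 (e * x) 0 (e * y) + rint f 0 (e * x) (e * y) y)%C; [|rewrite R2; ring].
  unfold rint, vint.
  rewrite <- (CInt_chasles (fun t => f (0, t)) 0 (e * y) y), <- (CInt_chasles (fun t => f (e * x, t)) 0 (e * y) y)
    by auto; ring. }
destruct (Hc 0) with (eps := 1) as (d & Hd0 & Hn); [now apply S|lra|].
set (M := Cmod (f 0) + 1).
assert (HM : forall p, Cmod p < d -> Cmod (f p) <= M).
{ intros p Hp; replace p with (p - 0)%C in Hp by ring; specialize (Hn p Hp).
  replace (f p) with (f 0 + (f p - f 0))%C by ring.
  eapply Rle_trans; [apply Cmod_triangle|]; unfold M; lra. }
assert (M0 : 0 < M) by (unfold M; assert (T := Cmod_ge_0 (f 0)); lra).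
apply Cmod_eq_0, Rle_antisym; [|apply Cmod_ge_0]; apply Rnot_lt_le; intros HI.
set (I := Cmod (rint f 0 x 0 y)) in *; set (l := Rabs x + Rabs y).
assert (Hl : 0 < l) by (unfold l; assert (T := Rabs_pos_lt x Hx0); assert (T' := Rabs_pos y); lra).
(* The three bounds keep the small rectangle inside the given one, keep it inside the disc where [f]
   is bounded by [M], and make its integral, at most [4 * M * (e * l)], smaller than [I]. *)
set (e := Rmin 1 (Rmin (d / (2 * l)) (I / (16 * M * l)))).
assert (He : 0 < e).
{ repeat apply Rmin_glb_lt; [lra| |]; apply Rdiv_lt_0_compat; try lra.
  repeat apply Rmult_lt_0_compat; lra. }
assert (He1 : e <= 1) by apply Rmin_l.
assert (He2 : e * (2 * l) <= d).
{ apply Rle_div_r; [lra|]; eapply Rle_trans; [apply Rmin_r|apply Rmin_l]. }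
assert (He3 : e * (16 * M * l) <= I).
{ apply Rle_div_r; [repeat apply Rmult_lt_0_compat; lra|]; eapply Rle_trans; [apply Rmin_r|apply Rmin_r]. }
assert (Hex := Sc e x (conj He He1) Hx); assert (Hey := Sc e y (conj He He1) Hy).
assert (Ax : Rabs (e * x) = e * Rabs x) by (rewrite Rabs_mult, (Rabs_pos_eq e); lra).
assert (Ay : Rabs (e * y) = e * Rabs y) by (rewrite Rabs_mult, (Rabs_pos_eq e); lra).
assert (Px := Rabs_pos x); assert (Py := Rabs_pos y).
assert (Bd : forall a t, Rmin 0 a <= t <= Rmax 0 a -> Rabs t <= Rabs a).
{ intros a t; unfold Rmin, Rmax; destruct (Rle_dec 0 a); intros Ht.
  - rewrite !Rabs_pos_eq; lra.
  - rewrite !Rabs_left1; lra. }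
assert (Sm : forall s t, Rabs s <= Rabs (e * x) -> Rabs t <= Rabs (e * y) -> Cmod (f (s, t)) <= M).
{ intros s t Hs Ht; apply HM; eapply Rle_lt_trans; [apply Cmod_le_Re_Im|]; simpl.
  unfold l in *; nra. }
assert (Hh : forall t, Rabs t <= Rabs (e * y) -> Cmod (hint f 0 (e * x) t) <= 2 * M * (e * Rabs x)).
{ intros t Ht; rewrite <- Ax; replace (Rabs (e * x)) with (Rabs (e * x - 0)) by now rewrite Rminus_0_r.
  apply CInt_bound; [apply Ih; auto; lra|].
  intros s Hs; apply Sm; auto. }
assert (Hv : forall t, Rabs t <= Rabs (e * x) -> Cmod (vint f t 0 (e * y)) <= 2 * M * (e * Rabs y)).
{ intros t Ht; unfold vint; rewrite Cmod_mult, Cmod_Ci, Rmult_1_l.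
  rewrite <- Ay; replace (Rabs (e * y)) with (Rabs (e * y - 0)) by now rewrite Rminus_0_r.
  apply CInt_bound; [apply Iv; auto; lra|].
  intros s Hs; apply Sm; auto. }
assert (K : I <= 4 * M * (e * l)).
{ unfold I; rewrite (Main e) by easy; unfold rint.
  assert (U1 := Hh 0 ltac:(rewrite Rabs_R0; apply Rabs_pos)); assert (U2 := Hh (e * y) ltac:(lra)).
  assert (V1 := Hv 0 ltac:(rewrite Rabs_R0; apply Rabs_pos)); assert (V2 := Hv (e * x) ltac:(lra)).
  set (h1 := hint f 0 (e * x) 0) in *; set (h2 := hint f 0 (e * x) (e * y)) in *.
  set (v1 := vint f (e * x) 0 (e * y)) in *; set (v2 := vint f 0 0 (e * y)) in *.
  assert (T1 := Cmod_triangle (h1 + v1 - h2) (- v2)); assert (T2 := Cmod_triangle (h1 + v1) (- h2)).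
  assert (T3 := Cmod_triangle h1 v1); rewrite Cmod_opp in T1, T2.
  unfold Cminus in *; unfold l; nra. }
nra.
Qed.

(** Extended by 0, the function [z g] is continuous at 0, hence holomorphic there. Its derivative at
    0 is the missing value of [g], and a second use of [hol_at_exceptional_point] shows the
    completed function to be holomorphic. *)
Lemma removable_singularity (g : C -> C) rho : 0 < rho ->
  (forall p, square 0 rho p -> p <> 0 -> exists l, wdiff g p l 0) ->
  (forall eps, 0 < eps -> near 0 (fun z => z <> 0 -> Cmod (z * g z) <= eps)) ->
  exists G, hol (square 0 rho) G /\ forall z : C, z <> 0 -> G z = g z.
Proof.
intros Hrho Hg Hlim.
assert (Neq : forall (p : C), p <> 0 -> near p (fun q => q <> 0)).
{ intros p Hp; exists (Cmod p); split; [now apply Cmod_gt_0|]; intros q Hq ->.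
  rewrite Cmod_sub_sym in Hq; replace (p - 0)%C with p in Hq by ring; lra. }
set (H := fun z : C => if Ceq_dec z 0 then RtoC 0 else (z * g z)%C).
assert (H0 : H 0 = 0) by (unfold H; destruct (Ceq_dec 0 0); easy).
assert (HH : hol (square 0 rho) H).
{ assert (Hoff : forall p, square 0 rho p -> p <> 0 -> exists l, wdiff H p l 0).
  { intros p Hp Hp0; destruct (Hg p Hp Hp0) as [l Hl]; exists (g p + p * l)%C.
    apply (wdiff_ext_near (fun z => z * g z)%C).
    - eapply near_imp; [|apply (Neq p Hp0)]; intros q Hq; unfold H.
      destruct (Ceq_dec q 0); easy.
    - eapply wdiff_eq; [apply wdiff_mult; [apply wdiff_id|exact Hl]|cbv beta; ring|cbv beta; ring]. }
  apply hol_at_exceptional_point; [|easy]; intros p Hp.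
  destruct (Ceq_dec p 0) as [->|Hp0]; [|destruct (Hoff p Hp Hp0) as [l Hl]; eapply wdiff_ccont, Hl].
  intros eps He; eapply near_imp; [|apply (Hlim (eps / 2)); lra]; intros w Hw; cbv beta in Hw.
  rewrite H0; unfold H; destruct (Ceq_dec w 0) as [->|Hw0].
  - replace (0 - 0)%C with (RtoC 0) by ring; now rewrite Cmod_0.
  - replace (w * g w - 0)%C with (w * g w)%C by ring; specialize (Hw Hw0); lra. }
set (l := Cder H 0).
assert (Hl : wdiff H 0 l 0) by (eapply Cder_spec; [exact HH|now apply square_center]).
set (G := fun z : C => if Ceq_dec z 0 then l else g z).
assert (EG : forall z : C, z <> 0 -> G z = g z) by (intros z Hz; unfold G; destruct (Ceq_dec z 0); easy).
exists G; split; [|easy].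
assert (Hoff : forall p, square 0 rho p -> p <> 0 -> exists l, wdiff G p l 0).
{ intros p Hp Hp0; destruct (Hg p Hp Hp0) as [m Hm]; exists m.
  apply (wdiff_ext_near g); [|easy].
  eapply near_imp; [|apply (Neq p Hp0)]; intros q Hq; now rewrite EG. }
apply hol_at_exceptional_point; [|easy]; intros p Hp.
destruct (Ceq_dec p 0) as [->|Hp0]; [|destruct (Hoff p Hp Hp0) as [m Hm]; eapply wdiff_ccont, Hm].
intros eps He; eapply near_imp; [|apply (Hl (eps / 2)); lra]; intros w Hw; cbv beta in Hw.
replace (G 0) with l by (unfold G; destruct (Ceq_dec 0 0); easy).
unfold G; destruct (Ceq_dec w 0) as [->|Hw0].
- replace (l - l)%C with (RtoC 0) by ring; now rewrite Cmod_0.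
- rewrite H0 in Hw; unfold H in Hw; destruct (Ceq_dec w 0) as [|_]; [easy|].
  replace (w * g w - 0 - l * (w - 0) - 0 * Cconj (w - 0))%C with (w * (g w - l))%C in Hw by ring.
  replace (w - 0)%C with w in Hw by ring; rewrite Cmod_mult in Hw.
  assert (Hm : 0 < Cmod w) by now apply Cmod_gt_0.
  apply Rle_lt_trans with (eps / 2); [|lra].
  apply (Rmult_le_reg_l (Cmod w)); lra.
Qed.

(** * The Cauchy transform *)

(* The kernel [1/(z-w)], integrated in polar coordinates around [z]: the
   Jacobian cancels its singularity.  The radius 2 is large enough when [z]
   and the support of [F] lie in the unit disc. *)
Definition cauchy_transform (F : C -> C) (z : C) : C :=
  (- / RtoC PI * CInt (fun r => circ_int F (fun t => cis (- t)) z r) 0 2)%C.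

Lemma PI_C_neq_0 : RtoC PI <> 0.
Proof. apply RtoC_neq_0; assert (P := PI_RGT_0); lra. Qed.

Lemma radial_icont F w z : weight w -> (forall p, ccont F p) ->
  icont (fun r => circ_int F w z r) 0 2.
Proof.
intros Hw HF r; rewrite Rmin_left, Rmax_right by lra; intros Hr.
apply circ_int_rcont; [easy|lra|]; intros p _; exists 1; split; [lra|auto].
Qed.

Lemma cauchy_transform_minus F G z : (forall p, ccont F p) -> (forall p, ccont G p) ->
  cauchy_transform (fun p => F p - G p)%C z = (cauchy_transform F z - cauchy_transform G z)%C.
Proof.
intros HF HG; unfold cauchy_transform.
rewrite (CInt_ext _ (fun r => circ_int F (fun t => cis (- t)) z r
  - circ_int G (fun t => cis (- t)) z r)%C).
- rewrite (CInt_minus (fun r => circ_int F (fun t => cis (- t)) z r)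
    (fun r => circ_int G (fun t => cis (- t)) z r))
    by (apply radial_icont; [apply weight_cis_neg|easy]); ring.
- intros r _; apply circ_int_minus; [apply weight_cis_neg|auto].
Qed.

Lemma CInt_support_bound f c rho N : icont f 0 2 -> 0 <= rho ->
  (forall t, Cmod (f t) <= N) -> (forall t, 0 <= t -> rho < Rabs (t - c) -> f t = 0) ->
  Cmod (CInt f 0 2) <= 4 * N * rho.
Proof.
intros Hf Hrho HN H0.
(* [[a, b]] is [[c - rho, c + rho]] clipped to [[0, 2]]; it degenerates to a point when the two do
   not meet. *)
set (a := Rmin 2 (Rmax 0 (c - rho))); set (b := Rmin 2 (Rmax 0 (c + rho))).
assert (Hab : 0 <= a /\ a <= b /\ b <= 2 /\ b - a <= 2 * rho).
{ unfold a, b, Rmin, Rmax; repeat destruct (Rle_dec _ _); lra. }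
assert (Ha : forall t, 0 < t < a -> f t = 0).
{ intros t Ht; apply H0; [lra|]; rewrite Rabs_left1; unfold a, Rmin, Rmax in Ht;
    repeat destruct (Rle_dec _ _); lra. }
assert (Hb : forall t, b < t < 2 -> f t = 0).
{ intros t Ht; apply H0; [|rewrite Rabs_pos_eq]; unfold b, Rmin, Rmax in Ht;
    repeat destruct (Rle_dec _ _); lra. }
assert (I : forall u v, 0 <= u -> u <= v -> v <= 2 -> icont f u v).
{ intros u v ? ? ? t; rewrite Rmin_left, Rmax_right by lra; intros Ht; apply Hf.
  rewrite Rmin_left, Rmax_right; lra. }
assert (N0 : 0 <= N) by (eapply Rle_trans; [apply Cmod_ge_0|apply (HN 0)]).
rewrite <- (CInt_chasles f 0 a 2), <- (CInt_chasles f a b 2) by (apply I; lra).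
rewrite (CInt_ext f (fun _ => RtoC 0) 0 a), (CInt_ext f (fun _ => RtoC 0) b 2).
- rewrite !CInt_const, !Cmult_0_l, Cplus_0_l, Cplus_0_r.
  eapply Rle_trans; [apply (CInt_bound f a b N); [apply I; lra|auto]|].
  rewrite Rabs_pos_eq by lra; nra.
- intros t; rewrite Rmin_left, Rmax_right by lra; apply Hb.
- intros t; rewrite Rmin_left, Rmax_right by lra; apply Ha.
Qed.

(** A circle of radius [r] about [z] meets the support only if [r] is within [rho] of [Cmod z], so
    the radial integral runs over a length of at most [2 * rho]. This gain of one factor [rho],
    uniform in [z], is what makes the dyadic pieces summable. *)
Lemma cauchy_transform_bound F z rho M : (forall p, ccont F p) -> 0 <= rho ->
  (forall p, Cmod (F p) <= M) -> (forall p, rho < Cmod p -> F p = 0) ->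
  Cmod (cauchy_transform F z) <= 16 * M * rho.
Proof.
intros HF Hrho HM H0; unfold cauchy_transform.
assert (P := PI_RGT_0).
rewrite Cmod_mult, Cmod_opp, Cmod_inv, Cmod_R_nonneg by (apply PI_C_neq_0 || lra).
assert (K := CInt_support_bound (fun r => circ_int F (fun t => cis (- t)) z r) (Cmod z) rho (4 * PI * M)
  (radial_icont F _ z weight_cis_neg HF) Hrho).
apply Rle_trans with (/ PI * (4 * (4 * PI * M) * rho)); [|right; field; lra].
apply Rmult_le_compat_l; [apply Rlt_le, Rinv_0_lt_compat; lra|]; apply K.
- intros t; apply circ_int_bound; [apply weight_cis_neg|auto|auto].
- intros r Hr Hrz; unfold circ_int; rewrite (CInt_ext _ (fun _ => RtoC 0)).
  + rewrite CInt_const; ring.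
  + intros t _; rewrite H0; [ring|]; eapply Rlt_le_trans; [exact Hrz|].
    assert (D := circ_dist z r t Hr).
    assert (T1 := Cmod_ge_sub z (circ z r t)); assert (T2 := Cmod_ge_sub (circ z r t) z).
    assert (T3 := Cmod_triangle (circ z r t) (- z)); rewrite Cmod_opp in T3.
    unfold Cminus in *; apply Rabs_le; lra.
Qed.

(** In polar coordinates about [z], the point enters only through the argument of [F], so that the
    derivatives fall on [F] and not on the kernel. *)
Lemma cauchy_transform_wdiff F A B z :
  (forall p, wdiff F p (A p) (B p) /\ ccont A p /\ ccont B p) ->
  wdiff (cauchy_transform F) z (cauchy_transform A z) (cauchy_transform B z).
Proof.
intros HF; unfold cauchy_transform; apply wdiff_cmult.
assert (CF : forall p, ccont F p) by (intros p; eapply wdiff_ccont, HF).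
assert (Hw := weight_cis_neg).
intros eps He.
destruct (circ_int_uniform_center (fun _ => True) F A B (fun t => cis (- t)) z 2 Hw) with (eps := eps / 4)
  as (d & Hd & H); [auto| |lra|].
{ intros p _; exists 1; split; [lra|auto]. }
exists d; split; [easy|]; intros z' Hz.
eapply Rle_trans.
- apply (CInt_linear_estimate _ _ _ _ (z' - z) 0 2 (eps / 4 * Cmod (z' - z)));
    try (apply radial_icont; [easy|]); auto; try (intros p; apply HF).
  intros r; rewrite Rmin_left, Rmax_right by lra; intros Hr; now apply H.
- rewrite (Rabs_pos_eq (2 - 0)) by lra; right; field.
Qed.

(* The derivative of [F] along the circle integrates to 0. *)
Lemma circ_int_balance F A B z r : 0 <= r ->
  (forall p, wdiff F p (A p) (B p) /\ ccont A p /\ ccont B p) ->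
  circ_int A cis z r = circ_int B (fun t => cis (- t)) z r.
Proof.
intros [Hr|<-] HF.
- assert (Hcirc : forall t, rcont (circ z r) t) by (intros; eapply rderiv_rcont, circ_rderiv).
  assert (IA : icont (fun t => A (circ z r t) * cis t)%C 0 (2 * PI)).
  { apply circ_icont; [apply weight_cis|intros; apply HF]. }
  assert (IB : icont (fun t => B (circ z r t) * cis (- t))%C 0 (2 * PI)).
  { apply (circ_icont B (fun t => cis (- t))); [apply weight_cis_neg|intros; apply HF]. }
  assert (E : (circ_int A cis z r - circ_int B (fun t => cis (- t)) z r = 0)%C).
  { unfold circ_int; rewrite <- CInt_minus by easy.
    rewrite (CInt_deriv (fun t => / (Ci * RtoC r) * F (circ z r t))%C).
    - rewrite circ_2PI; ring.
    - intros t _; eapply rderiv_eq.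
      + apply rderiv_cmult, (wdiff_rderiv F (circ z r)); [apply circ_rderiv|apply HF].
      + rewrite !Cmult_conj, Cconj_cis.
        rewrite Cconj_Ci.
        rewrite Cconj_RtoC.
        field; split; [apply RtoC_neq_0; lra|].
        intros X; apply (f_equal Im) in X; simpl in X; lra.
    - intros t Ht; apply rcont_minus; [now apply IA|now apply IB]. }
  replace (circ_int A cis z r) with (circ_int A cis z r - circ_int B (fun t => cis (- t)) z r
    + circ_int B (fun t => cis (- t)) z r)%C by ring.
  rewrite E; ring.
- assert (C0 : forall t, circ z 0 t = z) by (intros; unfold circ; ring).
  assert (I1 : icont cis 0 (2 * PI)) by (intros t _; apply weight_cis).
  assert (I2 : icont (fun t => cis (- t)) 0 (2 * PI)) by (intros t _; apply weight_cis_neg).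
  assert (Ci2 : (Ci * Ci)%C = (- (1))%C) by (apply C_eq; simpl; ring).
  unfold circ_int.
  rewrite (CInt_ext _ (fun t => A z * cis t)%C) by (intros; now rewrite C0).
  rewrite (CInt_ext (fun t => B (circ z 0 t) * cis (- t))%C (fun t => B z * cis (- t))%C)
    by (intros; now rewrite C0).
  rewrite !CInt_cmult by easy.
  rewrite (CInt_deriv (fun t => - Ci * cis t)%C cis), (CInt_deriv (fun t => Ci * cis (- t))%C (fun t => cis (- t))).
  + rewrite <- (Rplus_0_l (2 * PI)), cis_period.
    replace (cis (- (0 + 2 * PI))) with (cis (- 0)); [ring|].
    rewrite <- (cis_period (- (0 + 2 * PI))); f_equal; ring.
  + intros t _; eapply rderiv_eq; [apply rderiv_cmult, cis_neg_rderiv|].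
    transitivity (- (Ci * Ci) * cis (- t))%C; [ring|rewrite Ci2; ring].
  + easy.
  + intros t _; eapply rderiv_eq; [apply rderiv_cmult, cis_rderiv|].
    transitivity (- (Ci * Ci) * cis t)%C; [ring|rewrite Ci2; ring].
  + easy.
Qed.

(** The Cauchy-Pompeiu formula. The radial integral is evaluated at its two ends: the circle of
    radius 2 about a point of the unit disc avoids the support, and at radius 0 the mean is
    [2 pi F z]. *)
Lemma cauchy_transform_dbar F A B z :
  (forall p, wdiff F p (A p) (B p) /\ ccont A p /\ ccont B p) ->
  (forall p, 1 <= Cmod p -> F p = 0) -> Cmod z < 1 ->
  cauchy_transform B z = F z.
Proof.
intros HF H0 Hz; unfold cauchy_transform.
assert (Hw := weight_cis_neg).
set (b := fun r => circ_int B (fun t => cis (- t)) z r).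
assert (Ib : icont b 0 2) by (apply radial_icont; [easy|intros; apply HF]).
(* By the preceding lemma, [2 * b] is the derivative of the circular mean of [F]. *)
assert (E : CInt (fun r => 2 * b r)%C 0 2 = (circ_int F (fun _ => RtoC 1) z 2 - circ_int F (fun _ => RtoC 1) z 0)%C).
{ apply CInt_deriv.
  - intros r; rewrite Rmin_left, Rmax_right by lra; intros Hr.
    eapply rderiv_eq.
    + apply (circ_int_rderiv (fun _ => True) F A B); [lra|auto| |apply weight_1].
      intros p _; exists 1; split; [lra|auto].
    + rewrite (CInt_ext _ (fun t => A (circ z r t) * cis t + B (circ z r t) * cis (- t))%C)
        by (intros; ring).
      rewrite CInt_plus.
      * change (circ_int A cis z r + b r = 2 * b r)%C; rewrite (circ_int_balance F A B) by (lra || auto).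
        unfold b; ring.
      * apply circ_icont; [apply weight_cis|intros; apply HF].
      * apply (circ_icont B (fun t => cis (- t))); [easy|intros; apply HF].
  - intros t Ht; apply rcont_mult; [apply rcont_const|now apply Ib]. }
rewrite CInt_cmult in E by easy.
assert (E2 : circ_int F (fun _ => RtoC 1) z 2 = 0).
{ unfold circ_int; rewrite (CInt_ext _ (fun _ => RtoC 0)); [rewrite CInt_const; ring|].
  intros t _; rewrite H0; [ring|].
  assert (D := circ_dist z 2 t ltac:(lra)).
  assert (T := Cmod_triangle (circ z 2 t) (- z)); rewrite Cmod_opp in T; unfold Cminus in D; lra. }
assert (E3 : circ_int F (fun _ => RtoC 1) z 0 = (RtoC (2 * PI) * F z)%C).
{ unfold circ_int; rewrite (CInt_ext _ (fun _ => F z)).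
  - rewrite CInt_const, Rminus_0_r; ring.
  - intros t _; unfold circ; rewrite Cmult_0_l, Cplus_0_r; ring. }
rewrite E2, E3, RtoC_mult in E.
assert (P := PI_C_neq_0).
change (- / RtoC PI * CInt b 0 2 = F z)%C.
transitivity (- / RtoC PI * (/ 2 * (2 * CInt b 0 2)))%C; [field; easy|].
rewrite E; field; easy.
Qed.

(** * Continuously differentiable functions *)

(** Continuity of the coefficients is asked at [z] only, which keeps the condition pointwise. When
    it holds everywhere, uniqueness of the coefficients makes them globally continuous in
    [C1at_coefficients]. *)
Definition C1at (f : C -> C) (z : C) : Prop := exists A B,
  near z (fun w => wdiff f w (A w) (B w)) /\ ccont A z /\ ccont B z.

Lemma C1at_ext_near f g z : near z (fun w => f w = g w) -> C1at f z -> C1at g z.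
Proof.
intros H (A & B & H1 & H2 & H3); exists A, B; repeat split; auto.
apply near_near in H.
eapply near_imp; [|apply (near_and _ _ _ H H1)]; intros w [W1 W2]; eapply wdiff_ext_near; eauto.
Qed.

Lemma C1at_ccont f z : C1at f z -> ccont f z.
Proof. intros (A & B & H1 & _); eapply wdiff_ccont, (near_self _ _ H1). Qed.

Lemma C1at_const c z : C1at (fun _ => c) z.
Proof.
exists (fun _ => RtoC 0), (fun _ => RtoC 0); repeat split; try apply ccont_const.
exists 1; split; [lra|]; intros w _; apply wdiff_const.
Qed.

Lemma C1at_id z : C1at (fun w => w) z.
Proof.
exists (fun _ => RtoC 1), (fun _ => RtoC 0); repeat split; try apply ccont_const.
exists 1; split; [lra|]; intros w _; apply wdiff_id.
Qed.

Lemma C1at_plus f g z : C1at f z -> C1at g z -> C1at (fun w => f w + g w)%C z.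
Proof.
intros (A & B & H1 & H2 & H3) (A' & B' & H1' & H2' & H3').
exists (fun w => A w + A' w)%C, (fun w => B w + B' w)%C; repeat split; try now apply ccont_plus.
eapply near_imp; [|apply (near_and _ _ _ H1 H1')]; intros w [W1 W2]; now apply wdiff_plus.
Qed.

Lemma C1at_mult f g z : C1at f z -> C1at g z -> C1at (fun w => f w * g w)%C z.
Proof.
intros Hf Hg; assert (Cf := C1at_ccont _ _ Hf); assert (Cg := C1at_ccont _ _ Hg).
destruct Hf as (A & B & H1 & H2 & H3); destruct Hg as (A' & B' & H1' & H2' & H3').
exists (fun w => A w * g w + f w * A' w)%C, (fun w => B w * g w + f w * B' w)%C; repeat split.
- eapply near_imp; [|apply (near_and _ _ _ H1 H1')]; intros w [W1 W2]; now apply wdiff_mult.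
- apply ccont_plus; now apply ccont_mult.
- apply ccont_plus; now apply ccont_mult.
Qed.

Lemma C1at_minus f g z : C1at f z -> C1at g z -> C1at (fun w => f w - g w)%C z.
Proof.
intros Hf Hg; apply (C1at_ext_near (fun w => f w + - (1) * g w)%C).
- exists 1; split; [lra|]; intros w _; ring.
- apply C1at_plus; [easy|]; apply C1at_mult; [apply C1at_const|easy].
Qed.

Lemma ccont_near_neq_0 (f : C -> C) z : ccont f z -> f z <> 0 -> near z (fun w => f w <> 0).
Proof.
intros Hf H0; apply Cmod_gt_0 in H0; specialize (Hf _ H0).
eapply near_imp; [|exact Hf]; intros w Hw E; cbv beta in Hw; rewrite E in Hw.
rewrite Cmod_sub_sym in Hw; replace (f z - 0)%C with (f z) in Hw by ring; lra.
Qed.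

Lemma C1at_inv (f : C -> C) z : f z <> 0 -> C1at f z -> C1at (fun w => / f w)%C z.
Proof.
intros H0 Hf; assert (Cf := C1at_ccont _ _ Hf).
destruct Hf as (A & B & H1 & H2 & H3).
exists (fun w => - (A w * (/ f w * / f w)))%C, (fun w => - (B w * (/ f w * / f w)))%C; repeat split.
- eapply near_imp; [|apply (near_and _ _ _ H1 (ccont_near_neq_0 f z Cf H0))].
  intros w [W1 W2]; now apply wdiff_inv.
- apply ccont_opp, ccont_mult; [easy|]; apply ccont_mult; now apply ccont_inv.
- apply ccont_opp, ccont_mult; [easy|]; apply ccont_mult; now apply ccont_inv.
Qed.

Lemma C1at_conj f z : C1at f z -> C1at (fun w => Cconj (f w)) z.
Proof.
intros (A & B & H1 & H2 & H3); exists (fun w => Cconj (B w)), (fun w => Cconj (A w)); repeat split.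
- eapply near_imp; [|exact H1]; intros w W; now apply wdiff_conj.
- now apply ccont_conj.
- now apply ccont_conj.
Qed.

Lemma wdiff_real (u : C -> R) z A B : wdiff (fun w => RtoC (u w)) z A B -> B = Cconj A.
Proof.
intros H; assert (H' := wdiff_conj _ _ _ _ H).
destruct (wdiff_unique (fun w => RtoC (u w)) z A B (Cconj B) (Cconj A)) as [_ E]; auto.
eapply wdiff_ext; [|exact H']; intros w; apply Cconj_RtoC.
Qed.

Lemma C1at_real_comp (phi phi' : R -> R) (u : C -> R) z :
  near z (fun w => is_derive phi (u w) (phi' (u w))) -> continuous phi' (u z) ->
  C1at (fun w => RtoC (u w)) z -> C1at (fun w => RtoC (phi (u w))) z.
Proof.
intros Hphi Hc Hu; assert (Cu := C1at_ccont _ _ Hu).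
destruct Hu as (A & B & H1 & H2 & H3).
assert (Cphi : ccont (fun w => RtoC (phi' (u w))) z).
{ intros eps He; apply continuity_pt_filterlim in Hc.
  destruct (Hc eps He) as (d & Hd & Hn).
  eapply near_imp; [|apply (Cu d Hd)]; intros w Hw; cbv beta in *.
  rewrite <- RtoC_minus, Cmod_R in *.
  destruct (Req_dec (u z) (u w)) as [E|E].
  - rewrite E, Rminus_diag, Rabs_R0; easy.
  - apply (Hn (u w)); split; [split; [exact I|easy]|exact Hw]. }
exists (fun w => RtoC (phi' (u w)) * A w)%C, (fun w => Cconj (RtoC (phi' (u w)) * A w)); repeat split.
- eapply near_imp; [|apply (near_and _ _ _ H1 Hphi)]; intros w [W1 W2].
  apply wdiff_real_comp; [|exact W2].
  rewrite <- (wdiff_real _ _ _ _ W1); exact W1.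
- now apply ccont_mult.
- now apply ccont_conj, ccont_mult.
Qed.

Lemma C1at_coefficients f : (forall z, C1at f z) ->
  exists A B, forall z, wdiff f z (A z) (B z) /\ ccont A z /\ ccont B z.
Proof.
intros H.
set (cf := fun z => epsilon (inhabits (RtoC 0, RtoC 0)) (fun p : C * C => wdiff f z (fst p) (snd p))).
assert (Hcf : forall z, wdiff f z (fst (cf z)) (snd (cf z))).
{ intros z; apply (epsilon_spec (inhabits (RtoC 0, RtoC 0)) (fun p : C * C => wdiff f z (fst p) (snd p))).
  destruct (H z) as (A & B & H1 & _); exists (A z, B z); exact (near_self _ _ H1). }
exists (fun z => fst (cf z)), (fun z => snd (cf z)); intros z.
destruct (H z) as (A & B & H1 & H2 & H3); split; [apply Hcf|].
assert (E : near z (fun w => A w = fst (cf w) /\ B w = snd (cf w))).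
{ eapply near_imp; [|exact H1]; intros w W; eapply wdiff_unique; [exact W|apply Hcf]. }
split.
- apply (ccont_ext_near A); [eapply near_imp; [|exact E]; intros w [W _]; exact W|easy].
- apply (ccont_ext_near B); [eapply near_imp; [|exact E]; intros w [_ W]; exact W|easy].
Qed.

(** * A cutoff function *)

Lemma Rmax_sqr_derive (y : R) : is_derive (fun y => (Rmax 0 y) ^ 2) y (2 * Rmax 0 y).
Proof.
apply is_derive_eps; intros eps He; exists eps; split; [easy|]; intros s Hs.
apply Rle_trans with (Rabs (s - y) * Rabs (s - y)).
- rewrite <- Rabs_mult, (Rabs_pos_eq ((s - y) * (s - y))) by apply Rle_0_sqr.
  assert (Q := Rle_0_sqr (s - y)); unfold Rsqr in Q.
  unfold Rmax; destruct (Rle_dec 0 s) as [S|S%Rnot_le_lt]; destruct (Rle_dec 0 y) as [Y|Y%Rnot_le_lt];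
    apply Rabs_le; split; nra.
- apply Rmult_le_compat_r; [apply Rabs_pos|lra].
Qed.

(** A quadratic spline with nodes 1, 3/2 and 2, descending from 1 to 0. Its derivative is
    continuous, and one continuous derivative is all that the Cauchy transform asks of its
    density. *)
Definition cutoff (y : R) : R :=
  1 - 2 * ((Rmax 0 (y - 1)) ^ 2 - 2 * (Rmax 0 (y - 3 / 2)) ^ 2 + (Rmax 0 (y - 2)) ^ 2).

Definition cutoff' (y : R) : R :=
  - 4 * (Rmax 0 (y - 1) - 2 * Rmax 0 (y - 3 / 2) + Rmax 0 (y - 2)).

Lemma cutoff_derive (y : R) : is_derive cutoff y (cutoff' y).
Proof.
assert (S : forall a, is_derive (fun y => (Rmax 0 (y - a)) ^ 2) y (2 * Rmax 0 (y - a))).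
{ intros a; replace (2 * Rmax 0 (y - a)) with (1 * (2 * Rmax 0 (y - a))) by ring.
  apply (is_derive_comp (fun y => (Rmax 0 y) ^ 2) (fun y => y - a)); [apply Rmax_sqr_derive|].
  auto_derive; auto. }
unfold cutoff, cutoff'.
assert (D := S 1); assert (D' := S (3 / 2)); assert (D2 := S 2).
apply (is_derive_ext (fun y => 1 + ((-2) * (Rmax 0 (y - 1)) ^ 2 + (4 * (Rmax 0 (y - 3 / 2)) ^ 2
  + (-2) * (Rmax 0 (y - 2)) ^ 2)))).
{ intros t; match goal with |- ?a = ?b => change (@eq R a b) end; ring. }
replace (- 4 * _) with (0 + ((-2) * (2 * Rmax 0 (y - 1)) + (4 * (2 * Rmax 0 (y - 3 / 2))
  + (-2) * (2 * Rmax 0 (y - 2))))) by ring.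
repeat apply (is_derive_plus (K := R_AbsRing) (V := R_NormedModule)).
- apply (is_derive_const (K := R_AbsRing) (V := R_NormedModule)).
- apply (is_derive_scal (fun y => (Rmax 0 (y - 1)) ^ 2) y (-2)); exact D.
- apply (is_derive_scal (fun y => (Rmax 0 (y - 3 / 2)) ^ 2) y 4); exact D'.
- apply (is_derive_scal (fun y => (Rmax 0 (y - 2)) ^ 2) y (-2)); exact D2.
Qed.

Lemma cutoff'_cont (y : R) : continuous cutoff' y.
Proof.
apply continuity_pt_filterlim; intros eps He; exists (eps / 16); split; [lra|].
intros s [_ Hs]; simpl in *; unfold R_dist in *.
assert (L : forall a, Rabs (Rmax 0 (s - a) - Rmax 0 (y - a)) <= Rabs (s - y)).
{ intros a; unfold Rmax; destruct (Rle_dec 0 (s - a)); destruct (Rle_dec 0 (y - a));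
   apply Rabs_le; assert (T1 := Rle_abs (s - y)); assert (T2 := Rle_abs (- (s - y)));
   rewrite Rabs_Ropp in T2; lra. }
unfold cutoff'.
assert (L1 := L 1); assert (L2 := L (3 / 2)); assert (L3 := L 2).
apply Rabs_le_between in L1; apply Rabs_le_between in L2; apply Rabs_le_between in L3.
apply Rabs_def1; lra.
Qed.

Lemma cutoff_1 y : y <= 1 -> cutoff y = 1.
Proof. intros H; unfold cutoff; rewrite !Rmax_left by lra; ring. Qed.

Lemma cutoff_0 y : 2 <= y -> cutoff y = 0.
Proof. intros H; unfold cutoff; rewrite !Rmax_right by lra; field. Qed.

Lemma cutoff_range y : 0 <= cutoff y <= 1.
Proof.
unfold cutoff, Rmax; destruct (Rle_dec 0 (y - 1)); destruct (Rle_dec 0 (y - 3 / 2));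
  destruct (Rle_dec 0 (y - 2)); try lra; split; nra.
Qed.

Lemma C1at_cutoff c z : C1at (fun w => RtoC (cutoff (c * Cmod w ^ 2))) z.
Proof.
apply (C1at_real_comp cutoff cutoff' (fun w => c * Cmod w ^ 2)).
- exists 1; split; [lra|]; intros w _; apply cutoff_derive.
- apply cutoff'_cont.
- apply (C1at_ext_near (fun w => RtoC c * (w * Cconj w))%C).
  + exists 1; split; [lra|]; intros w _; now rewrite RtoC_mult, Cmod2_conj.
  + apply C1at_mult; [apply C1at_const|apply C1at_mult; [apply C1at_id|apply C1at_conj, C1at_id]].
Qed.

(** * Solving the d-bar equation with a bounded density *)

(** The bound telescopes: the intervals of radius [D / (n + 1)] about the real parts, and about the
    imaginary parts, are nested, and their common points are the coordinates of the limit. *)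
Lemma C_limit_rate (u : nat -> C) D : 0 <= D ->
  (forall n, Cmod (u (S n) - u n) <= D * (/ (INR n + 1) - / (INR n + 2))) ->
  exists l, forall n, Cmod (u n - l) <= 2 * D / (INR n + 1).
Proof.
intros HD H.
assert (Pos : forall n, 0 < / (INR n + 1)).
{ intros n; apply Rinv_0_lt_compat; assert (T := pos_INR n); lra. }
assert (W : forall v : nat -> R,
  (forall n, Rabs (v (S n) - v n) <= D * (/ (INR n + 1) - / (INR n + 2))) ->
  exists l, forall n, Rabs (v n - l) <= D / (INR n + 1)).
{ intros v Hv.
  assert (E : forall n, INR (S n) + 1 = INR n + 2) by (intros; rewrite S_INR; ring).
  destruct (nested_intervals (fun n => v n - D / (INR n + 1)) (fun n => 2 * D / (INR n + 1))) as [l Hl].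
  - intros n; specialize (Hv n); apply Rabs_le_between in Hv; rewrite E; unfold Rdiv; lra.
  - intros n; specialize (Hv n); apply Rabs_le_between in Hv; rewrite E; unfold Rdiv; lra.
  - intros n; specialize (Pos n); unfold Rdiv; nra.
  - exists l; intros n; specialize (Hl n); simpl in Hl; apply Rabs_le; unfold Rdiv in *; lra. }
destruct (W (fun n => Re (u n))) as [x Hx].
{ intros n; eapply Rle_trans; [|apply H].
  apply re_minus_le. }
destruct (W (fun n => Im (u n))) as [y Hy].
{ intros n; eapply Rle_trans; [|apply H].
  apply im_minus_le. }
exists (x, y); intros n; specialize (Hx n); specialize (Hy n); simpl in Hx, Hy.
eapply Rle_trans; [apply Cmod_le_Re_Im|]; simpl; unfold Re, Im, Rminus in *.
unfold Rdiv in *; lra.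
Qed.

Lemma pow4_pow2 n : 4 ^ n = 2 ^ n * 2 ^ n.
Proof. rewrite <- Rpow_mult_distr; f_equal; ring. Qed.

(** From [x < 2^-(2n+1)] and [ln 2 > 1/2]. *)
Lemma ln_pow2_lower (n : nat) (x : R) : 0 < x -> 4 ^ S n * x < 2 -> INR n + 1 <= 2 * - ln x.
Proof.
intros Hx H.
assert (P : 0 < 2 ^ n) by (apply pow_lt; lra).
assert (E : 4 ^ S n = 4 * (2 ^ n * 2 ^ n)) by (simpl; now rewrite pow4_pow2).
rewrite E in H; assert (PP : 0 < 2 ^ n * 2 ^ n) by nra.
assert (Hx' : x < / (2 ^ n * 2 ^ n * 2)).
{ apply (Rmult_lt_reg_l (2 ^ n * 2 ^ n * 2)); [nra|]; rewrite Rinv_r by nra; lra. }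
assert (L := ln_increasing _ _ Hx Hx').
rewrite ln_Rinv, !ln_mult, ln_pow in L by nra.
assert (L2 := ln_lt_2); assert (N := pos_INR n); nra.
Qed.

(** The hypotheses describe the annulus on which consecutive inner cutoffs can differ. There
    [1 / |z|] is at most [4 * 2^n] and the logarithmic factor at most [4 / (n + 1)^2]. *)
Lemma poincare_weighted_bound (n : nat) (z : C) : z <> 0 ->
  4 ^ S n * Cmod z ^ 2 < 2 -> 1 < 4 ^ S (S n) * Cmod z ^ 2 ->
  Cmod z * poincare z <= 16 * 2 ^ n / (INR n + 1) ^ 2.
Proof.
intros Hz H1 H2; assert (Hm := proj1 (Cmod_gt_0 z) Hz).
assert (P : 0 < 2 ^ n) by (apply pow_lt; lra).
assert (N := pos_INR n).
assert (L := ln_pow2_lower n (Cmod z ^ 2) ltac:(apply pow_lt; easy) H1).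
unfold poincare; set (l := - ln (Cmod z ^ 2)) in *.
assert (Hi : / Cmod z <= 4 * 2 ^ n).
{ assert (1 < 4 * 2 ^ n * Cmod z).
  { apply Rnot_le_lt; intros Hc.
    assert (E : 4 ^ S (S n) * Cmod z ^ 2 = (4 * 2 ^ n * Cmod z) ^ 2)
      by (simpl; rewrite pow4_pow2; ring).
    rewrite E in H2; assert (0 < 4 * 2 ^ n * Cmod z) by nra; nra. }
  apply (Rmult_le_reg_l (Cmod z)); [easy|]; rewrite Rinv_r by lra; lra. }
assert (Hl : / (l ^ 2) <= 4 / (INR n + 1) ^ 2).
{ replace (4 / (INR n + 1) ^ 2) with (/ (((INR n + 1) / 2) ^ 2)) by (field; lra).
  apply Rinv_le_contravar; [apply pow_lt; lra|]; apply pow_incr; lra. }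
replace (Cmod z * (1 / (Cmod z ^ 2 * l ^ 2))) with (/ Cmod z * / (l ^ 2)) by (field; lra).
replace (16 * 2 ^ n / (INR n + 1) ^ 2) with (4 * 2 ^ n * (4 / (INR n + 1) ^ 2)) by (field; lra).
apply Rmult_le_compat; try easy; apply Rlt_le, Rinv_0_lt_compat; [easy|apply pow_lt; lra].
Qed.

Definition poincare_bounded (k : C -> C) (K : R) : Prop := 0 < K /\
  forall z, punctured_disc z -> C1at k z /\ Cmod (k z) <= K * poincare z.

(** The first term confines the support to [|z|^2 <= 1/2], the second removes a neighbourhood of 0
    of radius about [2^-n]. The terms cancel for [n = 0], and consecutive differences live on single
    dyadic annuli. *)
Definition annulus_cutoff (n : nat) (z : C) : R :=
  cutoff (4 * Cmod z ^ 2) - cutoff (4 ^ S n * Cmod z ^ 2).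

Definition density (k : C -> C) (n : nat) (z : C) : C :=
  (RtoC (annulus_cutoff n z) * (z * k z))%C.

Lemma pow4_ge_4 n : 4 <= 4 ^ S n.
Proof. assert (H := pow_R1_Rle 4 n ltac:(lra)); simpl; lra. Qed.

Lemma density_outside k n z : 1 <= 2 * Cmod z ^ 2 -> density k n z = 0.
Proof.
intros H; unfold density, annulus_cutoff; assert (P := pow4_ge_4 n).
rewrite !cutoff_0 by nra; rewrite Rminus_0_r; ring.
Qed.

Lemma density_inside k n z : 4 ^ S n * Cmod z ^ 2 <= 1 -> density k n z = 0.
Proof.
intros H; unfold density, annulus_cutoff; assert (P := pow4_ge_4 n).
assert (S := pow2_ge_0 (Cmod z)).
rewrite !cutoff_1 by nra; rewrite Rminus_diag; ring.
Qed.

Lemma density_exact k n z : 4 * Cmod z ^ 2 <= 1 -> 2 <= 4 ^ S n * Cmod z ^ 2 ->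
  density k n z = (z * k z)%C.
Proof.
intros H1 H2; unfold density, annulus_cutoff; rewrite cutoff_1, cutoff_0 by easy.
rewrite Rminus_0_r; ring.
Qed.

Lemma density_C1 k K n z : poincare_bounded k K -> C1at (density k n) z.
Proof.
intros [_ Hk].
destruct (Ceq_dec z 0) as [->|Hz0].
- apply (C1at_ext_near (fun _ => RtoC 0)); [|apply C1at_const].
  exists (/ 4 ^ S n); assert (P := pow4_ge_4 n); split; [apply Rinv_0_lt_compat; lra|].
  intros w Hw; symmetry; apply density_inside.
  replace (w - 0)%C with w in Hw by ring.
  assert (Q : Cmod w * 4 ^ S n < 1).
  { apply (Rmult_lt_compat_r (4 ^ S n)) in Hw; [|lra]; rewrite Rinv_l in Hw; lra. }
  assert (X := Cmod_ge_0 w); nra.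
- destruct (Rlt_dec (Cmod z) 1) as [H1|H1].
  + apply C1at_mult; [|apply C1at_mult; [apply C1at_id|apply Hk; split; easy]].
    unfold annulus_cutoff.
    apply (C1at_ext_near (fun w => RtoC (cutoff (4 * Cmod w ^ 2)) - RtoC (cutoff (4 ^ S n * Cmod w ^ 2)))%C).
    * exists 1; split; [lra|]; intros w _; now rewrite RtoC_minus.
    * apply C1at_minus; apply C1at_cutoff.
  + apply (C1at_ext_near (fun _ => RtoC 0)); [|apply C1at_const].
    exists (1 / 4); split; [lra|]; intros w Hw; symmetry; apply density_outside.
    assert (T := Cmod_ge_sub z w); nra.
Qed.

(** The outer cutoffs cancel. The inner ones agree, being both 0 or both 1, except on the annulus
    treated in [poincare_weighted_bound], which lies in the disc of radius [2^-n]. *)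
Lemma density_step k K n z : poincare_bounded k K ->
  Cmod (density k (S n) z - density k n z) <= K * (16 * 2 ^ n / (INR n + 1) ^ 2) /\
  (/ 2 ^ n < Cmod z -> density k (S n) z - density k n z = 0)%C.
Proof.
intros [HK Hkb].
assert (P : 0 < 2 ^ n) by (apply pow_lt; lra).
assert (P4 := pow4_ge_4 n).
assert (N := pos_INR n).
assert (E : (density k (S n) z - density k n z)%C = (RtoC (cutoff (4 ^ S n * Cmod z ^ 2) -
   cutoff (4 ^ S (S n) * Cmod z ^ 2)) * (z * k z))%C).
{ unfold density, annulus_cutoff; rewrite !RtoC_minus; ring. }
assert (Sq := pow2_ge_0 (Cmod z)).
assert (E4 : 4 ^ S (S n) = 4 * 4 ^ S n) by reflexivity.
assert (R0 : 0 <= K * (16 * 2 ^ n / (INR n + 1) ^ 2)).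
{ apply Rmult_le_pos; [lra|]; apply Rle_mult_inv_pos; [lra|apply pow_lt; lra]. }
destruct (Rle_dec 2 (4 ^ S n * Cmod z ^ 2)) as [H1|H1].
{ rewrite E, !cutoff_0, Rminus_diag, Cmult_0_l, Cmod_0 by nra; auto. }
split.
- destruct (Rle_dec (4 ^ S (S n) * Cmod z ^ 2) 1) as [H2|H2].
  { rewrite E, !cutoff_1, Rminus_diag, Cmult_0_l, Cmod_0 by nra; auto. }
  assert (Hz0 : z <> 0).
  { intros ->; rewrite Cmod_0 in H2; apply H2; ring_simplify; lra. }
  assert (Hz1 : Cmod z < 1) by (apply Rnot_le_lt; intros Hc; apply H1; nra).
  rewrite E, !Cmod_mult, Cmod_R.
  destruct (Hkb z (conj Hz1 Hz0)) as [_ Hk].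
  assert (Hp := poincare_weighted_bound n z Hz0 ltac:(lra) ltac:(lra)).
  assert (C1 := cutoff_range (4 ^ S n * Cmod z ^ 2)); assert (C2 := cutoff_range (4 ^ S (S n) * Cmod z ^ 2)).
  assert (A : Rabs (cutoff (4 ^ S n * Cmod z ^ 2) - cutoff (4 ^ S (S n) * Cmod z ^ 2)) <= 1)
    by (apply Rabs_le; lra).
  assert (B : Cmod z * Cmod (k z) <= K * (Cmod z * poincare z)).
  { replace (K * (Cmod z * poincare z)) with (Cmod z * (K * poincare z)) by ring.
    apply Rmult_le_compat_l; [apply Cmod_ge_0|easy]. }
  apply Rle_trans with (1 * (Cmod z * Cmod (k z))).
  + apply Rmult_le_compat_r; [apply Rmult_le_pos; apply Cmod_ge_0|easy].
  + rewrite Rmult_1_l; eapply Rle_trans; [exact B|]; apply Rmult_le_compat_l; lra.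
- intros Hz; exfalso; apply H1.
  assert (Q : 1 < 2 ^ n * Cmod z).
  { apply (Rmult_lt_compat_l (2 ^ n)) in Hz; [|easy]; rewrite Rinv_r in Hz; lra. }
  replace (4 ^ S n * Cmod z ^ 2) with (4 * (2 ^ n * Cmod z) ^ 2) by (simpl; rewrite pow4_pow2; ring).
  nra.
Qed.

(** The powers of 2 in the height and in the radius of the support cancel, leaving
    [256 * K / (n + 1)^2] with [256 = 16 * 16]. The telescoping majorant costs another factor 2,
    since [n + 2 <= 2 * (n + 1)]. *)
Lemma approx_step k K n z : poincare_bounded k K ->
  Cmod (cauchy_transform (density k (S n)) z - cauchy_transform (density k n) z) <= 512 * K * (/ (INR n + 1) - / (INR n + 2)).
Proof.
intros Hb; assert (HK := proj1 Hb).
assert (Cd : forall m p, ccont (density k m) p) by (intros; eapply C1at_ccont, density_C1, Hb).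
assert (P : 0 < 2 ^ n) by (apply pow_lt; lra).
assert (N := pos_INR n).
rewrite <- cauchy_transform_minus by auto.
eapply Rle_trans.
- apply (cauchy_transform_bound _ z (/ 2 ^ n) (K * (16 * 2 ^ n / (INR n + 1) ^ 2))).
  + intros p; now apply ccont_minus.
  + now apply Rlt_le, Rinv_0_lt_compat.
  + intros p; apply (density_step k K n p Hb).
  + intros p; apply (density_step k K n p Hb).
- replace (16 * (K * (16 * 2 ^ n / (INR n + 1) ^ 2)) * / 2 ^ n) with (256 * K * / (INR n + 1) ^ 2)
    by (field; lra).
  replace (/ (INR n + 1) - / (INR n + 2)) with (/ ((INR n + 1) * (INR n + 2))) by (field; lra).
  apply Rle_trans with (256 * K * (2 * / ((INR n + 1) * (INR n + 2)))); [|right; ring].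
  apply Rmult_le_compat_l; [lra|].
  replace (2 * _) with (/ ((INR n + 1) * (INR n + 2) / 2)) by (field; lra).
  apply Rinv_le_contravar; nra.
Qed.

(** Instead of differentiability of [Q], the conclusion offers exact solutions of the equation
    arbitrarily close to [Q] on a fixed square. This suits [hol_uniform_limit]. The radius 1/2 is
    that of the disc on which the outer cutoff equals 1. *)
Lemma dbar_solution k K : poincare_bounded k K -> exists Q : C -> C, Q 0 = 0 /\ ccont Q 0 /\
  forall z0 : C, z0 <> 0 -> Cmod z0 < 1 / 2 -> exists rho, 0 < rho /\
    (forall p, square z0 rho p -> p <> 0 /\ Cmod p < 1 / 2) /\
    forall eps, 0 < eps -> exists G, forall p, square z0 rho p ->
      (exists A, wdiff G p A (p * k p)) /\ Cmod (G p - Q p) <= eps.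
Proof.
intros Hb; assert (HK := proj1 Hb).
set (approx := fun n => cauchy_transform (density k n)).
set (lim := fun z => epsilon (inhabits (RtoC 0))
  (fun l => forall n, Cmod (approx n z - l) <= 2 * (512 * K) / (INR n + 1))).
assert (Hlim : forall z n, Cmod (approx n z - lim z) <= 1024 * K / (INR n + 1)).
{ intros z; replace (1024 * K) with (2 * (512 * K)) by ring; unfold lim; apply epsilon_spec.
  apply C_limit_rate; [lra|]; intros n; now apply (approx_step k K). }
assert (Hn : forall eps, 0 < eps -> exists n0, forall n, (n0 <= n)%nat -> 1024 * K / (INR n + 1) <= eps).
{ intros eps He; destruct (INR_unbounded (1024 * K / eps)) as [n0 H0]; exists n0; intros n Hle.
  assert (T := le_INR _ _ Hle); assert (T0 := pos_INR n0).
  apply Rle_div_l; [lra|]; apply Rlt_div_l in H0; [|easy]; nra. }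
assert (Da : forall n z, Cmod z < 1 -> exists A, wdiff (approx n) z A (density k n z)).
{ intros n z Hz; destruct (C1at_coefficients (density k n)) as (A & B & HAB).
  { intros p; now apply (density_C1 k K). }
  exists (cauchy_transform A z); rewrite <- (cauchy_transform_dbar (density k n) A B z HAB); auto.
  - now apply cauchy_transform_wdiff.
  - intros p Hp; apply density_outside; nra. }
(* The approximations converge uniformly on the plane, 0 included, so the limit is continuous at 0;
   subtracting its value there does not affect the equation. *)
exists (fun z => lim z - lim 0)%C; split; [ring|split].
- intros eps He; destruct (Hn (eps / 3) ltac:(lra)) as [n H].
  specialize (H n (Nat.le_refl n)).
  destruct (Da n 0) as [A HA]; [rewrite Cmod_0; lra|].
  eapply near_imp; [|apply (wdiff_ccont _ _ _ _ HA (eps / 3)); lra]; intros w Hw; cbv beta in *.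
  assert (H1 := Hlim w n); assert (H2 := Hlim 0 n).
  replace (_ - _)%C with (- (approx n w - lim w) + ((approx n w - approx n 0) + (approx n 0 - lim 0)))%C by ring.
  eapply Rle_lt_trans; [apply Cmod_triangle|]; rewrite Cmod_opp.
  assert (T := Cmod_triangle (approx n w - approx n 0) (approx n 0 - lim 0)); lra.
- intros z0 Hz0 Hz1; assert (Hm := proj1 (Cmod_gt_0 z0) Hz0).
  set (d := Rmin (Cmod z0 / 2) (1 / 2 - Cmod z0)).
  destruct (near_square z0 (fun p => Cmod (p - z0) < d)) as (rho & Hrho & Hsq).
  { exists d; split; [apply Rmin_glb_lt; lra|auto]. }
  assert (Hp : forall p, square z0 rho p -> Cmod z0 / 2 < Cmod p < 1 / 2).
  { intros p Hp; specialize (Hsq p Hp); cbv beta in Hsq.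
    assert (A1 := Rlt_le_trans _ _ _ Hsq (Rmin_l _ _)); assert (A2 := Rlt_le_trans _ _ _ Hsq (Rmin_r _ _)).
    assert (T := Cmod_ge_sub z0 p); assert (T' := Cmod_ge_sub p z0); rewrite Cmod_sub_sym in T'; lra. }
  exists rho; split; [easy|]; split.
  { intros p H; specialize (Hp p H); split; [apply Cmod_gt_0; lra|lra]. }
  intros eps He; destruct (Hn eps He) as [n1 H1].
  (* Beyond [n2] the inner cutoff vanishes on the whole square: there [|p| > |z0| / 2], and the
     crude bound [n <= 4^(n+1)] gives [4^(n+1) |p|^2 >= 2]. *)
  destruct (INR_unbounded (8 / Cmod z0 ^ 2)) as [n2 H2].
  set (n := max n1 n2); exists (fun z => approx n z - lim 0)%C; intros p Hsp.
  specialize (Hp p Hsp); split.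
  + destruct (Da n p) as [A HA]; [lra|]; exists A; eapply wdiff_eq.
    * apply wdiff_minus; [exact HA|apply wdiff_const].
    * ring.
    * rewrite density_exact; [ring|nra|].
      assert (Hn2 : INR n2 <= INR n) by apply le_INR, Nat.le_max_r.
      assert (H4 : INR n <= 4 ^ S n).
      { clear; induction n as [|n IH]; [simpl; lra|]; rewrite S_INR.
        change (4 ^ S (S n)) with (4 * 4 ^ S n); assert (T := pow4_ge_4 n); lra. }
      assert (S0 : 0 < Cmod z0 ^ 2) by now apply pow_lt.
      apply Rlt_div_l in H2; [|easy].
      assert (Cmod z0 ^ 2 / 4 <= Cmod p ^ 2) by nra.
      assert (4 ^ S n * (Cmod z0 ^ 2 / 4) <= 4 ^ S n * Cmod p ^ 2)
        by (apply Rmult_le_compat_l; [apply pow_le; lra|easy]).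
      nra.
  + replace (_ - _)%C with (approx n p - lim p)%C by ring.
    eapply Rle_trans; [apply Hlim|]; apply H1, Nat.le_max_l.
Qed.

(** * Exponential, logarithm, polar coordinates *)

Definition Cexp (z : C) : C := (RtoC (exp (Re z)) * cis (Im z))%C.

Lemma Cexp_wdiff z : wdiff Cexp z (Cexp z) 0.
Proof.
assert (He : wdiff (fun w => RtoC (exp (Re w))) z (RtoC (exp (Re z)) * / 2) (Cconj (RtoC (exp (Re z)) * / 2))).
{ apply (wdiff_real_comp exp Re).
  - rewrite half_conj; apply wdiff_Re.
  - apply is_derive_Reals, derivable_pt_lim_exp. }
assert (Hc := rderiv_wdiff cis (Im z) _ (cis_rderiv (Im z))).
assert (Hm : wdiff (fun w => - Ci * w)%C z (- Ci) 0).
{ eapply wdiff_eq; [apply wdiff_cmult, wdiff_id|ring|ring]. }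
assert (Eim : forall w : C, Re (- Ci * w) = Im w) by (intros [x y]; simpl; ring).
(* [Hc] concerns the real point [Im z]; as the function depends on the real part only, its
   coefficients are the same at [- Ci * z], which has real part [Im z]. *)
assert (Hc' : wdiff (fun w => cis (Re w)) (- Ci * z)%C (Ci * cis (Im z) * / 2) (Ci * cis (Im z) * / 2)).
{ intros eps Heps; destruct (Hc eps Heps) as (d & Hd & H); exists d; split; [easy|]; intros w Hw.
  assert (X : Rabs (Re w - Im z) < d).
  { eapply Rle_lt_trans; [|exact Hw].
    replace (Re w - Im z) with (Re (w - - Ci * z)); [apply re_le_Cmod|].
    destruct w, z; simpl; ring. }
  specialize (H (RtoC (Re w))).
  rewrite <- RtoC_minus, Cmod_R, !re_RtoC in H; specialize (H X).
  rewrite Eim; eapply Rle_trans; [|eapply Rle_trans; [exact H|]].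
  - right; f_equal.
    assert (EE : (w - - Ci * z + Cconj (w - - Ci * z))%C = (2 * RtoC (Re w - Im z))%C).
    { destruct w, z; apply C_eq; simpl; ring. }
    rewrite Cconj_RtoC.
    transitivity (cis (Re w) - cis (Im z) - Ci * cis (Im z) * / 2 * (w - - Ci * z + Cconj (w - - Ci * z)))%C;
      [ring|rewrite EE; ring].
  - apply Rmult_le_compat_l; [lra|].
    replace (Re w - Im z) with (Re (w - - Ci * z)); [apply re_le_Cmod|].
    destruct w, z; simpl; ring. }
assert (Hcis : wdiff (fun w => cis (Im w)) z (cis (Im z) * / 2) (- (cis (Im z) * / 2))).
{ apply (wdiff_ext (fun w => cis (Re (- Ci * w)))); [intros; now rewrite Eim|].
  eapply wdiff_eq; [apply (wdiff_comp (fun w => - Ci * w)%C (fun w => cis (Re w))); [exact Hm|exact Hc']| |];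
   rewrite ?Cconj_RtoC;
   rewrite ?Copp_conj, ?Cconj_Ci;
   set (e := cis (Im z)).
  - transitivity (- (Ci * Ci) * (e * / 2))%C; [ring|].
    rewrite Ci_sqr; ring.
  - transitivity ((Ci * Ci) * (e * / 2))%C; [ring|].
    rewrite Ci_sqr; ring. }
eapply wdiff_eq; [apply wdiff_mult; [exact He|exact Hcis]| |]; cbv beta; unfold Cexp.
- field.
- rewrite Cmult_conj, half_conj, Cconj_RtoC; ring.
Qed.

Lemma cis_plus s t : cis (s + t) = (cis s * cis t)%C.
Proof. unfold cis; rewrite cos_plus, sin_plus; apply C_eq; simpl; ring. Qed.

Lemma Cexp_plus z w : Cexp (z + w) = (Cexp z * Cexp w)%C.
Proof.
unfold Cexp; rewrite re_plus, im_plus, exp_plus, cis_plus, RtoC_mult; ring.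
Qed.

Lemma Cmod_Cexp z : Cmod (Cexp z) = exp (Re z).
Proof.
unfold Cexp; rewrite Cmod_mult, Cmod_cis, Cmod_R_nonneg; [ring|apply Rlt_le, exp_pos].
Qed.

Lemma Cexp_neq_0 z : Cexp z <> 0.
Proof. apply Cmod_gt_0; rewrite Cmod_Cexp; apply exp_pos. Qed.

Lemma polar_coordinates (z : C) : exists t, - PI <= t <= PI /\ z = (RtoC (Cmod z) * cis t)%C.
Proof.
destruct (Ceq_dec z 0) as [->|Hz].
{ exists 0; split; [assert (P := PI_RGT_0); lra|]; rewrite Cmod_0; ring. }
assert (Hm := proj1 (Cmod_gt_0 z) Hz); set (m := Cmod z) in *.
set (x := Re z / m); set (y := Im z / m).
assert (Exy : x ^ 2 + y ^ 2 = 1).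
{ unfold x, y; replace ((Re z / m) ^ 2 + (Im z / m) ^ 2) with ((Re z ^ 2 + Im z ^ 2) / m ^ 2) by (field; lra).
  rewrite <- Cmod2_alt; fold m; field; lra. }
assert (Hx : -1 <= x <= 1) by (split; nra).
assert (Ez : z = (RtoC m * (x, y))%C) by (apply C_eq; unfold x, y; simpl; field; lra).
assert (Sq : forall s, 0 <= s -> s ^ 2 = 1 - x ^ 2 -> sin (acos x) = s).
{ intros s Hs E; rewrite sin_acos by easy; rewrite Rsqr_pow2, <- E; now apply sqrt_pow2. }
assert (A := acos_bound x).
destruct (Rle_dec 0 y) as [Hy|Hy].
- exists (acos x); split; [lra|]; rewrite Ez at 1; f_equal; unfold cis.
  rewrite cos_acos by easy; rewrite (Sq y); [reflexivity|easy|lra].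
- exists (- acos x); split; [lra|]; rewrite Ez at 1; f_equal; unfold cis.
  rewrite cos_neg, sin_neg, cos_acos by easy; rewrite (Sq (- y)); [f_equal; ring|lra|].
  replace ((- y) ^ 2) with (y ^ 2) by ring; lra.
Qed.

Lemma Cexp_surj (z : C) : z <> 0 -> exists w, Cexp w = z.
Proof.
intros Hz; destruct (polar_coordinates z) as (t & _ & E); exists (ln (Cmod z), t).
unfold Cexp; simpl; rewrite exp_ln by now apply Cmod_gt_0.
now rewrite <- E.
Qed.

(** The principal logarithm on the half-plane [Re z > 0]. On the other half-planes a branch is
    obtained by rotating the argument first. *)
Definition Clog (z : C) : C := (ln (Cmod z ^ 2) / 2, atan (Im z / Re z)).

Lemma wdiff_Im z : wdiff (fun w => RtoC (Im w)) z (- Ci * / 2) (Cconj (- Ci * / 2)).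
Proof.
apply (wdiff_ext (fun w => - Ci * / 2 * (w - Cconj w))%C).
{ intros [x y]; apply C_eq; simpl; field. }
eapply wdiff_eq; [apply wdiff_cmult, wdiff_minus; [apply wdiff_id|apply wdiff_conj_id]|ring|].
apply C_eq; simpl; field.
Qed.

Lemma wdiff_sqr_mod z : wdiff (fun w => RtoC (Cmod w ^ 2)) z (Cconj z) (Cconj (Cconj z)).
Proof.
apply (wdiff_ext (fun w => w * Cconj w)%C); [intros; now rewrite Cmod2_conj|].
eapply wdiff_eq; [apply wdiff_mult; [apply wdiff_id|apply wdiff_conj_id]|cbv beta; ring|].
cbv beta; rewrite Cconj_conj; ring.
Qed.

Lemma Cconj_Re_Im z : Cconj z = (RtoC (Re z) - Ci * RtoC (Im z))%C.
Proof. destruct z; apply C_eq; simpl; ring. Qed.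

Lemma Clog_wdiff (z : C) : 0 < Re z -> wdiff Clog z (/ z) 0.
Proof.
intros Hx.
assert (Hz : z <> 0) by (intros ->; simpl in Hx; lra).
assert (Hm := proj1 (Cmod_gt_0 z) Hz).
assert (Hm2 : 0 < Cmod z ^ 2) by now apply pow_lt.
assert (Hzc : Cconj z <> 0).
{ apply Cmod_gt_0; now rewrite Cmod_conj. }
assert (HRe : RtoC (Re z) <> 0) by (apply RtoC_neq_0; lra).
assert (L : wdiff (fun w => RtoC (ln (Cmod w ^ 2))) z (RtoC (/ Cmod z ^ 2) * Cconj z) (Cconj (RtoC (/ Cmod z ^ 2) * Cconj z))).
{ apply (wdiff_real_comp ln (fun w => Cmod w ^ 2)); [apply wdiff_sqr_mod|].
  apply is_derive_Reals, derivable_pt_lim_ln, Hm2. }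
assert (Q : exists a, wdiff (fun w => RtoC (Im w / Re w)) z a (Cconj a) /\
   a = (- Ci * / 2 * Cconj z * / (RtoC (Re z) * RtoC (Re z)))%C).
{ eexists; split; [|reflexivity].
  assert (W := wdiff_mult _ _ _ _ _ _ _ (wdiff_Im z) (wdiff_inv _ _ _ _ HRe (wdiff_Re z))).
  assert (N : near z (fun w => (RtoC (Im w) * / RtoC (Re w))%C = RtoC (Im w / Re w))).
  { exists (Re z); split; [easy|]; intros w Hw.
    assert (Re w <> 0).
    { intros E; assert (T := re_le_Cmod (w - z)).
      replace (Re (w - z)) with (- Re z) in T by (transitivity (Re w - Re z); [rewrite E; ring|unfold Re; simpl; ring]).
      rewrite Rabs_Ropp, Rabs_pos_eq in T; lra. }
    unfold Rdiv; now rewrite RtoC_mult, RtoC_inv. }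
  apply (wdiff_ext_near _ _ _ _ _ N) in W.
  cbv beta in W; assert (E := wdiff_real _ _ _ _ W); rewrite E in W; eapply wdiff_eq; [exact W| |f_equal];
   (replace (Cconj z) with (RtoC (Re z) - Ci * RtoC (Im z))%C by (symmetry; apply Cconj_Re_Im);
    transitivity ((- Ci * RtoC (Re z) - RtoC (Im z)) * / 2 * / (RtoC (Re z) * RtoC (Re z)))%C;
    [field; easy|];
    transitivity ((- Ci * RtoC (Re z) + (Ci * Ci) * RtoC (Im z)) * / 2 * / (RtoC (Re z) * RtoC (Re z)))%C;
    [rewrite Ci_sqr; field; easy|field; easy]). }
destruct Q as (a & Ha & Ea).
assert (T : wdiff (fun w => RtoC (atan (Im w / Re w))) z (RtoC (/ (1 + (Im z / Re z) ^ 2)) * a)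
  (Cconj (RtoC (/ (1 + (Im z / Re z) ^ 2)) * a))).
{ apply (wdiff_real_comp atan (fun w => Im w / Re w)); [exact Ha|].
  apply is_derive_Reals, derivable_pt_lim_atan. }
assert (Eabs : (RtoC (/ (1 + (Im z / Re z) ^ 2)) * a)%C = (- Ci * / 2 * / z)%C).
{ rewrite Ea.
  replace (/ (1 + (Im z / Re z) ^ 2)) with (Re z * Re z * / Cmod z ^ 2).
  2: { assert (R2 := Cmod2_alt z); rewrite R2; field; split; [lra|].
       assert (0 < Re z ^ 2) by (apply pow_lt; lra); assert (0 <= Im z ^ 2) by apply pow2_ge_0; lra. }
  rewrite !RtoC_mult, RtoC_inv, Cmod2_conj by lra; field; repeat split; easy. }
assert (El : (RtoC (/ Cmod z ^ 2) * Cconj z)%C = (/ z)%C).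
{ rewrite RtoC_inv, Cmod2_conj by lra; field; split; easy. }
rewrite Eabs in T; rewrite El in L.
apply (wdiff_ext (fun w => / 2 * RtoC (ln (Cmod w ^ 2)) + Ci * RtoC (atan (Im w / Re w)))%C).
{ intros w; unfold Clog; apply C_eq; simpl; field. }
eapply wdiff_eq; [apply wdiff_plus; [apply wdiff_cmult; exact L|apply wdiff_cmult; exact T]| |].
- transitivity (/ 2 * / z - (Ci * Ci) * / 2 * / z)%C; [ring|].
  rewrite Ci_sqr; field; easy.
- rewrite !Cmult_conj, Copp_conj, half_conj.
  rewrite Cconj_Ci.
  transitivity (/ 2 * Cconj (/ z) + (Ci * Ci) * / 2 * Cconj (/ z))%C; [ring|].
  rewrite Ci_sqr; ring.
Qed.

(** On the first quadrant both [z] and [- Ci * z] lie in the right half-plane, and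
    [atan t + atan (1 / t) = PI / 2]. This single comparison of branches, rotated, is used in all
    four quadrants around the origin. *)
Lemma Clog_rotate (z : C) : 0 < Re z -> 0 < Im z ->
  Clog z = (Clog (- Ci * z) + Ci * RtoC (PI / 2))%C.
Proof.
intros Hx Hy; unfold Clog.
rewrite Cmod_mult, Cmod_opp, Cmod_Ci, Rmult_1_l.
destruct z as [x y]; simpl in *.
replace (_ / (- 0 * x - - (1) * y)) with (- (x / y)) by (field; lra).
rewrite atan_opp; replace (y / x) with (/ (x / y)) by (field; lra).
rewrite atan_inv by (apply Rdiv_lt_0_compat; lra).
apply C_eq; simpl; ring.
Qed.

(** * Growth of a function with logarithmic singularity *)

Lemma nonincreasing_of_derive (f f' : R -> R) a b : a <= b ->
  (forall t, a <= t <= b -> is_derive f t (f' t) /\ f' t <= 0) -> f b <= f a.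
Proof.
intros [Hab|<-] H; [|lra].
destruct (MVT_gen f a b f') as (c & Hc & E).
- intros t; rewrite Rmin_left, Rmax_right by lra; intros Ht; apply H; lra.
- intros t; rewrite Rmin_left, Rmax_right by lra; intros Ht.
  apply continuity_pt_filterlim, (ex_derive_continuous f); exists (f' t); now apply H.
- rewrite Rmin_left, Rmax_right in Hc by lra; destruct (H c Hc); nra.
Qed.

Lemma real_curve_derive (u : C -> R) (g : R -> C) t v A : rderiv g t v ->
  wdiff (fun w => RtoC (u w)) (g t) A (Cconj A) ->
  is_derive (fun s => u (g s)) t (2 * Re (A * v)).
Proof.
intros Hg Hu; destruct (wdiff_rderiv _ _ _ _ _ _ Hg Hu) as [X _]; simpl in X.
replace (2 * Re (A * v)) with (Re A * Re v - Im A * Im v + (Re A * Re v - - Im A * - Im v));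
  [exact X|unfold Re, Im; simpl; ring].
Qed.

(** Along a ray the derivative of [u] is [2 Re (Q + mu) / s], which lies within [2 del / s] of
    [2 Re mu / s] once [|Q| <= del]. Hence [u] compared with [2 (Re mu + del) ln s] and with
    [2 (Re mu - del) ln s] is monotone on each ray. *)
Lemma log_growth (u : C -> R) (Q : C -> C) (mu : C) r0 : 0 < r0 ->
  (forall z : C, z <> 0 -> Cmod z < r0 ->
     wdiff (fun w => RtoC (u w)) z ((Q z + mu) * / z) (Cconj ((Q z + mu) * / z))) ->
  Q 0 = 0 -> ccont Q 0 ->
  forall del, 0 < del -> exists r1 M, 0 < r1 /\ forall z : C, z <> 0 -> Cmod z < r1 ->
    Rabs (u z - 2 * Re mu * ln (Cmod z)) <= - 2 * del * ln (Cmod z) + M.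
Proof.
intros Hr0 Hu Q0 HQ del Hdel.
destruct (HQ del Hdel) as (d & Hd & Hn).
set (r1 := Rmin (d / 2) (r0 / 2)).
assert (Hr1 : 0 < r1) by (apply Rmin_glb_lt; lra).
assert (H1 : r1 <= d / 2) by apply Rmin_l; assert (H2 : r1 <= r0 / 2) by apply Rmin_r.
assert (QB : forall z, Cmod z <= r1 -> Cmod (Q z) <= del).
{ intros z Hz; specialize (Hn z); rewrite Q0 in Hn.
  replace (z - 0)%C with z in Hn by ring; replace (Q z - 0)%C with (Q z) in Hn by ring.
  apply Rlt_le, Hn; lra. }
assert (Hpt : forall s t, 0 < s <= r1 -> Cmod (circ 0 s t) = s /\ circ 0 s t <> 0 /\
   circ 0 s t = (RtoC s * cis t)%C).
{ intros s t Hs; assert (E : circ 0 s t = (RtoC s * cis t)%C) by (unfold circ; ring).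
  assert (M : Cmod (circ 0 s t) = s) by (rewrite E, Cmod_mult, Cmod_cis, Cmod_R_nonneg; lra).
  repeat split; auto; apply Cmod_gt_0; lra. }
assert (Hcis : forall t, cis t <> 0) by (intros t; apply Cmod_gt_0; rewrite Cmod_cis; lra).
assert (Rad : forall s t, 0 < s <= r1 ->
  is_derive (fun s => u (circ 0 s t)) s (2 * Re (Q (circ 0 s t) + mu) / s)).
{ intros s t Hs; destruct (Hpt s t Hs) as (P1 & P2 & P3).
  assert (X := real_curve_derive u (fun s => circ 0 s t) s (cis t) _ (radius_rderiv 0 s t)
    (Hu _ P2 ltac:(lra))).
  replace (2 * Re (Q (circ 0 s t) + mu) / s) with
    (2 * Re ((Q (circ 0 s t) + mu) * / circ 0 s t * cis t)); [exact X|].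
  replace ((Q (circ 0 s t) + mu) * / circ 0 s t * cis t)%C with
    (RtoC (/ s) * (Q (circ 0 s t) + mu))%C.
  - rewrite re_scal_l; field; lra.
  - rewrite RtoC_inv by lra; rewrite P3 at 3; field; split; [apply Hcis|apply RtoC_neq_0; lra]. }
assert (Ang : forall t, is_derive (fun t => u (circ 0 r1 t)) t (2 * Re (Ci * (Q (circ 0 r1 t) + mu)))).
{ intros t; destruct (Hpt r1 t ltac:(lra)) as (P1 & P2 & P3).
  assert (X := real_curve_derive u (circ 0 r1) t _ _ (circ_rderiv 0 r1 t) (Hu _ P2 ltac:(lra))).
  replace (Ci * (Q (circ 0 r1 t) + mu))%C with
    ((Q (circ 0 r1 t) + mu) * / circ 0 r1 t * (Ci * (RtoC r1 * cis t)))%C; [exact X|].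
  rewrite <- P3; field; easy. }
set (D := 2 * (del + Cmod mu)).
assert (HD : 0 < D) by (unfold D; assert (T := Cmod_ge_0 mu); lra).
(* The rays start on the circle of radius [r1]; the angular derivative bounds [u] there
   independently of the ray. This is where the imaginary part of [mu] enters. *)
assert (HB : forall t, - PI <= t <= PI -> Rabs (u (circ 0 r1 t) - u (circ 0 r1 0)) <= D * PI).
{ intros t Ht; apply Rle_trans with (D * Rabs (t - 0)).
  - apply (bounded_variation (fun t => u (circ 0 r1 t)) (fun t => 2 * Re (Ci * (Q (circ 0 r1 t) + mu)))).
    intros s _; split; [apply Ang|].
    rewrite Rabs_mult, (Rabs_pos_eq 2) by lra; unfold D; apply Rmult_le_compat_l; [lra|].
    eapply Rle_trans; [apply re_le_Cmod|]; rewrite Cmod_mult, Cmod_Ci, Rmult_1_l.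
    eapply Rle_trans; [apply Cmod_triangle|]; apply Rplus_le_compat_r, QB.
    destruct (Hpt r1 s ltac:(lra)); lra.
  - apply Rmult_le_compat_l; [lra|]; rewrite Rminus_0_r; apply Rabs_le; lra. }
set (M := Rabs (u (circ 0 r1 0)) + D * PI + Rabs (2 * Re mu * ln r1) + Rabs (2 * del * ln r1)).
exists r1, M; split; [easy|]; intros z Hz Hzr.
assert (Hm := proj1 (Cmod_gt_0 z) Hz).
destruct (polar_coordinates z) as (t & Ht & Ez); set (m := Cmod z) in *.
replace z with (circ 0 m t) by (unfold circ; rewrite Ez; ring).
assert (QB' : forall s, 0 < s <= r1 -> - del <= Re (Q (circ 0 s t)) <= del).
{ intros s Hs; apply Rabs_le_between; eapply Rle_trans; [apply re_le_Cmod|]; apply QB.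
  destruct (Hpt s t Hs); lra. }
assert (Up : u (circ 0 r1 t) - 2 * (Re mu + del) * ln r1 <= u (circ 0 m t) - 2 * (Re mu + del) * ln m).
{ apply (nonincreasing_of_derive (fun s => u (circ 0 s t) - 2 * (Re mu + del) * ln s)
    (fun s => 2 * Re (Q (circ 0 s t) + mu) / s - 2 * (Re mu + del) * / s)); [lra|].
  intros s Hs; split.
  - apply (is_derive_minus (fun s => u (circ 0 s t)) (fun s => 2 * (Re mu + del) * ln s)); [apply Rad; lra|].
    apply is_derive_scal, is_derive_Reals, derivable_pt_lim_ln; lra.
  - rewrite re_plus; specialize (QB' s ltac:(lra)).
    assert (0 < / s) by (apply Rinv_0_lt_compat; lra); unfold Rdiv; nra. }
assert (Lo : - u (circ 0 r1 t) + 2 * (Re mu - del) * ln r1 <= - u (circ 0 m t) + 2 * (Re mu - del) * ln m).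
{ apply (nonincreasing_of_derive (fun s => - u (circ 0 s t) + 2 * (Re mu - del) * ln s)
    (fun s => - (2 * Re (Q (circ 0 s t) + mu) / s) + 2 * (Re mu - del) * / s)); [lra|].
  intros s Hs; split.
  - apply (is_derive_plus (fun s => - u (circ 0 s t)) (fun s => 2 * (Re mu - del) * ln s)).
    + apply (is_derive_opp (fun s => u (circ 0 s t))), Rad; lra.
    + apply is_derive_scal, is_derive_Reals, derivable_pt_lim_ln; lra.
  - rewrite re_plus; specialize (QB' s ltac:(lra)).
    assert (0 < / s) by (apply Rinv_0_lt_compat; lra); unfold Rdiv; nra. }
assert (B := HB t Ht); apply Rabs_le_between in B.
assert (T1 := Rle_abs (u (circ 0 r1 0))); assert (T1' := Rle_abs (- u (circ 0 r1 0))).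
assert (T2 := Rle_abs (2 * Re mu * ln r1)); assert (T2' := Rle_abs (- (2 * Re mu * ln r1))).
assert (T3 := Rle_abs (2 * del * ln r1)); assert (T3' := Rle_abs (- (2 * del * ln r1))).
rewrite Rabs_Ropp in T1', T2', T3'.
apply Rabs_le; unfold M; lra.
Qed.

Lemma ex_derive_wdiff f z :
  ex_derive (K := C_AbsRing) (V := C_NormedModule) f z <-> exists l, wdiff f z l 0.
Proof.
assert (E : forall l w, minus (minus (f w) (f z)) (scal (minus w z) l) =
   (f w - f z - l * (w - z) - 0 * Cconj (w - z))%C).
{ intros l w; change (f w - f z - (w - z) * l = f w - f z - l * (w - z) - 0 * Cconj (w - z))%C; ring. }
split.
- intros [l [_ H]]; exists l; intros eps He.
  destruct (H z (fun P HP => HP) (mkposreal eps He)) as [d Hd].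
  exists d; split; [apply cond_pos|]; intros w Hw.
  specialize (Hd w Hw); rewrite E in Hd; exact Hd.
- intros [l H]; exists l; split; [apply is_linear_scal_l|].
  intros x Hx.
  replace x with z by (apply (is_filter_lim_locally_unique (K := C_AbsRing)); exact Hx).
  intros [eps He]; destruct (H eps He) as (d & Hd & Hn).
  exists (mkposreal d Hd); intros w Hw; rewrite E; apply Hn, Hw.
Qed.

Lemma holomorphic_on_hol U f : holomorphic_on U f <-> hol U f.
Proof. split; intros H z Hz; apply ex_derive_wdiff, H, Hz. Qed.

(** * Smooth functions *)

Definition Dx (f : C -> R) (p : C) : R := Derive (fun t => f (t, Im p)) (Re p).
Definition Dy (f : C -> R) (p : C) : R := Derive (fun t => f (Re p, t)) (Im p).

Lemma smooth_Dx U f : smooth_on U f -> smooth_on U (Dx f).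
Proof. intros H z Hz n; destruct (H z Hz (S n)) as (_ & _ & _ & X & _); exact X. Qed.

Lemma smooth_Dy U f : smooth_on U f -> smooth_on U (Dy f).
Proof. intros H z Hz n; destruct (H z Hz (S n)) as (_ & _ & _ & _ & X); exact X. Qed.

Lemma smooth_ccont U f z : smooth_on U f -> U z -> ccont (fun w => RtoC (f w)) z.
Proof.
intros H Hz eps He; destruct (H z Hz O) as [X _]; destruct (X (mkposreal eps He)) as [d Hd].
exists d; split; [apply cond_pos|]; intros w Hw.
rewrite <- RtoC_minus, Cmod_R.
destruct w as [x y], z as [a b]; apply Hd; (eapply Rle_lt_trans; [|exact Hw]).
- apply (re_le_Cmod (x - a, y - b)).
- apply (im_le_Cmod (x - a, y - b)).
Qed.

(** The Wirtinger derivative of a real function with respect to [z]. *)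
Definition grad (f : C -> R) (z : C) : C := ((RtoC (Dx f z) - Ci * RtoC (Dy f z)) * / 2)%C.

(** The increment is split at [(Re z, Im w)]. The horizontal part is controlled by continuity of
    [Dx f] and the mean value inequality, the vertical part by the partial derivative at [z]
    itself. *)
Lemma smooth_wdiff (U : C -> Prop) f z : open U -> smooth_on U f -> U z ->
  wdiff (fun w => RtoC (f w)) z (grad f z) (Cconj (grad f z)).
Proof.
intros HU Hf Hz eps He.
assert (He2 : 0 < eps / 2) by lra.
destruct (near_square z U (open_near U z HU Hz)) as (rho & Hrho & Hsq).
destruct (smooth_ccont U (Dx f) z (smooth_Dx _ _ Hf) Hz (eps / 2) He2) as (d1 & Hd1 & H1).
destruct (Hf z Hz 1%nat) as (_ & _ & EY & _).
assert (DY : is_derive (fun t => f (Re z, t)) (Im z) (Dy f z)) by exact (Derive_correct _ _ EY).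
destruct (proj1 (is_derive_eps _ _ _) DY (eps / 2) He2) as (d2 & Hd2 & H2).
exists (Rmin rho (Rmin (d1 / 2) d2)); split; [repeat apply Rmin_glb_lt; lra|]; intros w Hw.
assert (W0 := Rlt_le_trans _ _ _ Hw (Rmin_l _ _)).
assert (W' := Rlt_le_trans _ _ _ Hw (Rmin_r _ _)).
assert (W1 := Rlt_le_trans _ _ _ W' (Rmin_l _ _)); assert (W2 := Rlt_le_trans _ _ _ W' (Rmin_r _ _)).
assert (AR : Rabs (Re w - Re z) <= Cmod (w - z)).
{ apply re_minus_le. }
assert (AI : Rabs (Im w - Im z) <= Cmod (w - z)).
{ apply im_minus_le. }
assert (BV : Rabs ((f (Re w, Im w) - Dx f z * Re w) - (f (Re z, Im w) - Dx f z * Re z))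
   <= eps / 2 * Rabs (Re w - Re z)).
{ apply (bounded_variation (fun t => f (t, Im w) - Dx f z * t) (fun t => Dx f (t, Im w) - Dx f z)).
  intros t Ht.
  assert (Ut : U (t, Im w)).
  { apply Hsq; split; simpl; [change (fst z) with (Re z)|change (snd z) with (Im z)]; lra. }
  split.
  - destruct (Hf _ Ut 1%nat) as (_ & EX & _).
    assert (DX : is_derive (fun s => f (s, Im w)) t (Dx f (t, Im w))) by exact (Derive_correct _ _ EX).
    apply (is_derive_minus (fun s => f (s, Im w)) (fun s => Dx f z * s)); [exact DX|].
    auto_derive; auto; ring.
  - specialize (H1 (t, Im w)); rewrite <- RtoC_minus, Cmod_R in H1; apply Rlt_le, H1.
    eapply Rle_lt_trans; [apply Cmod_le_Re_Im|].
    replace (Re ((t, Im w) - z)) with (t - Re z) by (unfold Re; simpl; ring).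
    replace (Im ((t, Im w) - z)) with (Im w - Im z) by (unfold Im; simpl; ring); lra. }
specialize (H2 (Im w) ltac:(lra)); cbv beta in H2, BV.
assert (H3 : Rabs (f (Re z, Im w) - f (Re z, Im z) - Dy f z * (Im w - Im z))
  <= eps / 2 * Rabs (Im w - Im z)) by exact H2.
replace (f (Re z, Im z)) with (f z) in H3 by (destruct z; reflexivity).
replace (f (Re w, Im w)) with (f w) in BV by (destruct w; reflexivity).
replace (RtoC (f w) - RtoC (f z) - grad f z * (w - z) - Cconj (grad f z) * Cconj (w - z))%C with
  (RtoC ((f w - Dx f z * Re w - (f (Re z, Im w) - Dx f z * Re z)) +
   (f (Re z, Im w) - f z - Dy f z * (Im w - Im z)))).
- rewrite Cmod_R; eapply Rle_trans; [apply Rabs_triang|].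
  assert (K1 := Rmult_le_compat_l (eps / 2) _ _ (Rlt_le _ _ He2) AR).
  assert (K2 := Rmult_le_compat_l (eps / 2) _ _ (Rlt_le _ _ He2) AI); lra.
- unfold grad; apply C_eq; unfold Re, Im; simpl; field.
Qed.

Lemma smooth_C1at (U : C -> Prop) f z : open U -> smooth_on U f -> U z ->
  C1at (fun w => RtoC (f w)) z.
Proof.
intros HU Hf Hz; exists (grad f), (fun w => Cconj (grad f w)).
assert (G : ccont (grad f) z).
{ apply ccont_mult; [|apply ccont_const]; apply ccont_minus.
  - eapply smooth_ccont; [apply smooth_Dx|]; eauto.
  - apply ccont_mult; [apply ccont_const|]; eapply smooth_ccont; [apply smooth_Dy|]; eauto. }
repeat split; [|easy|now apply ccont_conj].
eapply near_imp; [|apply (open_near U z HU Hz)]; intros w Hw; now apply (smooth_wdiff U).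
Qed.

Lemma smooth_Schwarz (U : C -> Prop) f z : open U -> smooth_on U f -> U z -> Dx (Dy f) z = Dy (Dx f) z.
Proof.
intros HU Hf Hz.
destruct (near_square z U (open_near U z HU Hz)) as (rho & Hrho & Hsq).
assert (Cxy := smooth_Dx _ _ (smooth_Dy _ _ Hf)); assert (Cyx := smooth_Dy _ _ (smooth_Dx _ _ Hf)).
refine (Schwarz (fun x y => f (x, y)) (Re z) (Im z) _ _ _).
- exists (mkposreal rho Hrho); intros u v Hu Hv; simpl in Hu, Hv.
  assert (Huv : U (u, v)) by (apply Hsq; split; simpl; assumption).
  destruct (Hf _ Huv 1%nat) as (_ & E1 & E2 & _).
  destruct (smooth_Dy _ _ Hf _ Huv 1%nat) as (_ & E3 & _ & _).
  destruct (smooth_Dx _ _ Hf _ Huv 1%nat) as (_ & _ & E4 & _).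
  repeat split; assumption.
- destruct (Cxy z Hz O) as [X _]; exact X.
- destruct (Cyx z Hz O) as [X _]; exact X.
Qed.

Definition laplacian (f : C -> R) (z : C) : R := Dx (Dx f) z + Dy (Dy f) z.

Lemma grad_wdiff (U : C -> Prop) f z : open U -> smooth_on U f -> U z ->
  exists A, wdiff (grad f) z A (RtoC (laplacian f z / 4)).
Proof.
intros HU Hf Hz.
assert (W1 := smooth_wdiff U (Dx f) z HU (smooth_Dx _ _ Hf) Hz).
assert (W2 := smooth_wdiff U (Dy f) z HU (smooth_Dy _ _ Hf) Hz).
eexists; eapply wdiff_eq.
- apply (wdiff_ext (fun w => / 2 * (RtoC (Dx f w) + (- Ci) * RtoC (Dy f w)))%C).
  { intros w; unfold grad; ring. }
  apply wdiff_cmult, wdiff_plus; [exact W1|apply wdiff_cmult; exact W2].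
- reflexivity.
- assert (S := smooth_Schwarz U f z HU Hf Hz); unfold grad, laplacian; rewrite <- S.
  apply C_eq; simpl; field.
Qed.

Lemma grad_C1at (U : C -> Prop) f z : open U -> smooth_on U f -> U z -> C1at (grad f) z.
Proof.
intros HU Hf Hz; apply C1at_mult; [|apply C1at_const]; apply C1at_minus.
- eapply smooth_C1at; [exact HU|apply smooth_Dx, Hf|easy].
- apply C1at_mult; [apply C1at_const|]; eapply smooth_C1at; [exact HU|apply smooth_Dy, Hf|easy].
Qed.

(* The coefficients of [d log f] and of [dbar d log f]. *)
Definition dlog (f : C -> R) (z : C) : C := (grad f z * / RtoC (f z))%C.
Definition ddlog (f : C -> R) (z : C) : R :=
  laplacian f z / (4 * f z) - Cmod (grad f z) ^ 2 / f z ^ 2.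

Lemma dlog_wdiff (U : C -> Prop) f z : open U -> smooth_on U f -> U z -> 0 < f z ->
  exists A, wdiff (dlog f) z A (RtoC (ddlog f z)).
Proof.
intros HU Hf Hz Hpos.
assert (H0 : RtoC (f z) <> 0) by (apply RtoC_neq_0; lra).
destruct (grad_wdiff U f z HU Hf Hz) as [A HA].
eexists; eapply wdiff_eq.
- apply wdiff_mult; [exact HA|apply wdiff_inv; [exact H0|apply (smooth_wdiff U); easy]].
- reflexivity.
- unfold ddlog; cbv beta; rewrite RtoC_minus, !RtoC_div, !RtoC_mult, Cmod2_conj, RtoC_pow by
    (try apply pow_nonzero; lra).
  field; easy.
Qed.

Lemma ddlog_C1at (U : C -> Prop) f z : open U -> smooth_on U f -> U z -> 0 < f z ->
  C1at (fun w => RtoC (ddlog f w)) z.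
Proof.
intros HU Hf Hz Hpos.
assert (Cf := smooth_ccont U f z Hf Hz).
assert (H0 : RtoC (f z) <> 0) by (apply RtoC_neq_0; lra).
assert (N0 := ccont_near_neq_0 _ z Cf H0).
apply (C1at_ext_near (fun w => (RtoC (Dx (Dx f) w) + RtoC (Dy (Dy f) w)) * / (RtoC 4 * RtoC (f w))
  - (grad f w * Cconj (grad f w)) * / (RtoC (f w) * RtoC (f w)))%C).
- eapply near_imp; [|exact N0]; intros w Hw; cbv beta in Hw.
  assert (Hw' : f w <> 0) by (intros E; apply Hw; now rewrite E).
  unfold ddlog, laplacian; rewrite RtoC_minus, !RtoC_div, RtoC_mult, RtoC_plus, Cmod2_conj by
    (try apply pow_nonzero; lra).
  rewrite RtoC_pow; field; easy.
- assert (C1 := fun g H => smooth_C1at U g z HU H Hz).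
  assert (Cg := grad_C1at U f z HU Hf Hz).
  apply C1at_minus; apply C1at_mult.
  + apply C1at_plus; apply C1; [do 2 apply smooth_Dx|do 2 apply smooth_Dy]; exact Hf.
  + apply C1at_inv; [apply Cmult_neq_0; [apply RtoC_neq_0; lra|easy]|].
    apply C1at_mult; [apply C1at_const|now apply C1].
  + apply C1at_mult; [easy|now apply C1at_conj].
  + apply C1at_inv; [now apply Cmult_neq_0|]; apply C1at_mult; now apply C1.
Qed.

(** The derivatives along the two axes are [A + B] and [Ci * (A - B)]; solving for [A] and [B] links
    the curvature, defined by partial derivatives, to the calculus of [wdiff]. *)
Lemma wdiff_partials f z A B : wdiff f z A B -> partial_z f z = A /\ partial_zbar f z = B.
Proof.
intros H.
assert (H' : wdiff f (Re z, Im z) A B) by (destruct z; exact H).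
assert (PX : partial_x f z = (A + B)%C).
{ assert (X := wdiff_rderiv f (fun t => (t, Im z)) (Re z) 1 A B (hline_rderiv _ _)).
  destruct (X H') as [X1 X2]; apply C_eq.
  - etransitivity; [exact (is_derive_unique _ _ _ X1)|unfold Re, Im; simpl; ring].
  - etransitivity; [exact (is_derive_unique _ _ _ X2)|unfold Re, Im; simpl; ring]. }
assert (PY : partial_y f z = (Ci * (A - B))%C).
{ assert (X := wdiff_rderiv f (fun t => (Re z, t)) (Im z) Ci A B (vline_rderiv _ _)).
  destruct (X H') as [X1 X2]; apply C_eq.
  - etransitivity; [exact (is_derive_unique _ _ _ X1)|unfold Re, Im; simpl; ring].
  - etransitivity; [exact (is_derive_unique _ _ _ X2)|unfold Re, Im; simpl; ring]. }
unfold partial_z, partial_zbar; rewrite PX, PY.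
assert (I2 : (Ci * (Ci * (A - B)) = - (A - B))%C).
{ transitivity ((Ci * Ci) * (A - B))%C; [ring|].
  rewrite Ci_sqr; ring. }
rewrite I2; split; field; intros E; apply RtoC_inj in E; lra.
Qed.

Lemma ln_partials (U : C -> Prop) f z : open U -> smooth_on U f -> (forall w, U w -> 0 < f w) -> U z ->
  partial_zbar (partial_z (fun w => RtoC (ln (f w)))) z = RtoC (ddlog f z).
Proof.
intros HU Hf Hpos Hz.
assert (P : forall w, U w -> partial_z (fun w => RtoC (ln (f w))) w = dlog f w).
{ intros w Hw.
  assert (W := wdiff_real_comp ln f w _ (/ f w) (smooth_wdiff U f w HU Hf Hw)
    ltac:(apply is_derive_Reals, derivable_pt_lim_ln, Hpos, Hw)).
  rewrite (proj1 (wdiff_partials _ _ _ _ W)); unfold dlog.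
  rewrite RtoC_inv by (specialize (Hpos w Hw); lra); ring. }
destruct (dlog_wdiff U f z HU Hf Hz (Hpos z Hz)) as [A HA].
eapply wdiff_partials, wdiff_ext_near; [|exact HA].
eapply near_imp; [|apply (open_near U z HU Hz)]; intros w Hw; symmetry; now apply P.
Qed.

(** * Local geometry of a Hermitian line bundle *)

Lemma dom_near {X} (L : line_bundle X) i z : dom L i z -> near z (dom L i).
Proof. apply open_near, dom_open. Qed.

Lemma frame_scal_inj {X} (L : line_bundle X) i z (c d : C) : dom L i z ->
  scal c (frame L i z) = scal d (frame L i z) -> c = d.
Proof.
intros Hz H; destruct (frame_basis L i z Hz (scal c (frame L i z))) as [b [_ Hb]].
transitivity b; [symmetry; now apply Hb|now apply Hb].
Qed.

Lemma scal_scal {X} (L : line_bundle X) z (c d : C) (v : fiber L z) :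
  scal c (scal d v) = scal (c * d)%C v.
Proof. apply (scal_assoc (K := C_Ring)). Qed.

Lemma scal_C1 {X} (L : line_bundle X) z (v : fiber L z) : scal (RtoC 1) v = v.
Proof. apply (scal_one (K := C_Ring)). Qed.

Lemma frame_neq_zero {X} (L : line_bundle X) i z : dom L i z -> frame L i z <> zero.
Proof.
intros Hz E; assert (A : (1 : C) = 0).
{ apply (frame_scal_inj L i z); [easy|].
  rewrite E, !(scal_zero_r (K := C_Ring)); reflexivity. }
apply RtoC_inj in A; lra.
Qed.

Lemma frame_change {X} (L : line_bundle X) i j : exists g : C -> C,
  hol (fun z => dom L i z /\ dom L j z) g /\
  forall z, dom L i z -> dom L j z -> g z <> 0 /\ frame L j z = scal (g z) (frame L i z).
Proof.
destruct (frame_transition L i j) as (g & Hg & Ht); exists g; split.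
- now apply holomorphic_on_hol.
- intros z Hi Hj; split; [|now apply Ht].
  intros E; apply (frame_neq_zero L j z Hj); rewrite (Ht z Hi Hj), E.
  apply (scal_zero_l (K := C_Ring)).
Qed.

Definition norm2 {X} {L : line_bundle X} (h : hermitian_metric L) (z : C) (v : fiber L z) : R :=
  Re (form h z v v).

Lemma norm2_scal {X} {L : line_bundle X} (h : hermitian_metric L) z c v : X z ->
  norm2 h z (scal c v) = Cmod c ^ 2 * norm2 h z v.
Proof.
intros Hz; unfold norm2.
assert (E : form h z (scal c v) (scal c v) = (RtoC (Cmod c ^ 2) * form h z v v)%C).
{ rewrite (form_scal L h z Hz), (form_conj L h z Hz (scal c v) v), (form_scal L h z Hz), Cmult_conj,
    <- (form_conj L h z Hz), Cmod2_conj; ring. }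
rewrite E; apply re_scal_l.
Qed.

Definition frame_norm2 {X} {L : line_bundle X} (h : hermitian_metric L) (i : chart L) (z : C) : R :=
  norm2 h z (frame L i z).

Lemma frame_norm2_pos {X} {L : line_bundle X} (h : hermitian_metric L) i z : dom L i z ->
  0 < frame_norm2 h i z.
Proof.
intros Hz; apply form_pos; [apply (dom_cover L); now exists i|now apply frame_neq_zero].
Qed.

Lemma frame_norm2_smooth {X} {L : line_bundle X} (h : hermitian_metric L) i :
  smooth_on (dom L i) (frame_norm2 h i).
Proof. apply (form_smooth L h). Qed.

(** [conn] is the coefficient of the Chern connection form in a frame, and [curv] its derivative in
    [bar z], the opposite of [chern_curvature]. *)
Definition conn {X} {L : line_bundle X} (h : hermitian_metric L) (i : chart L) : C -> C :=
  dlog (frame_norm2 h i).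
Definition curv {X} {L : line_bundle X} (h : hermitian_metric L) (i : chart L) : C -> R :=
  ddlog (frame_norm2 h i).

Lemma conn_wdiff {X} {L : line_bundle X} (h : hermitian_metric L) i z : dom L i z ->
  exists A, wdiff (conn h i) z A (RtoC (curv h i z)).
Proof.
intros Hz; apply (dlog_wdiff (dom L i));
  [apply dom_open|apply frame_norm2_smooth|easy|now apply frame_norm2_pos].
Qed.

Lemma chern_curvature_curv {X} {L : line_bundle X} (h : hermitian_metric L) i z : dom L i z ->
  chern_curvature h i z = (- RtoC (curv h i z))%C.
Proof.
intros Hz; unfold chern_curvature; f_equal.
apply (ln_partials (dom L i) (frame_norm2 h i));
  [apply dom_open|apply frame_norm2_smooth|intros; now apply frame_norm2_pos|easy].
Qed.

Lemma frame_norm2_wdiff {X} {L : line_bundle X} (h : hermitian_metric L) i z : dom L i z ->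
  wdiff (fun w => RtoC (frame_norm2 h i w)) z (RtoC (frame_norm2 h i z) * conn h i z)
    (Cconj (RtoC (frame_norm2 h i z) * conn h i z)).
Proof.
intros Hz; assert (P := frame_norm2_pos h i z Hz).
replace (RtoC (frame_norm2 h i z) * conn h i z)%C with (grad (frame_norm2 h i) z).
- apply (smooth_wdiff (dom L i)); [apply dom_open|apply frame_norm2_smooth|easy].
- unfold conn, dlog; field; apply RtoC_neq_0; lra.
Qed.

Lemma norm2_section_wdiff {X} {L : line_bundle X} (h : hermitian_metric L) i (c : C -> C) (c' : C) z :
  dom L i z -> wdiff c z c' 0 ->
  wdiff (fun w => RtoC (Cmod (c w) ^ 2 * frame_norm2 h i w)) z
    ((c' * Cconj (c z) + c z * Cconj (c z) * conn h i z) * RtoC (frame_norm2 h i z))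
    (Cconj ((c' * Cconj (c z) + c z * Cconj (c z) * conn h i z) * RtoC (frame_norm2 h i z))).
Proof.
intros Hz Hc.
assert (W := wdiff_mult _ _ _ _ _ _ _ (wdiff_mult _ _ _ _ _ _ _ Hc (wdiff_conj _ _ _ _ Hc))
  (frame_norm2_wdiff h i z Hz)); cbv beta in W.
apply (wdiff_ext _ (fun w => RtoC (Cmod (c w) ^ 2 * frame_norm2 h i w))) in W.
2: { intros w; now rewrite RtoC_mult, Cmod2_conj. }
assert (E := wdiff_real _ _ _ _ W); rewrite E in W; eapply wdiff_eq; [exact W| |f_equal];
 rewrite Cconj_RtoC; ring.
Qed.

(** The frame norms satisfy [|e_j|^2 = |g|^2 |e_i|^2], and the logarithmic derivative of [|g|^2] in
    [z] is that of [g]. *)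
Lemma conn_change {X} {L : line_bundle X} (h : hermitian_metric L) i j (g : C -> C) z :
  hol (fun z => dom L i z /\ dom L j z) g ->
  (forall z, dom L i z -> dom L j z -> g z <> 0 /\ frame L j z = scal (g z) (frame L i z)) ->
  dom L i z -> dom L j z -> conn h j z = (conn h i z + Cder g z * / g z)%C.
Proof.
intros Hg Ht Hi Hj.
assert (Dg := Cder_spec _ _ z Hg (conj Hi Hj)).
assert (W := norm2_section_wdiff h i g _ z Hi Dg).
apply (wdiff_ext_near _ (fun w => RtoC (frame_norm2 h j w))) in W.
2: { eapply near_imp; [|apply (near_and _ _ _ (dom_near L i z Hi) (dom_near L j z Hj))].
  intros w [Wi Wj]; f_equal; unfold frame_norm2; rewrite (proj2 (Ht w Wi Wj)), norm2_scal; [easy|].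
  apply (dom_cover L); now exists i. }
destruct (wdiff_unique _ _ _ _ _ _ W (frame_norm2_wdiff h j z Hj)) as [E _].
assert (Pj := frame_norm2_pos h j z Hj); assert (Pi := frame_norm2_pos h i z Hi).
destruct (Ht z Hi Hj) as [G0 Gt].
assert (EN : RtoC (frame_norm2 h j z) = (g z * Cconj (g z) * RtoC (frame_norm2 h i z))%C).
{ unfold frame_norm2 at 1; rewrite Gt, norm2_scal, RtoC_mult, Cmod2_conj; [easy|].
  apply (dom_cover L); now exists i. }
assert (NJ : RtoC (frame_norm2 h j z) <> 0) by (apply RtoC_neq_0; lra).
transitivity (/ RtoC (frame_norm2 h j z) * (RtoC (frame_norm2 h j z) * conn h j z))%C; [field; easy|].
rewrite <- E, EN; field; repeat split; try easy.
- apply RtoC_neq_0; lra.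
- apply Cmod_gt_0; rewrite Cmod_conj; now apply Cmod_gt_0.
Qed.

Lemma near_dom2 {X} (L : line_bundle X) i j z : dom L i z /\ dom L j z ->
  near z (fun w => dom L i w /\ dom L j w).
Proof. intros [Hi Hj]; apply near_and; now apply dom_near. Qed.

(** The connection coefficients differ by [g' / g], which is holomorphic and so has no derivative in
    [bar z]. That [g'] is again holomorphic is [hol_Cder]. *)
Lemma curv_change {X} {L : line_bundle X} (h : hermitian_metric L) i j z :
  dom L i z -> dom L j z -> curv h j z = curv h i z.
Proof.
intros Hi Hj; destruct (frame_change L i j) as (g & Hg & Ht).
destruct (conn_wdiff h i z Hi) as [Ai HAi]; destruct (conn_wdiff h j z Hj) as [Aj HAj].
assert (Hg' := hol_Cder _ g (near_dom2 L i j) Hg).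
destruct (Hg' z (conj Hi Hj)) as [l Hl].
assert (W := wdiff_plus _ _ _ _ _ _ _ HAi (wdiff_mult _ _ _ _ _ _ _ Hl
  (wdiff_inv g z _ _ (proj1 (Ht z Hi Hj)) (Cder_spec _ _ z Hg (conj Hi Hj))))); cbv beta in W.
apply (wdiff_ext_near _ (conn h j)) in W.
2: { eapply near_imp; [|apply (near_dom2 L i j z (conj Hi Hj))]; intros w [Wi Wj].
  symmetry; now apply conn_change. }
destruct (wdiff_unique _ _ _ _ _ _ W HAj) as [_ E]; apply RtoC_inj; rewrite <- E; ring.
Qed.

(** The [dbar] equation is solved on the disc as a whole, so the local curvatures must form a single
    function. Any chart may be selected, by [curv_change]. *)
Definition global_curv {X} {L : line_bundle X} (h : hermitian_metric L) (z : C) : C :=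
  RtoC (epsilon (inhabits 0) (fun x => exists i, dom L i z /\ x = curv h i z)).

Lemma global_curv_eq {X} {L : line_bundle X} (h : hermitian_metric L) i z : dom L i z ->
  global_curv h z = RtoC (curv h i z).
Proof.
intros Hz; unfold global_curv; f_equal.
destruct (epsilon_spec (inhabits 0) (fun x => exists i, dom L i z /\ x = curv h i z)) as (j & Hj & ->).
- now exists (curv h i z), i.
- now apply curv_change.
Qed.

Lemma global_curv_bounded (L : line_bundle punctured_disc) (h : hermitian_metric L) K :
  0 < K -> curvature_bounded h K -> poincare_bounded (global_curv h) K.
Proof.
intros HK HC; split; [easy|]; intros z Hz.
destruct (proj1 (dom_cover L z) Hz) as [i Hi]; split.
- apply (C1at_ext_near (fun w => RtoC (curv h i w))).
  + eapply near_imp; [|apply (dom_near L i z Hi)]; intros w Hw; symmetry; now apply global_curv_eq.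
  + apply (ddlog_C1at (dom L i));
      [apply dom_open|apply frame_norm2_smooth|easy|now apply frame_norm2_pos].
- rewrite (global_curv_eq h i z Hi), Cmod_R.
  specialize (HC i z Hi); rewrite chern_curvature_curv in HC by easy.
  rewrite re_opp, re_RtoC in HC; apply Rabs_le; lra.
Qed.

(** * Sections with prescribed logarithmic derivative of the norm *)

(* On [S], the section [f] is holomorphic and nowhere zero, and satisfies
   [d log |f|^2 = q dz + conj (q dz)]. *)
Definition flat_at {X} {L : line_bundle X} (h : hermitian_metric L) (q : C -> C)
  (S : C -> Prop) (f : section L) (z : C) : Prop :=
  exists (i : chart L) (c : C -> C), near z (fun w => dom L i w /\ c w <> 0 /\
    wdiff c w ((q w - conn h i w) * c w) 0 /\ (S w -> f w = scal (c w) (frame L i w))).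

Definition flat_on {X} {L : line_bundle X} (h : hermitian_metric L) (q : C -> C)
  (S : C -> Prop) (f : section L) : Prop := forall z, S z -> flat_at h q S f z.

Section Flat.
Context {X : C -> Prop} {L : line_bundle X} (h : hermitian_metric L) (q : C -> C).

Lemma flat_on_mono (S T : C -> Prop) f : (forall z, S z -> T z) -> flat_on h q T f -> flat_on h q S f.
Proof.
intros HST Hf z Hz; destruct (Hf z (HST z Hz)) as (i & c & H); exists i, c.
eapply near_imp; [|exact H]; intros w (H1 & H2 & H3 & H4); repeat split; auto.
Qed.

Lemma flat_on_ext (S : C -> Prop) f g : (forall z, S z -> f z = g z) -> flat_on h q S f -> flat_on h q S g.
Proof.
intros HS Hf z Hz; destruct (Hf z Hz) as (i & c & H); exists i, c.
eapply near_imp; [|exact H]; intros w (H1 & H2 & H3 & H4); repeat split; auto.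
intros Hw; rewrite <- HS; auto.
Qed.

Lemma flat_on_open (S : C -> Prop) f : (forall z, S z -> exists T, near z T /\ flat_on h q T f) ->
  flat_on h q S f.
Proof.
intros H z Hz; destruct (H z Hz) as (T & HT & Hf); destruct (Hf z (near_self _ _ HT)) as (i & c & Hn).
exists i, c; eapply near_imp; [|apply (near_and _ _ _ HT Hn)].
intros w (W & H1 & H2 & H3 & H4); repeat split; auto.
Qed.

Lemma flat_on_scal (k : C) (S : C -> Prop) f : k <> 0 -> flat_on h q S f ->
  flat_on h q S (section_scal (fun _ => k) f).
Proof.
intros Hk Hf z Hz; destruct (Hf z Hz) as (i & c & H); exists i, (fun w => k * c w)%C.
eapply near_imp; [|exact H]; intros w (H1 & H2 & H3 & H4); repeat split; auto.
- now apply Cmult_neq_0.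
- eapply wdiff_eq; [apply wdiff_cmult, H3|ring|ring].
- intros Hw; unfold section_scal; rewrite H4 by easy; apply scal_scal.
Qed.

Lemma flat_frame_nonzero (S : C -> Prop) f z : flat_on h q S f -> S z ->
  forall k k' : C, scal k (f z) = scal k' (f z) -> k = k'.
Proof.
intros Hf Hz k k' E; destruct (Hf z Hz) as (i & c & H).
destruct (near_self _ _ H) as (H1 & H2 & H3 & H4).
rewrite H4, !scal_scal in E by easy; apply frame_scal_inj in E; [|easy].
transitivity (k * c z * / c z)%C; [field; easy|rewrite E; field; easy].
Qed.

Lemma wdiff_zero_locally_const (r : C -> C) z :
  near z (fun w => wdiff r w 0 0) -> near z (fun w => r w = r z).
Proof.
intros (d & Hd & H); exists d; split; [easy|]; intros w Hw.
transitivity (r (z + RtoC 1 * (w - z))%C); [f_equal; ring|].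
transitivity (r (z + RtoC 0 * (w - z))%C); [|f_equal; ring].
symmetry; apply (rderiv_zero (fun t => r (z + RtoC t * (w - z))%C) 0 1).
intros t; rewrite Rmin_left, Rmax_right by lra; intros Ht.
eapply rderiv_eq; [apply (wdiff_rderiv r (fun t => z + RtoC t * (w - z))%C);
  [apply segment_rderiv|apply H]|ring].
replace (z + RtoC t * (w - z) - z)%C with (RtoC t * (w - z))%C by ring.
rewrite Cmod_mult, Cmod_R_nonneg by lra; assert (T := Cmod_ge_0 (w - z)); nra.
Qed.

(** Expressed in the same frame, both coefficients solve one linear first-order equation, so their
    ratio has derivative 0. Stating this for coefficients makes the comparison valid on a full
    neighbourhood, even when the sections are prescribed on a closed set only. *)
Lemma flat_local_ratio i j (c d : C -> C) z :
  near z (fun w => dom L i w /\ c w <> 0 /\ wdiff c w ((q w - conn h i w) * c w) 0) ->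
  near z (fun w => dom L j w /\ d w <> 0 /\ wdiff d w ((q w - conn h j w) * d w) 0) ->
  exists k : C, k <> 0 /\
    near z (fun w => scal (c w) (frame L i w) = scal k (scal (d w) (frame L j w))).
Proof.
intros Hc Hd; destruct (frame_change L i j) as (g & Hg & Ht).
assert (Hn := near_and _ _ _ Hc Hd).
set (r := fun w => (c w * / (d w * g w))%C).
assert (Hr : near z (fun w => r w = r z)).
{ apply wdiff_zero_locally_const; eapply near_imp; [|exact Hn].
  intros w ((Wi & C0 & Dc) & (Wj & D0 & Dd)).
  destruct (Ht w Wi Wj) as [G0 _].
  assert (Dg := Cder_spec _ _ w Hg (conj Wi Wj)).
  assert (EC := conn_change h i j g w Hg Ht Wi Wj).
  eapply wdiff_eq.
  - apply wdiff_mult; [exact Dc|apply wdiff_inv; [now apply Cmult_neq_0|apply wdiff_mult; [exact Dd|exact Dg]]].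
  - cbv beta; rewrite EC; field; now split.
  - cbv beta; field; now split. }
exists (r z); split.
- destruct (near_self _ _ Hn) as ((Wi & C0 & Dc) & (Wj & D0 & Dd)).
  destruct (Ht z Wi Wj) as [G0 _]; unfold r; apply Cmult_neq_0; [easy|].
  apply Cmod_gt_0; rewrite Cmod_inv by now apply Cmult_neq_0.
  apply Rinv_0_lt_compat, Cmod_gt_0; now apply Cmult_neq_0.
- eapply near_imp; [|apply (near_and _ _ _ Hr Hn)]; intros w (R & (Wi & C0 & Dc) & (Wj & D0 & Dd)).
  destruct (Ht w Wi Wj) as [G0 Gt]; rewrite Gt, !scal_scal; f_equal; rewrite <- R; unfold r.
  field; now split.
Qed.

Lemma flat_ratio_near (S : C -> Prop) f1 f2 z : flat_on h q S f1 -> flat_on h q S f2 -> S z ->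
  exists k : C, k <> 0 /\ near z (fun w => S w -> f1 w = scal k (f2 w)).
Proof.
intros H1 H2 Hz; destruct (H1 z Hz) as (i & c & Hc); destruct (H2 z Hz) as (j & d & Hd).
destruct (flat_local_ratio i j c d z) as (k & Hk & Hn).
- eapply near_imp; [|exact Hc]; intros w (A & B & D & _); auto.
- eapply near_imp; [|exact Hd]; intros w (A & B & D & _); auto.
- exists k; split; [easy|].
  eapply near_imp; [|apply (near_and _ _ _ Hn (near_and _ _ _ Hc Hd))].
  intros w (N & (_ & _ & _ & E1) & (_ & _ & _ & E2)) Hw; rewrite E1, E2; auto.
Qed.

(** The ratio is locally constant, and bisection takes the place of connectedness. Adjacent pieces
    share a point, where the sections do not vanish, so their constants agree ([J]). *)
Lemma flat_ratio_rect f1 f2 a b c d : a <= b -> c <= d ->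
  flat_on h q (rect a b c d) f1 -> flat_on h q (rect a b c d) f2 ->
  exists k : C, k <> 0 /\ forall z, rect a b c d z -> f1 z = scal k (f2 z).
Proof.
intros Hab Hcd H1 H2.
assert (J : forall (S T : C -> Prop) p, (forall z, S z -> rect a b c d z) -> S p -> T p ->
  (exists k : C, k <> 0 /\ forall z, S z -> f1 z = scal k (f2 z)) ->
  (exists k : C, k <> 0 /\ forall z, T z -> f1 z = scal k (f2 z)) ->
  exists k : C, k <> 0 /\ forall z, S z \/ T z -> f1 z = scal k (f2 z)).
{ intros S T p HS Sp Tp (k & Hk & K) (k' & Hk' & K').
  assert (k = k') as <-.
  { apply (flat_frame_nonzero _ f2 p H2); auto; rewrite <- K, <- K'; auto. }
  exists k; split; [easy|]; intros z [Hz|Hz]; auto. }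
apply (rectangle_induction (fun x z u v => exists k : C, k <> 0 /\
  forall p, rect x z u v p -> f1 p = scal k (f2 p))); auto.
- intros x y z u v ? ? ? ? ? ? ? P1 P2.
  destruct (J (rect x y u v) (rect y z u v) (y, u) ltac:(intros p [? ?]; split; lra) ltac:(split; simpl; lra)
    ltac:(split; simpl; lra) P1 P2) as (k & Hk & K).
  exists k; split; [easy|]; intros p [A1 A2]; apply K.
  destruct (Rle_dec (Re p) y); [left|right]; split; lra.
- intros x z u t v ? ? ? ? ? ? ? P1 P2.
  destruct (J (rect x z u t) (rect x z t v) (x, t) ltac:(intros p [? ?]; split; lra) ltac:(split; simpl; lra)
    ltac:(split; simpl; lra) P1 P2) as (k & Hk & K).
  exists k; split; [easy|]; intros p [A1 A2]; apply K.
  destruct (Rle_dec (Im p) t); [left|right]; split; lra.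
- intros p p' Hp Hp'.
  destruct (flat_ratio_near _ f1 f2 (p, p') H1 H2) as (k & Hk & Hn); [now split|].
  destruct (near_square _ _ Hn) as (r & Hr & Hs).
  exists r; split; [easy|]; intros n x z u v ? ? ? ? ? ? _ _ ? ?.
  exists k; split; [easy|]; intros w [A1 A2]; apply Hs; [|split; lra].
  split; simpl; apply Rabs_def1; lra.
Qed.

(** Both sets are closed, so that near a point of only one of them the other one is absent. At a
    common point, the local model for the first set also fits the rescaled second section: the
    constant between the two models is 1, as is seen at the point. *)
Lemma flat_glue (S1 S2 : C -> Prop) f1 f2 :
  (forall z, ~ S1 z -> near z (fun w => ~ S1 w)) -> (forall z, ~ S2 z -> near z (fun w => ~ S2 w)) ->
  flat_on h q S1 f1 -> flat_on h q S2 f2 ->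
  (exists k : C, k <> 0 /\ forall z, S1 z -> S2 z -> f1 z = scal k (f2 z)) ->
  exists f, flat_on h q (fun z => S1 z \/ S2 z) f.
Proof.
intros C1 C2 H1 H2 (k & Hk & K).
assert (H2' := flat_on_scal k S2 f2 Hk H2); set (f2' := section_scal (fun _ => k) f2) in *.
set (f := fun z => if excluded_middle_informative (S1 z) then f1 z else f2' z).
assert (E1 : forall z, S1 z -> f z = f1 z).
{ intros z Hz; unfold f; destruct (excluded_middle_informative (S1 z)); easy. }
assert (E2 : forall z, S2 z -> f z = f2' z).
{ intros z Hz; unfold f; destruct (excluded_middle_informative (S1 z)); [now apply K|easy]. }
exists f; intros z Hz.
destruct (classic (S1 z)) as [Z1|Z1]; [destruct (classic (S2 z)) as [Z2|Z2]|].
- destruct (H1 z Z1) as (i & c & Hc); destruct (H2' z Z2) as (j & d & Hd).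
  destruct (flat_local_ratio i j c d z) as (m & Hm & Hn).
  + eapply near_imp; [|exact Hc]; intros w (A & B & D & _); auto.
  + eapply near_imp; [|exact Hd]; intros w (A & B & D & _); auto.
  + assert (m = 1) as ->.
    { apply (flat_frame_nonzero S2 f2' z H2' Z2).
      destruct (near_self _ _ Hc) as (_ & _ & _ & Ec); destruct (near_self _ _ Hd) as (_ & _ & _ & Ed).
      rewrite scal_C1, Ed, <- (near_self _ _ Hn), <- Ec, <- Ed, <- E1, <- E2 by easy; easy. }
    exists i, c; eapply near_imp; [|apply (near_and _ _ _ Hn (near_and _ _ _ Hc Hd))].
    intros w (N & (A1 & A2 & A3 & A4) & (_ & _ & _ & B4)); repeat split; auto.
    rewrite scal_C1 in N; intros [W|W]; [rewrite E1; auto|rewrite E2, B4; auto].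
- destruct (H1 z Z1) as (i & c & Hc); exists i, c.
  eapply near_imp; [|apply (near_and _ _ _ (C2 z Z2) Hc)].
  intros w (N & A1 & A2 & A3 & A4); repeat split; auto.
  intros [W|W]; [rewrite E1; auto|easy].
- destruct Hz as [Z2|Z2]; [easy|]; destruct (H2' z Z2) as (j & d & Hd); exists j, d.
  eapply near_imp; [|apply (near_and _ _ _ (C1 z Z1) Hd)].
  intros w (N & A1 & A2 & A3 & A4); repeat split; auto.
  intros [W|W]; [easy|rewrite E2; auto].
Qed.

Lemma rect_closed a b c d z : ~ rect a b c d z -> near z (fun w => ~ rect a b c d w).
Proof.
intros H.
assert (Hlt : Re z < a \/ b < Re z \/ Im z < c \/ d < Im z).
{ apply NNPP; intros HN; apply H; split; split; apply Rnot_lt_le; intros HH; apply HN; auto. }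
assert (G : forall r : R, 0 < r -> (forall w, Rabs (Re w - Re z) < r -> Rabs (Im w - Im z) < r ->
   ~ rect a b c d w) -> near z (fun w => ~ rect a b c d w)).
{ intros r Hr HH; exists r; split; [easy|]; intros w Hw; apply HH;
    (eapply Rle_lt_trans; [|exact Hw]).
  - apply re_minus_le.
  - apply im_minus_le. }
destruct Hlt as [E|[E|[E|E]]].
- apply (G (a - Re z)); [lra|]; intros w A B [? ?]; apply Rabs_def2 in A; lra.
- apply (G (Re z - b)); [lra|]; intros w A B [? ?]; apply Rabs_def2 in A; lra.
- apply (G (c - Im z)); [lra|]; intros w A B [? ?]; apply Rabs_def2 in B; lra.
- apply (G (Im z - d)); [lra|]; intros w A B [? ?]; apply Rabs_def2 in B; lra.
Qed.

(** A multiple [c] of the frame has the required property exactly when [c' / c = q - conn]; so [c]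
    is the exponential of a primitive. *)
Lemma flat_local_existence z i rho : 0 < rho ->
  (forall w, square z rho w -> dom L i w) ->
  hol (square z rho) (fun w => q w - conn h i w)%C ->
  exists f, flat_on h q (square z rho) f.
Proof.
intros Hrho Hd Hh.
destruct (square_primitive (fun w => q w - conn h i w)%C z rho) as [F HF].
- intros p Hp; eapply hol_ccont; eauto.
- intros p Hp; apply goursat_box; intros w Hw; apply Hh.
  eapply box_square; [now apply square_center|exact Hp|exact Hw].
- exists (fun w => scal (Cexp (F w)) (frame L i w)); intros p Hp; exists i, (fun w => Cexp (F w)).
  eapply near_imp; [|apply (square_near _ _ _ Hp)]; intros w Hw; repeat split; auto.
  + apply Cexp_neq_0.
  + eapply wdiff_eq; [apply (wdiff_comp F Cexp); [apply HF, Hw|apply Cexp_wdiff]|ring|ring].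
Qed.

Lemma flat_rect_existence a b c d : a <= b -> c <= d ->
  (forall z, rect a b c d z -> exists i rho, 0 < rho /\ (forall w, square z rho w -> dom L i w) /\
    hol (square z rho) (fun w => q w - conn h i w)%C) ->
  exists f, flat_on h q (rect a b c d) f.
Proof.
intros Hab Hcd Hloc.
apply (rectangle_induction (fun x z u v => exists f, flat_on h q (rect x z u v) f)); auto.
- intros x y z u v ? ? ? ? ? ? ? (f1 & F1) (f2 & F2).
  (* The common edge is a degenerate rectangle, on which the ratio is constant. *)
  destruct (flat_ratio_rect f1 f2 y y u v) as (k & Hk & K); try lra.
  + eapply flat_on_mono; [|exact F1]; intros p [? ?]; split; lra.
  + eapply flat_on_mono; [|exact F2]; intros p [? ?]; split; lra.
  + destruct (flat_glue (rect x y u v) (rect y z u v) f1 f2) as [f Hf]; auto using rect_closed.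
    * exists k; split; [easy|]; intros p [? ?] [? ?]; apply K; split; lra.
    * exists f; eapply flat_on_mono; [|exact Hf]; intros p [? ?].
      destruct (Rle_dec (Re p) y); [left|right]; split; lra.
- intros x z u t v ? ? ? ? ? ? ? (f1 & F1) (f2 & F2).
  destruct (flat_ratio_rect f1 f2 x z t t) as (k & Hk & K); try lra.
  + eapply flat_on_mono; [|exact F1]; intros p [? ?]; split; lra.
  + eapply flat_on_mono; [|exact F2]; intros p [? ?]; split; lra.
  + destruct (flat_glue (rect x z u t) (rect x z t v) f1 f2) as [f Hf]; auto using rect_closed.
    * exists k; split; [easy|]; intros p [? ?] [? ?]; apply K; split; lra.
    * exists f; eapply flat_on_mono; [|exact Hf]; intros p [? ?].
      destruct (Rle_dec (Im p) t); [left|right]; split; lra.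
- intros p p' Hp Hp'.
  destruct (Hloc (p, p')) as (i & rho & Hrho & Hd & Hh); [now split|].
  destruct (flat_local_existence (p, p') i rho Hrho Hd Hh) as [f Hf].
  exists rho; split; [easy|]; intros n x z u v ? ? ? ? ? ? _ _ ? ?.
  exists f; eapply flat_on_mono; [|exact Hf]; intros w [? ?].
  split; simpl; apply Rabs_def1; lra.
Qed.

End Flat.

Definition orect (a b c d : R) (z : C) : Prop := a < Re z < b /\ c < Im z < d.

Lemma orect_near a b c d z : orect a b c d z -> near z (orect a b c d).
Proof.
intros [[H1 H2] [H3 H4]].
set (r := Rmin (Rmin (Re z - a) (b - Re z)) (Rmin (Im z - c) (d - Im z))).
assert (R1 : r <= Re z - a) by (eapply Rle_trans; [apply Rmin_l|apply Rmin_l]).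
assert (R2 : r <= b - Re z) by (eapply Rle_trans; [apply Rmin_l|apply Rmin_r]).
assert (R3 : r <= Im z - c) by (eapply Rle_trans; [apply Rmin_r|apply Rmin_l]).
assert (R4 : r <= d - Im z) by (eapply Rle_trans; [apply Rmin_r|apply Rmin_r]).
exists r; split; [repeat apply Rmin_glb_lt; lra|]; intros w Hw.
assert (A := re_le_Cmod (w - z)); assert (B := im_le_Cmod (w - z)).
rewrite re_minus in A.
rewrite im_minus in B.
apply Rabs_le_between in A; apply Rabs_le_between in B; split; lra.
Qed.

Section FlatOpen.
Context {X : C -> Prop} {L : line_bundle X} (h : hermitian_metric L) (q : C -> C).

(** The open rectangle is exhausted by closed ones. Their sections are unique up to a constant, so
    normalising all of them at the centre makes each extend the preceding one. *)
Lemma flat_orect_existence a b c d : a < b -> c < d ->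
  (forall z, orect a b c d z -> exists i rho, 0 < rho /\ (forall w, square z rho w -> dom L i w) /\
    hol (square z rho) (fun w => q w - conn h i w)%C) ->
  exists f, flat_on h q (orect a b c d) f.
Proof.
intros Hab Hcd Hloc.
(* The shift by 2 keeps [e n <= 1/2], so that no rectangle is empty; the first one is reduced to the
   centre. *)
set (e := fun n : nat => / (INR n + 2)).
assert (E : forall n, 0 < e n <= / 2).
{ intros n; assert (T := pos_INR n); split; [apply Rinv_0_lt_compat; lra|].
  apply Rinv_le_contravar; lra. }
assert (Em : forall m n, (m <= n)%nat -> e n <= e m).
{ intros m n H; apply le_INR in H; assert (T := pos_INR m); apply Rinv_le_contravar; lra. }
set (Rn := fun n => rect (a + e n * (b - a)) (b - e n * (b - a)) (c + e n * (d - c)) (d - e n * (d - c))).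
assert (Hle : forall n, a + e n * (b - a) <= b - e n * (b - a) /\ c + e n * (d - c) <= d - e n * (d - c)).
{ intros n; specialize (E n); split; nra. }
assert (Hm : forall m n, (m <= n)%nat -> forall z, Rn m z -> Rn n z).
{ intros m n H z [Z1 Z2]; specialize (Em m n H); split; nra. }
assert (Hin : forall n z, Rn n z -> orect a b c d z).
{ intros n z [Z1 Z2]; specialize (E n); split; nra. }
assert (Hex : forall n, exists f, flat_on h q (Rn n) f).
{ intros n; apply flat_rect_existence; [apply Hle|apply Hle|]; intros z Hz; eapply Hloc, Hin, Hz. }
set (p := ((a + b) / 2, (c + d) / 2)).
assert (Hp : forall n, Rn n p) by (intros n; specialize (E n); split; simpl; nra).
destruct (Hex O) as [f0 Hf0].
set (G := fun n f => flat_on h q (Rn n) f /\ f p = f0 p).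
set (F := fun n => epsilon (inhabits f0) (G n)).
assert (HF : forall n, G n (F n)).
{ intros n; apply epsilon_spec; destruct (Hex n) as [f Hf].
  destruct (flat_ratio_rect h q f0 f _ _ _ _ (proj1 (Hle O)) (proj2 (Hle O)) Hf0) as (k & Hk & K).
  { eapply flat_on_mono; [|exact Hf]; intros z Hz; apply (Hm O n); [lia|exact Hz]. }
  exists (section_scal (fun _ => k) f); split; [now apply flat_on_scal|].
  symmetry; apply K, Hp. }
assert (Ag : forall m n, (m <= n)%nat -> forall z, Rn m z -> F m z = F n z).
{ intros m n H; destruct (HF m) as [A1 A2]; destruct (HF n) as [B1 B2].
  destruct (flat_ratio_rect h q (F m) (F n) _ _ _ _ (proj1 (Hle m)) (proj2 (Hle m)) A1) as (k & Hk & K).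
  { eapply flat_on_mono; [|exact B1]; now apply Hm. }
  assert (k = 1) as ->.
  { apply (flat_frame_nonzero h q (Rn n) (F n) p); auto.
    rewrite scal_C1, <- K, A2, B2 by apply (Hp m); easy. }
  intros z Hz; rewrite (K z Hz); apply scal_C1. }
set (nu := fun z => epsilon (inhabits O) (fun n => Rn n z)).
assert (Af : forall n z, Rn n z -> F (nu z) z = F n z).
{ intros n z Hz.
  assert (Hn : Rn (nu z) z) by (apply (epsilon_spec (inhabits O) (fun n => Rn n z)); now exists n).
  destruct (Nat.le_ge_cases (nu z) n) as [H|H]; [now apply Ag|symmetry; now apply Ag]. }
exists (fun z => F (nu z) z); apply flat_on_open; intros z Hz.
destruct Hz as [[Z1 Z2] [Z3 Z4]].
set (t := Rmin (Rmin ((Re z - a) / (b - a)) ((b - Re z) / (b - a)))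
  (Rmin ((Im z - c) / (d - c)) ((d - Im z) / (d - c)))).
assert (Ht : 0 < t) by (repeat apply Rmin_glb_lt; apply Rdiv_lt_0_compat; lra).
destruct (INR_unbounded (/ t)) as [n Hn].
assert (En : e n < t).
{ unfold e; rewrite <- (Rinv_inv t); apply Rinv_lt_contravar; [|lra].
  apply Rmult_lt_0_compat; [now apply Rinv_0_lt_compat|assert (T := pos_INR n); lra]. }
assert (T1 : t * (b - a) <= Re z - a) by (apply Rle_div_r; [lra|]; eapply Rle_trans; [apply Rmin_l|apply Rmin_l]).
assert (T2 : t * (b - a) <= b - Re z) by (apply Rle_div_r; [lra|]; eapply Rle_trans; [apply Rmin_l|apply Rmin_r]).
assert (T3 : t * (d - c) <= Im z - c) by (apply Rle_div_r; [lra|]; eapply Rle_trans; [apply Rmin_r|apply Rmin_l]).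
assert (T4 : t * (d - c) <= d - Im z) by (apply Rle_div_r; [lra|]; eapply Rle_trans; [apply Rmin_r|apply Rmin_r]).
exists (Rn n); split.
- eapply near_imp; [|apply (orect_near (a + e n * (b - a)) (b - e n * (b - a)) (c + e n * (d - c)) (d - e n * (d - c)))].
  + intros w [? ?]; split; lra.
  + split; nra.
- apply (flat_on_ext h q (Rn n) (F n)); [|apply HF].
  intros w Hw; symmetry; now apply Af.
Qed.

(** The closed rectangle spanned by the centre and [z] lies inside, and its constant is the one seen
    at the centre. *)
Lemma flat_ratio_orect f1 f2 a b c d : a < b -> c < d ->
  flat_on h q (orect a b c d) f1 -> flat_on h q (orect a b c d) f2 ->
  exists k : C, k <> 0 /\ forall z, orect a b c d z -> f1 z = scal k (f2 z).
Proof.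
intros Hab Hcd H1 H2.
set (p := ((a + b) / 2, (c + d) / 2)).
assert (Hp : orect a b c d p) by (split; simpl; lra).
assert (B : forall z, orect a b c d z -> exists k : C, k <> 0 /\ f1 p = scal k (f2 p) /\ f1 z = scal k (f2 z)).
{ intros z [Z1 Z2].
  destruct (flat_ratio_rect h q f1 f2 (Rmin (Re p) (Re z)) (Rmax (Re p) (Re z))
    (Rmin (Im p) (Im z)) (Rmax (Im p) (Im z))) as (k & Hk & K).
  - apply Rminmax.
  - apply Rminmax.
  - eapply flat_on_mono; [|exact H1]; intros w [W1 W2]; destruct Hp as [P1 P2].
    unfold Rmin, Rmax in W1, W2; destruct (Rle_dec (Re p) (Re z)); destruct (Rle_dec (Im p) (Im z)); split; lra.
  - eapply flat_on_mono; [|exact H2]; intros w [W1 W2]; destruct Hp as [P1 P2].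
    unfold Rmin, Rmax in W1, W2; destruct (Rle_dec (Re p) (Re z)); destruct (Rle_dec (Im p) (Im z)); split; lra.
  - exists k; split; [easy|]; split; apply K; split; split; auto using Rmin_l, Rmin_r, Rmax_l, Rmax_r. }
destruct (B p Hp) as (k & Hk & Kp & _); exists k; split; [easy|]; intros z Hz.
destruct (B z Hz) as (k' & Hk' & Kp' & Kz); rewrite Kz; f_equal.
apply (flat_frame_nonzero h q _ f2 p H2 Hp); congruence.
Qed.

Lemma flat_on_q_ext (q' : C -> C) S f : (forall w, q w = q' w) -> flat_on h q S f -> flat_on h q' S f.
Proof.
intros E Hf z Hz; destruct (Hf z Hz) as (i & c & H); exists i, c.
eapply near_imp; [|exact H]; intros w (H1 & H2 & H3 & H4); repeat split; auto.
rewrite <- E; exact H3.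
Qed.

(** A factor with logarithmic derivative [t] adds [t] to [q]. It is applied to branches of [z^mu],
    for which [t = mu / z]. *)
Lemma flat_twist (t m : C -> C) (S : C -> Prop) f :
  (forall z, S z -> near z (fun w => m w <> 0 /\ wdiff m w (t w * m w) 0)) ->
  flat_on h q S f -> flat_on h (fun w => q w + t w)%C S (section_scal m f).
Proof.
intros Hm Hf z Hz; destruct (Hf z Hz) as (i & c & H); exists i, (fun w => m w * c w)%C.
eapply near_imp; [|apply (near_and _ _ _ (Hm z Hz) H)].
intros w ((M1 & M2) & H1 & H2 & H3 & H4); repeat split; auto.
- now apply Cmult_neq_0.
- eapply wdiff_eq; [apply wdiff_mult; [exact M2|exact H3]|ring|ring].
- intros Hw; unfold section_scal; rewrite H4 by easy; apply scal_scal.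
Qed.

End FlatOpen.

(** A branch of [w^mu], up to a constant, on the half-plane [Re (a * w) > 0]; the constant [b]
    records which branch of the logarithm is meant. *)
Lemma power_branch (mu a b z : C) : 0 < Re (a * z) ->
  near z (fun w => Cexp (mu * (Clog (a * w) + b)) <> 0 /\
    wdiff (fun w => Cexp (mu * (Clog (a * w) + b)))%C w (mu * / w * Cexp (mu * (Clog (a * w) + b))) 0).
Proof.
intros Hz.
assert (Ha : a <> 0).
{ intros ->; rewrite Cmult_0_l in Hz; simpl in Hz; lra. }
assert (Cc : ccont (fun w => RtoC (Re (a * w))) z).
{ apply (ccont_comp (fun w => a * w)%C (fun w => RtoC (Re w))).
  - apply ccont_mult; [apply ccont_const|]; eapply wdiff_ccont, wdiff_id.
  - eapply wdiff_ccont, wdiff_Re. }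
eapply near_imp; [|apply (Cc _ Hz)]; intros w Hw.
cbv beta in Hw; rewrite <- RtoC_minus, Cmod_R in Hw; apply Rabs_def2 in Hw.
assert (Hw' : 0 < Re (a * w)) by lra.
assert (Hw0 : w <> 0).
{ intros ->; rewrite Cmult_0_r in Hw'; simpl in Hw'; lra. }
split; [apply Cexp_neq_0|].
eapply wdiff_eq.
- apply (wdiff_comp (fun w => mu * (Clog (a * w) + b))%C Cexp); [|apply Cexp_wdiff].
  apply wdiff_cmult, wdiff_plus; [|apply wdiff_const].
  apply (wdiff_comp (fun w => a * w)%C Clog); [apply wdiff_cmult, wdiff_id|now apply Clog_wdiff].
- replace (Cconj (a * 0)) with (RtoC 0) by (rewrite Cmult_0_r; apply C_eq; simpl; ring).
  field; now split.
- replace (Cconj (a * 1)) with (Cconj a) by (f_equal; ring); ring.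
Qed.

Lemma Clog_rotate_branch (v : C) (s : R) : 0 < Re v -> 0 < Im v ->
  (Clog v + Ci * RtoC s = Clog (- Ci * v) + Ci * RtoC (s + PI / 2))%C.
Proof. intros H1 H2; rewrite (Clog_rotate v H1 H2), RtoC_plus; ring. Qed.

Lemma cis_2PI_nat n : cis (2 * PI * INR n) = 1.
Proof.
induction n as [|n IH]; [rewrite Rmult_0_r; apply cis_0|].
rewrite S_INR; replace (2 * PI * (INR n + 1)) with (2 * PI * INR n + 2 * PI) by ring.
now rewrite cis_period.
Qed.

Lemma cis_2PI_Z n : cis (2 * PI * IZR n) = 1.
Proof.
destruct (Z.abs_spec n) as [[H E]|[H E]].
- rewrite <- (Z2Nat.id n H), <- INR_IZR_INZ; apply cis_2PI_nat.
- replace n with (- Z.of_nat (Z.to_nat (- n)))%Z by (rewrite Z2Nat.id; lia).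
  rewrite opp_IZR, <- INR_IZR_INZ.
  replace (2 * PI * - INR (Z.to_nat (- n))) with (- (2 * PI * INR (Z.to_nat (- n)))) by ring.
  rewrite <- Cconj_cis, cis_2PI_nat; apply C_eq; simpl; ring.
Qed.

(* The exponent is determined up to an integer, which is used to normalise
   its real part. *)
Lemma monodromy_exponent (beta : C) (s : R) : beta <> 0 ->
  exists mu, (Cexp (mu * (Ci * RtoC (2 * PI))) * beta = 1)%C /\ s <= Re mu < s + 1.
Proof.
intros Hb; destruct (Cexp_surj (/ beta)) as [w Hw].
{ apply Cmod_gt_0; rewrite Cmod_inv by easy; now apply Rinv_0_lt_compat, Cmod_gt_0. }
set (mu0 := (w * / (Ci * RtoC (2 * PI)))%C).
(* As [x < up x <= x + 1], adding [n] brings the real part into [[s, s + 1)]. *)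
set (n := (1 - up (Re mu0 - s))%Z).
assert (HCi : Ci <> 0) by (intros E; apply (f_equal Im) in E; simpl in E; lra).
exists (mu0 + RtoC (IZR n))%C; split.
- replace ((mu0 + RtoC (IZR n)) * (Ci * RtoC (2 * PI)))%C with (w + Ci * RtoC (2 * PI * IZR n))%C.
  + rewrite Cexp_plus, Hw; replace (Cexp (Ci * RtoC (2 * PI * IZR n))) with (RtoC 1); [field; easy|].
    unfold Cexp; replace (Re (Ci * RtoC (2 * PI * IZR n))) with 0 by (simpl; ring).
    replace (Im (Ci * RtoC (2 * PI * IZR n))) with (2 * PI * IZR n) by (simpl; ring).
    rewrite exp_0, cis_2PI_Z; ring.
  + unfold mu0; rewrite RtoC_mult; field; split; [apply two_PI_neq_0|easy].
- rewrite re_plus, re_RtoC; unfold n; rewrite minus_IZR.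
  destruct (archimed (Re mu0 - s)); lra.
Qed.

Definition punctured_square (r : R) (z : C) : Prop := z <> 0 /\ Rabs (Re z) < r /\ Rabs (Im z) < r.

(** Four half squares cover the punctured square, and consecutive ones meet in a quadrant, where
    their sections differ by constants [k1], ..., [k4]. After rescaling the sections agree on three
    of the quadrants, and the product of the constants is the monodromy on the fourth.
    Multiplication by [z^mu], continued around the origin, removes it. *)
Lemma flat_punctured_square {X : C -> Prop} {L : line_bundle X} (h : hermitian_metric L)
  (Q : C -> C) (r s : R) : 0 < r ->
  (forall z, punctured_square r z -> exists i rho, 0 < rho /\ (forall w, square z rho w -> dom L i w) /\
    hol (square z rho) (fun w => Q w * / w - conn h i w)%C) ->
  exists mu f, s <= Re mu < s + 1 /\
    flat_on h (fun w => (Q w + mu) * / w)%C (punctured_square r) f.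
Proof.
intros Hr Hloc.
set (q := fun w : C => (Q w * / w)%C).
assert (PS : forall z, - r < Re z < r -> - r < Im z < r -> (Re z <> 0 \/ Im z <> 0) -> punctured_square r z).
{ intros z H1 H2 H3; repeat split; [|apply Rabs_def1; lra|apply Rabs_def1; lra].
  intros ->; simpl in H3; destruct H3; lra. }
assert (Ex : forall a b c d, a < b -> c < d ->
   (forall z, orect a b c d z -> punctured_square r z) -> exists f, flat_on h q (orect a b c d) f).
{ intros a b c d Hab Hcd H; apply flat_orect_existence; auto. }
destruct (Ex 0 r (- r) r) as [fE HE]; try lra; [intros z [? ?]; apply PS; lra|].
destruct (Ex (- r) r 0 r) as [fN HN]; try lra; [intros z [? ?]; apply PS; lra|].
destruct (Ex (- r) 0 (- r) r) as [fW HW]; try lra; [intros z [? ?]; apply PS; lra|].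
destruct (Ex (- r) r (- r) 0) as [fS HS]; try lra; [intros z [? ?]; apply PS; lra|].
assert (Sub : forall a b c d a' b' c' d' f, flat_on h q (orect a' b' c' d') f ->
  a' <= a -> b <= b' -> c' <= c -> d <= d' -> flat_on h q (orect a b c d) f).
{ intros a b c d a' b' c' d' f Hf ? ? ? ?; eapply flat_on_mono; [|exact Hf]; intros z [? ?]; split; lra. }
destruct (flat_ratio_orect h q fE fN 0 r 0 r) as (k1 & Hk1 & K1); try lra;
  [eapply Sub; [exact HE| | | |]; lra|eapply Sub; [exact HN| | | |]; lra|].
destruct (flat_ratio_orect h q fN fW (- r) 0 0 r) as (k2 & Hk2 & K2); try lra;
  [eapply Sub; [exact HN| | | |]; lra|eapply Sub; [exact HW| | | |]; lra|].
destruct (flat_ratio_orect h q fW fS (- r) 0 (- r) 0) as (k3 & Hk3 & K3); try lra;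
  [eapply Sub; [exact HW| | | |]; lra|eapply Sub; [exact HS| | | |]; lra|].
destruct (flat_ratio_orect h q fS fE 0 r (- r) 0) as (k4 & Hk4 & K4); try lra;
  [eapply Sub; [exact HS| | | |]; lra|eapply Sub; [exact HE| | | |]; lra|].
destruct (monodromy_exponent (k1 * k2 * k3 * k4) s) as (mu & Hmu & Hs).
{ repeat apply Cmult_neq_0; easy. }
(* The factors [1], [- Ci], [- 1], [Ci] rotate the four half-planes onto the right one, and the
   angles [0], [PI / 2], [PI], [3 * PI / 2] make neighbouring branches agree on the first three
   quadrants. *)
set (m := fun (a : C) (b : R) (w : C) => Cexp (mu * (Clog (a * w) + Ci * RtoC b))).
set (gE := section_scal (m 1 0) fE).
set (gN := section_scal (m (- Ci)%C (PI / 2)) (section_scal (fun _ => k1) fN)).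
set (gW := section_scal (m (- (1))%C PI) (section_scal (fun _ => k1 * k2)%C fW)).
set (gS := section_scal (m Ci (3 * PI / 2)) (section_scal (fun _ => k1 * k2 * k3)%C fS)).
set (q' := fun w : C => ((Q w + mu) * / w)%C).
assert (Tw : forall a b S f, flat_on h q S f -> (forall z, S z -> 0 < Re (a * z)) ->
   flat_on h q' S (section_scal (m a b) f)).
{ intros a b S f Hf Ha; apply (flat_on_q_ext h (fun w => q w + mu * / w)%C).
  - intros w; unfold q, q'; ring.
  - apply flat_twist; [|easy]; intros z Hz; now apply power_branch, Ha. }
assert (FE : flat_on h q' (orect 0 r (- r) r) gE).
{ apply Tw; [easy|]; intros [x y] [? ?]; simpl in *; lra. }
assert (FN : flat_on h q' (orect (- r) r 0 r) gN).
{ apply Tw; [now apply flat_on_scal|]; intros [x y] [? ?]; simpl in *; lra. }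
assert (FW : flat_on h q' (orect (- r) 0 (- r) r) gW).
{ apply Tw; [apply flat_on_scal; [now apply Cmult_neq_0|easy]|]; intros [x y] [? ?]; simpl in *; lra. }
assert (FS : flat_on h q' (orect (- r) r (- r) 0) gS).
{ apply Tw; [apply flat_on_scal; [now repeat apply Cmult_neq_0|easy]|]; intros [x y] [? ?]; simpl in *; lra. }
assert (Ci2 : (- Ci * - Ci)%C = (- (1))%C) by (apply C_eq; simpl; ring).
assert (Rot : forall (a a' : C) b b' z, 0 < Re (a * z) -> 0 < Im (a * z) -> a' = (- Ci * a)%C ->
   b' = b + PI / 2 -> m a b z = m a' b' z).
{ intros a a' b b' z H1 H2 -> ->; unfold m; rewrite (Clog_rotate_branch (a * z) b H1 H2).
  now rewrite Cmult_assoc. }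
assert (NE : forall z, orect 0 r 0 r z -> gE z = gN z).
{ intros z Hz; unfold gE, gN, section_scal; rewrite (K1 z Hz); f_equal.
  destruct Hz as [? ?]; apply Rot; [destruct z; simpl in *; lra|destruct z; simpl in *; lra|ring|lra]. }
assert (NW : forall z, orect (- r) 0 0 r z -> gN z = gW z).
{ intros z Hz; unfold gN, gW, section_scal; rewrite (K2 z Hz), !scal_scal; f_equal.
  rewrite <- Cmult_assoc; f_equal; destruct Hz as [? ?].
  apply Rot; [destruct z; simpl in *; lra|destruct z; simpl in *; lra|now rewrite Ci2|lra]. }
assert (SW : forall z, orect (- r) 0 (- r) 0 z -> gW z = gS z).
{ intros z Hz; unfold gW, gS, section_scal; rewrite (K3 z Hz), !scal_scal; f_equal.
  replace (m (- (1))%C PI z) with (m Ci (3 * PI / 2) z); [ring|]; destruct Hz as [? ?].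
  symmetry; apply Rot; [destruct z; simpl in *; lra|destruct z; simpl in *; lra|ring|field]. }
assert (SE : forall z, orect 0 r (- r) 0 z -> gE z = gS z).
{ intros z Hz; unfold gE, gS, section_scal; rewrite (K4 z Hz), !scal_scal; f_equal.
  destruct Hz as [? ?].
  (* A fourth quarter turn arrives at angle [2 * PI] instead of 0; the resulting factor cancels the
     monodromy by the choice of [mu]. *)
  rewrite (Rot Ci 1 (3 * PI / 2) (2 * PI) z); [|destruct z; simpl in *; lra|destruct z; simpl in *; lra| |field].
  2: { transitivity (- (Ci * Ci))%C; [|ring]; apply C_eq; simpl; ring. }
  unfold m; rewrite !Cmult_plus_distr_l, !Cexp_plus.
  replace (mu * (Ci * RtoC 0))%C with (RtoC 0) by ring.
  replace (Cexp 0) with (RtoC 1) by (unfold Cexp; simpl; rewrite exp_0, cis_0; ring).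
  transitivity (Cexp (mu * Clog (1 * z)) * (Cexp (mu * (Ci * RtoC (2 * PI))) * (k1 * k2 * k3 * k4)))%C;
    [rewrite Hmu; ring|ring]. }
set (f := fun z => if Rlt_dec 0 (Re z) then gE z else if Rlt_dec 0 (Im z) then gN z
   else if Rlt_dec (Re z) 0 then gW z else gS z).
exists mu, f; split; [easy|]; fold q'; apply flat_on_open; intros z (Hz0 & Z1 & Z2).
apply Rabs_def2 in Z1; apply Rabs_def2 in Z2.
destruct (Rlt_dec 0 (Re z)) as [C1|C1]; [|destruct (Rlt_dec 0 (Im z)) as [C2|C2];
  [|destruct (Rlt_dec (Re z) 0) as [C3|C3]]].
- exists (orect 0 r (- r) r); split; [apply orect_near; split; lra|].
  apply (flat_on_ext h q' _ gE); [|easy]; intros w [? ?]; unfold f.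
  destruct (Rlt_dec 0 (Re w)); [easy|lra].
- exists (orect (- r) r 0 r); split; [apply orect_near; split; lra|].
  apply (flat_on_ext h q' _ gN); [|easy]; intros w [? ?]; unfold f.
  destruct (Rlt_dec 0 (Re w)); [symmetry; apply NE; split; lra|].
  destruct (Rlt_dec 0 (Im w)); [easy|lra].
- exists (orect (- r) 0 (- r) r); split; [apply orect_near; split; lra|].
  apply (flat_on_ext h q' _ gW); [|easy]; intros w [? ?]; unfold f.
  destruct (Rlt_dec 0 (Re w)); [lra|].
  destruct (Rlt_dec 0 (Im w)); [symmetry; apply NW; split; lra|].
  destruct (Rlt_dec (Re w) 0); [easy|lra].
- exists (orect (- r) r (- r) 0); split.
  (* Here [Re z = 0] and [Im z <= 0]; excluding the origin leaves [Im z < 0]. *)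
  { apply orect_near; split; [lra|]; split; [lra|].
    destruct (Rtotal_order (Im z) 0) as [|[E|]]; [easy| |lra].
    exfalso; apply Hz0, C_eq; simpl; lra. }
  apply (flat_on_ext h q' _ gS); [|easy]; intros w [? ?]; unfold f.
  destruct (Rlt_dec 0 (Re w)); [symmetry; apply SE; split; lra|].
  destruct (Rlt_dec 0 (Im w)); [lra|].
  destruct (Rlt_dec (Re w) 0); [symmetry; apply SW; split; lra|easy].
Qed.

(** * Generators of the prolongations *)

(** For a multiple [c] of a frame, [log |f|^2] has derivative [c' / c + conn], and here
    [c' / c = q - conn]: the frame drops out. *)
Lemma flat_norm2 {X} {L : line_bundle X} (h : hermitian_metric L) (q : C -> C) (S : C -> Prop) f z :
  flat_on h q S f -> near z S ->
  0 < norm2 h z (f z) /\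
  wdiff (fun w => RtoC (ln (norm2 h w (f w)))) z (q z) (Cconj (q z)).
Proof.
intros Hf HS; destruct (Hf z (near_self _ _ HS)) as (i & c & Hn).
destruct (near_self _ _ Hn) as (Hd & H0 & Hc & Ef).
assert (En : near z (fun w => norm2 h w (f w) = Cmod (c w) ^ 2 * frame_norm2 h i w)).
{ eapply near_imp; [|apply (near_and _ _ _ HS Hn)]; intros w (Sw & A1 & A2 & A3 & A4).
  rewrite A4 by easy; apply norm2_scal, (dom_cover L); now exists i. }
assert (P : 0 < norm2 h z (f z)).
{ rewrite (near_self _ _ En); apply Rmult_lt_0_compat; [apply pow_lt; now apply Cmod_gt_0|].
  now apply frame_norm2_pos. }
split; [easy|].
assert (W := norm2_section_wdiff h i c _ z Hd Hc).
apply (wdiff_ext_near _ (fun w => RtoC (norm2 h w (f w)))) in W.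
2: { eapply near_imp; [|exact En]; intros w E; now rewrite E. }
assert (W' := wdiff_real_comp ln (fun w => norm2 h w (f w)) z _ (/ norm2 h z (f z)) W
  ltac:(apply is_derive_Reals, derivable_pt_lim_ln, P)).
assert (Eq : (RtoC (/ norm2 h z (f z)) * (((q z - conn h i z) * c z * Cconj (c z) +
  c z * Cconj (c z) * conn h i z) * RtoC (frame_norm2 h i z)))%C = q z).
{ rewrite (near_self _ _ En), RtoC_inv, RtoC_mult, Cmod2_conj
    by (rewrite <- (near_self _ _ En); lra).
  assert (F := frame_norm2_pos h i z Hd); field; repeat split.
  - apply RtoC_neq_0; lra.
  - apply Cmod_gt_0; rewrite Cmod_conj; now apply Cmod_gt_0.
  - easy. }
rewrite Eq in W'; exact W'.
Qed.

(** A holomorphic coefficient in one frame near each point is enough, since coefficients in any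
    other frame differ by a holomorphic transition function. *)
Lemma section_coefficient_holomorphic {X} (L : line_bundle X) (V : C -> Prop) (f : section L) :
  (forall z, V z -> exists i c, near z (fun w => dom L i w /\ (exists l, wdiff c w l 0) /\
     f w = scal (c w) (frame L i w))) ->
  holomorphic_section L V f.
Proof.
intros H i.
set (co := fun z => epsilon (inhabits (RtoC 0)) (fun c : C => f z = scal c (frame L i z))).
assert (Hco : forall z, dom L i z -> f z = scal (co z) (frame L i z)).
{ intros z Hz; apply (epsilon_spec (inhabits (RtoC 0)) (fun c : C => f z = scal c (frame L i z))).
  destruct (frame_basis L i z Hz (f z)) as [c [E _]]; now exists c. }
exists co; split; [|auto].
apply holomorphic_on_hol; intros z [Vz Dz].
destruct (H z Vz) as (j & c & Hn); destruct (frame_change L i j) as (g & Hg & Ht).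
destruct (near_self _ _ Hn) as (Dj & (l & Hl) & _).
exists (l * g z + c z * Cder g z)%C.
apply (wdiff_ext_near (fun w => c w * g w)%C).
- eapply near_imp; [|apply (near_and _ _ _ Hn (dom_near L i z Dz))].
  intros w ((Dw & _ & Ew) & Di); apply (frame_scal_inj L i w _ _ Di).
  rewrite <- (Hco w Di), Ew, (proj2 (Ht w Di Dw)), scal_scal; reflexivity.
- eapply wdiff_eq; [apply wdiff_mult; [exact Hl|apply (Cder_spec _ g z Hg); now split]|reflexivity|].
  cbv beta; ring.
Qed.

Lemma flat_holomorphic_section {X} {L : line_bundle X} (h : hermitian_metric L) (q : C -> C)
  (S V : C -> Prop) f : flat_on h q S f -> (forall z, V z -> near z S) -> holomorphic_section L V f.
Proof.
intros Hf HV; apply section_coefficient_holomorphic; intros z Hz.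
destruct (Hf z (near_self _ _ (HV z Hz))) as (i & c & Hn); exists i, c.
eapply near_imp; [|apply (near_and _ _ _ (HV z Hz) Hn)]; intros w (Sw & A1 & A2 & A3 & A4).
repeat split; auto; eexists; exact A3.
Qed.

Lemma punctured_square_near r z : punctured_square r z -> near z (punctured_square r).
Proof.
intros (H0 & H1 & H2).
assert (N : near z (fun w => w <> 0)) by (apply (ccont_near_neq_0 (fun w => w)); [eapply wdiff_ccont, wdiff_id|easy]).
assert (Sq : square 0 r z) by (split; simpl; rewrite Rminus_0_r; easy).
eapply near_imp; [|apply (near_and _ _ _ N (square_near _ _ _ Sq))]; intros w [W0 [W1 W2]].
simpl in W1, W2; rewrite Rminus_0_r in W1, W2; repeat split; easy.
Qed.

(** The exponent [sg] is [Re mu], normalised to the half-open interval by the integer freedom in the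
    monodromy. The growth is exact only up to arbitrarily small powers of [|z|], which matches the
    [eps] in the definition of [prolongation]. *)
Lemma generator_existence (L : line_bundle punctured_disc) (h : hermitian_metric L) K a :
  0 < K -> curvature_bounded h K ->
  exists (f : section L) (r sg : R), 0 < r /\ - a <= sg < - a + 1 /\
    (forall V : C -> Prop, Defs.included V (square 0 r) -> holomorphic_section L (puncture V) f) /\
    forall del, 0 < del -> exists r1 M, 0 < r1 <= 1 /\ forall z : C, z <> 0 -> Cmod z < r1 ->
      0 < norm2 h z (f z) /\
      Rabs (ln (norm2 h z (f z)) - 2 * sg * ln (Cmod z)) <= - 2 * del * ln (Cmod z) + M.
Proof.
intros HK HC.
destruct (dbar_solution _ K (global_curv_bounded L h K HK HC)) as (Q & Q0 & CQ & HQ).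
(* The square of half-side 1/3 lies in the disc of radius 1/2 where the [dbar] equation is solved,
   as [2/9 < 1/4]. *)
destruct (flat_punctured_square h Q (1 / 3) (- a)) as (mu & f & Hmu & Hf); [lra| |].
{ intros z (Hz & Hx & Hy).
  assert (Hm := proj1 (Cmod_gt_0 z) Hz).
  assert (Hz2 : Cmod z < 1 / 2).
  { assert (E := Cmod2_alt z); rewrite <- (pow2_abs (Re z)), <- (pow2_abs (Im z)) in E.
    assert (X := Rabs_pos (Re z)); assert (Y := Rabs_pos (Im z)).
    assert (X2 : Rabs (Re z) ^ 2 <= 1 / 9)
      by (replace (1 / 9) with ((1 / 3) ^ 2) by field; apply pow_incr; lra).
    assert (Y2 : Rabs (Im z) ^ 2 <= 1 / 9)
      by (replace (1 / 9) with ((1 / 3) ^ 2) by field; apply pow_incr; lra).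
    apply Rnot_le_lt; intros Hc; nra. }
  destruct (HQ z Hz Hz2) as (rho & Hrho & Hsq & HG).
  destruct (proj1 (dom_cover L z)) as [i Hi]; [split; [change (Cmod z < 1); lra|easy]|].
  destruct (near_square z (fun w => square z rho w /\ dom L i w)) as (rho' & Hrho' & Hs).
  { apply near_and; [apply square_near; now apply square_center|now apply dom_near]. }
  exists i, rho'; split; [easy|]; split; [intros w Hw; now apply Hs|].
  (* For an exact solution [G] the derivatives of [G] and of [w * conn] in [bar w] cancel, so the
     function is a uniform limit of holomorphic ones. Division by [w] is postponed to keep the
     approximation error unchanged. *)
  assert (HH : hol (square z rho') (fun w => Q w - w * conn h i w)%C).
  { apply hol_uniform_limit; [easy|]; intros eps He; destruct (HG eps He) as [G HG'].
    exists (fun w => G w - w * conn h i w)%C; split.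
    - intros w Hw; destruct (Hs w Hw) as [S1 D1]; destruct (HG' w S1) as [[A HA] _].
      destruct (conn_wdiff h i w D1) as [B HB]; eexists; eapply wdiff_eq.
      + apply wdiff_minus; [exact HA|apply wdiff_mult; [apply wdiff_id|exact HB]].
      + reflexivity.
      + cbv beta; rewrite (global_curv_eq h i w D1); ring.
    - intros w Hw; destruct (Hs w Hw) as [S1 D1]; destruct (HG' w S1) as [_ B].
      eapply Rle_trans; [right|exact B]; f_equal; ring. }
  intros w Hw; destruct (HH w Hw) as [l Hl].
  assert (W0 : w <> 0) by (apply Hsq, Hs, Hw).
  eexists; apply (wdiff_ext_near (fun v => (Q v - v * conn h i v) * / v)%C).
  2: { eapply wdiff_eq; [apply (wdiff_mult _ Cinv); [exact Hl|apply Cinv_wdiff, W0]|reflexivity|ring]. }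
  eapply near_imp; [|apply (square_near _ _ _ Hw)]; intros v Hv.
  assert (V0 : v <> 0) by (apply Hsq, Hs, Hv); cbv beta; field; easy. }
exists f, (1 / 3), (Re mu); split; [lra|]; split; [easy|]; split.
- intros V HV; apply (flat_holomorphic_section h _ _ _ f Hf).
  intros z [Vz Z0]; apply punctured_square_near; destruct (HV z Vz) as [V1 V2]; simpl in V1, V2.
  rewrite Rminus_0_r in V1, V2; repeat split; easy.
- intros del Hdel.
  assert (PS : forall z : C, z <> 0 -> Cmod z < 1 / 3 -> near z (punctured_square (1 / 3))).
  { intros z Hz Hm; apply punctured_square_near; repeat split; [easy| |];
    eapply Rle_lt_trans; [apply re_le_Cmod|easy|apply im_le_Cmod|easy]. }
  destruct (log_growth (fun w => ln (norm2 h w (f w))) Q mu (1 / 3)) with (del := del)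
    as (r1 & M & Hr1 & HM); try easy; [lra| |].
  + intros z Hz Hm; apply (flat_norm2 h _ _ f z Hf); now apply PS.
  + exists (Rmin r1 (1 / 3)), M; split.
    * split; [apply Rmin_glb_lt; lra|]; eapply Rle_trans; [apply Rmin_r|lra].
    * intros z Hz Hm; split.
      -- apply (flat_norm2 h _ _ f z Hf), PS; [easy|]; eapply Rlt_le_trans; [exact Hm|apply Rmin_r].
      -- apply HM; [easy|]; eapply Rlt_le_trans; [exact Hm|apply Rmin_l].
Qed.

(** * The dual norm and the duality pairing *)

Lemma metric_norm_scal {X} {L : line_bundle X} (h : hermitian_metric L) z c v : X z ->
  metric_norm h z (scal c v) = Cmod c * metric_norm h z v.
Proof.
intros Hz; unfold metric_norm.
change (sqrt (norm2 h z (scal c v)) = Cmod c * sqrt (norm2 h z v)).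
rewrite norm2_scal by easy; rewrite sqrt_mult_alt by apply pow2_ge_0.
rewrite sqrt_pow2 by apply Cmod_ge_0; reflexivity.
Qed.

(** The fibre is a line, so the supremum in the dual norm is attained on every nonzero direction and
    the usual inequality becomes an equality. *)
Lemma dual_norm_eval {X} {L : line_bundle X} (h : hermitian_metric L) z
  (xi : fiber (dual_bundle L) z) (v : fiber L z) : X z ->
  Cmod (eval xi v) = dual_metric_norm h z xi * metric_norm h z v.
Proof.
intros Hz; destruct (proj1 (dom_cover L z) Hz) as [i Hi].
set (e := frame L i z).
set (N := metric_norm h z e).
assert (HN : 0 < N) by (apply sqrt_lt_R0, (frame_norm2_pos h i z Hi)).
assert (D : dual_metric_norm h z xi = Cmod (eval xi e) / N).
{ unfold dual_metric_norm.
  rewrite (is_lub_Rbar_unique _ (Finite (Cmod (eval xi e) / N))); [reflexivity|split].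
  - intros x (u & Hu & ->); destruct (frame_basis L i z Hi u) as [c [Ec _]]; fold e in Ec.
    rewrite Ec in *; rewrite metric_norm_scal in Hu by easy; fold N in Hu.
    rewrite eval_scal, Cmod_mult; simpl.
    apply (Rle_div_r _ _ N); [easy|].
    assert (T := Cmod_ge_0 (eval xi e)); nra.
  (* The normalised frame vector attains the bound. *)
  - intros b Hb; apply Hb; exists (scal (RtoC (/ N)) e); split.
    + rewrite metric_norm_scal, Cmod_R_nonneg by (easy || (apply Rlt_le, Rinv_0_lt_compat; easy)).
      fold N; rewrite Rinv_l; lra.
    + rewrite eval_scal, Cmod_mult, Cmod_R_nonneg by (apply Rlt_le, Rinv_0_lt_compat; easy).
      unfold Rdiv; ring. }
destruct (frame_basis L i z Hi v) as [c [Ec _]]; fold e in Ec; rewrite Ec.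
rewrite metric_norm_scal, eval_scal, Cmod_mult, D by easy; fold N; field; lra.
Qed.

Lemma pairing_hol {X} (L : line_bundle X) (V : C -> Prop) (s : section (dual_bundle L)) (f : section L) :
  (forall z, V z -> X z) -> (forall z, V z -> near z V) ->
  holomorphic_section (dual_bundle L) V s -> holomorphic_section L V f ->
  hol V (fun z => eval (s z) (f z)).
Proof.
intros HX HV Hs Hf z Hz; destruct (proj1 (dom_cover L z) (HX z Hz)) as [i Hi].
destruct (Hs i) as (d & Hd & Ed); destruct (Hf i) as (c & Hc & Ec); simpl in d, Hd, Ed.
apply holomorphic_on_hol in Hd; apply holomorphic_on_hol in Hc.
destruct (Hd z (conj Hz Hi)) as [ld Hld]; destruct (Hc z (conj Hz Hi)) as [lc Hlc].
exists (ld * c z + d z * lc)%C; apply (wdiff_ext_near (fun w => d w * c w)%C).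
- eapply near_imp; [|apply (near_and _ _ _ (HV z Hz) (dom_near L i z Hi))]; intros w [Vw Dw].
  rewrite (Ed w Vw Dw), (Ec w Vw Dw), eval_scal.
  change (d w * c w = c w * (d w * eval (dual_frame L i w) (frame L i w)))%C.
  rewrite (dual_frame_spec L i w Dw); ring.
- eapply wdiff_eq; [apply wdiff_mult; [exact Hld|exact Hlc]|reflexivity|cbv beta; ring].
Qed.

(** * Limits at the puncture *)

Definition lim0 (g : C -> C) (l : C) : Prop :=
  forall eps, 0 < eps -> near 0 (fun w => w <> 0 -> Cmod (g w - l) < eps).

Lemma lim0_unique g l l' : lim0 g l -> lim0 g l' -> l = l'.
Proof.
intros H H'; assert (E : (l - l' = 0)%C).
{ apply Cmod_eq_0, Rle_antisym; [|apply Cmod_ge_0]; apply Rnot_lt_le; intros Hp.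
  destruct (near_and _ _ _ (H (Cmod (l - l') / 2) ltac:(lra)) (H' (Cmod (l - l') / 2) ltac:(lra)))
    as (d & Hd & Hn).
  destruct (Hn (RtoC (d / 2))) as [A B].
  { replace (RtoC (d / 2) - 0)%C with (RtoC (d / 2)) by ring; rewrite Cmod_R_nonneg; lra. }
  assert (N : RtoC (d / 2) <> 0) by (apply RtoC_neq_0; lra).
  specialize (A N); specialize (B N).
  assert (T := Cmod_sub_triangle l (g (RtoC (d / 2))) l'); rewrite (Cmod_sub_sym l (g _)) in T; lra. }
replace l with (l - l' + l')%C by ring; rewrite E; ring.
Qed.

Lemma lim0_ext f g l : near 0 (fun w => w <> 0 -> f w = g w) -> lim0 f l -> lim0 g l.
Proof.
intros H Hf eps He; eapply near_imp; [|apply (near_and _ _ _ H (Hf eps He))].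
intros w [A B] W; rewrite <- A; auto.
Qed.

Lemma ccont_lim0 g : ccont g 0 -> lim0 g (g 0).
Proof. intros H eps He; eapply near_imp; [|exact (H eps He)]; auto. Qed.

Definition value0 (g : C -> C) : C := epsilon (inhabits (RtoC 0)) (lim0 g).

Lemma value0_eq g l : lim0 g l -> value0 g = l.
Proof.
intros H; apply (lim0_unique g); [|easy]; unfold value0; apply epsilon_spec; now exists l.
Qed.

(** Taking the value at 0 as a limit makes it depend only on [g] off 0, as the restriction property
    of a sheaf morphism requires. *)
Definition extend0 (g : C -> C) (z : C) : C := if Ceq_dec z 0 then value0 g else g z.

Lemma extend0_off (g : C -> C) (z : C) : z <> 0 -> extend0 g z = g z.
Proof. intros H; unfold extend0; destruct (Ceq_dec z 0); easy. Qed.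

Lemma extend0_at (g G : C -> C) : ccont G 0 -> near 0 (fun w => w <> 0 -> G w = g w) ->
  extend0 g 0 = G 0 /\ near 0 (fun w => G w = extend0 g w).
Proof.
intros HG Hn.
assert (E : extend0 g 0 = G 0).
{ unfold extend0; destruct (Ceq_dec 0 0); [|easy].
  apply value0_eq, (lim0_ext G); [easy|now apply ccont_lim0]. }
split; [easy|]; eapply near_imp; [|exact Hn]; intros w Hw.
destruct (Ceq_dec w 0) as [->|N]; [now symmetry|rewrite extend0_off; auto].
Qed.

Lemma neq_0_near (z : C) : z <> 0 -> near z (fun w => w <> 0).
Proof. apply (ccont_near_neq_0 (fun w => w)); eapply wdiff_ccont, wdiff_id. Qed.

Lemma locally'_near (P : C -> Prop) :
  locally' (T := C_UniformSpace) (RtoC 0) P <-> near 0 (fun w => w <> 0 -> P w).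
Proof. symmetry; apply near_locally. Qed.

Lemma Rpower_small (e M eps : R) : 0 < e -> 0 <= M -> 0 < eps ->
  exists d, 0 < d /\ forall x, 0 < x < d -> M * Rpower x e <= eps.
Proof.
intros He HM Heps; set (t := eps / (M + 1)).
assert (Ht : 0 < t) by (apply Rdiv_lt_0_compat; lra).
exists (exp (ln t / e)); split; [apply exp_pos|]; intros x Hx.
assert (L : Rpower x e <= t).
{ unfold Rpower; rewrite <- (exp_ln t Ht).
  assert (A := ln_increasing _ _ (proj1 Hx) (proj2 Hx)); rewrite ln_exp in A.
  apply (Rmult_lt_compat_r e) in A; [|easy].
  replace (ln t / e * e) with (ln t) in A by (field; lra).
  left; apply exp_increasing; lra. }
assert (E : t * (M + 1) = eps) by (unfold t; field; lra).
assert (0 < Rpower x e) by apply exp_pos; nra.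
Qed.

Lemma metric_norm_exp {X} {L : line_bundle X} (h : hermitian_metric L) z (v : fiber L z) :
  0 < norm2 h z v -> metric_norm h z v = exp (ln (norm2 h z v) / 2).
Proof.
intros H; change (sqrt (norm2 h z v) = exp (ln (norm2 h z v) / 2)).
apply sqrt_lem_1; [lra|apply Rlt_le, exp_pos|].
rewrite <- exp_plus; replace (_ + _) with (ln (norm2 h z v)) by field; now apply exp_ln.
Qed.

Lemma metric_norm_ge_0 {X} {L : line_bundle X} (h : hermitian_metric L) z (v : fiber L z) :
  0 <= metric_norm h z v.
Proof. apply sqrt_pos. Qed.

Lemma exp_le_mono x y : x <= y -> exp x <= exp y.
Proof. intros [H| ->]; [left; now apply exp_increasing|lra]. Qed.

Lemma ln_lt_0 x : 0 < x < 1 -> ln x < 0.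
Proof. intros H; rewrite <- ln_1; apply ln_increasing; lra. Qed.

Lemma open_square_inter (U : C -> Prop) c r : open U -> open (fun z => U z /\ square c r z).
Proof.
intros HU z [Uz Sz]; apply near_locally, near_and; [now apply open_near|now apply square_near].
Qed.

Lemma open_puncture (U : C -> Prop) : open U -> open (puncture U).
Proof.
intros HU z [Uz Z0]; apply near_locally, near_and; [now apply open_near|now apply neq_0_near].
Qed.

Lemma holomorphic_section_mono {X} (L : line_bundle X) (V W : C -> Prop) (f : section L) :
  (forall z, W z -> V z) -> holomorphic_section L V f -> holomorphic_section L W f.
Proof.
intros HW Hf i; destruct (Hf i) as (c & Hc & Ec); exists c; split.
- intros z [Wz Dz]; apply Hc; auto.
- intros z Wz Dz; auto.
Qed.

Lemma puncture_disc (U : C -> Prop) : Defs.included U Defs.disc -> forall z, puncture U z -> punctured_disc z.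
Proof. intros HU z [Uz Z0]; split; [now apply HU|easy]. Qed.

Section Inclusions.
Context {L : line_bundle punctured_disc} (h : hermitian_metric L).

(* A local generator [f] of the prolongation, with [|f|_h] of order
   [|z|^sg], detects the growth of a section [s] of the dual sheaf because
   the holomorphic function [s(f)] is bounded near 0. *)
Lemma dual_sheaf_in_prolongation a r sg (f : section L) eps :
  0 < r -> - a <= sg -> eps < - a + 1 - sg ->
  (forall V : C -> Prop, Defs.included V (square 0 r) -> holomorphic_section L (puncture V) f) ->
  (forall del, 0 < del -> exists r1 M, 0 < r1 <= 1 /\ forall z : C, z <> 0 -> Cmod z < r1 ->
      0 < norm2 h z (f z) /\
      Rabs (ln (norm2 h z (f z)) - 2 * sg * ln (Cmod z)) <= - 2 * del * ln (Cmod z) + M) ->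
  forall (U : C -> Prop) s, open U -> Defs.included U Defs.disc ->
    dual_sheaf (prolongation L (metric_norm h) a) U s ->
    prolongation (dual_bundle L) (dual_metric_norm h) (- a + 1 - eps) U s.
Proof.
intros Hr Hsg Heps Hol Hgr U s HU HUd [Hs (phi & Hphi & Hev)]; split; [easy|].
intros U0 e He.
set (V := fun z : C => U z /\ square 0 r z).
assert (HV : open V) by now apply open_square_inter.
assert (V0 : V 0) by (split; [easy|now apply square_center]).
(* Since [- a <= sg], the loss [|z|^-del] with [del = e'] is within the growth allowed to sections
   of [_a L]. *)
assert (FV : prolongation L (metric_norm h) a V f).
{ split; [apply Hol; intros z Hz; apply Hz|]; intros _ e' He'.
  destruct (Hgr e' He') as (r1 & M & Hr1 & HM); exists (exp (M / 2)); apply locally'_near.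
  exists r1; split; [easy|]; intros z Hz Z0; replace (z - 0)%C with z in Hz by ring.
  destruct (HM z Z0 Hz) as [N B]; assert (Hm := proj1 (Cmod_gt_0 z) Z0).
  assert (Hl := ln_lt_0 (Cmod z) ltac:(lra)).
  rewrite metric_norm_exp by easy; unfold Rpower; rewrite <- exp_plus.
  apply Rabs_le_between in B; apply exp_le_mono; nra. }
destruct (hom_holomorphic _ _ _ Hphi V f HV (fun z Hz => proj1 Hz) FV 0 V0) as [l0 Hl0].
assert (Cphi : ccont (phi V f) 0).
{ destruct (proj1 (ex_derive_wdiff (phi V f) (RtoC 0)) (ex_intro _ l0 Hl0)) as [l Hl]; eapply wdiff_ccont, Hl. }
(* The room left by the choice of [eps]: the quotient of the bounds is [O(|z|^-(sg + del))], and
   [sg + del = - a + 1 - eps]. *)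
set (del := - a + 1 - eps - sg).
destruct (Hgr del) as (r1 & M & Hr1 & HM); [unfold del; lra|].
set (M0 := Cmod (phi V f 0) + 1).
exists (M0 * exp (M / 2)); apply locally'_near.
apply near_imp with (P := fun z : C => (Cmod (phi V f z - phi V f 0) < 1 /\ V z) /\ Cmod (z - 0) < r1).
2: { apply near_and; [apply near_and; [apply Cphi; lra|now apply open_near]|].
  exists r1; split; [lra|auto]. }
intros z ((B & Vz) & Hz) Z0; replace (z - 0)%C with z in Hz by ring.
assert (Hm := proj1 (Cmod_gt_0 z) Z0); assert (Hl := ln_lt_0 (Cmod z) ltac:(lra)).
assert (HW : open (puncture V)) by now apply open_puncture.
(* The morphism is known to be evaluation only over open sets avoiding 0. So the section is
   restricted to the punctured set, where the growth condition is vacuous. *)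
assert (FW : prolongation L (metric_norm h) a (puncture V) f).
{ split; [|intros [_ N]; easy].
  apply (holomorphic_section_mono L (puncture V)); [intros w [W _]; exact W|apply FV]. }
assert (E : phi V f z = eval (s z) (f z)).
{ rewrite (hom_restrict _ _ _ Hphi V (puncture V) f f HV HW); auto.
  - apply Hev; auto; [intros w [[W _] W0]; now split|now split].
  - intros w W; apply W.
  - intros w W; apply W.
  - now split. }
assert (Bs : Cmod (eval (s z) (f z)) <= M0).
{ rewrite <- E; replace (phi V f z) with (phi V f z - phi V f 0 + phi V f 0)%C by ring.
  eapply Rle_trans; [apply Cmod_triangle|]; unfold M0; lra. }
assert (Xz : punctured_disc z) by (apply (puncture_disc U HUd); split; [apply Vz|easy]).
rewrite (dual_norm_eval h z (s z) (f z) Xz) in Bs.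
destruct (HM z Z0 Hz) as [N B2]; rewrite metric_norm_exp in Bs by easy.
set (t := ln (norm2 h z (f z)) / 2) in *.
assert (HM0 : 0 < M0) by (unfold M0; assert (T := Cmod_ge_0 (phi V f 0)); lra).
apply Rle_trans with (M0 * exp (- t)).
- rewrite exp_Ropp; apply (Rle_div_r _ _ (exp t)); [apply exp_pos|easy].
- rewrite Rmult_assoc; apply Rmult_le_compat_l; [lra|].
  unfold Rpower; rewrite <- exp_plus; apply exp_le_mono.
  apply Rabs_le_between in B2; unfold t, del in *; nra.
Qed.

(** The two exponents of growth add up to slightly less than 1, so [z] times the pairing tends to 0
    and the singularity is removable. *)
Lemma pairing_extends a eps (U V : C -> Prop) (s : section (dual_bundle L)) (f : section L) : 0 < eps ->
  Defs.included U Defs.disc -> open V -> Defs.included V U -> V 0 ->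
  prolongation (dual_bundle L) (dual_metric_norm h) (- a + 1 - eps) U s ->
  prolongation L (metric_norm h) a V f ->
  exists l, wdiff (extend0 (fun z => eval (s z) (f z))) 0 l 0.
Proof.
intros Heps HUd HV HVU V0 [Hs Gs] [Hf Gf].
set (g := fun z => eval (s z) (f z)).
assert (Hp : forall z, puncture V z -> punctured_disc z).
{ intros z [Vz Z0]; apply (puncture_disc U HUd); split; auto. }
assert (Hg : hol (puncture V) g).
{ apply pairing_hol; auto.
  - intros z Hz; now apply open_near; [apply open_puncture|].
  - apply (holomorphic_section_mono (dual_bundle L) (puncture U)); [|easy].
    intros z [Vz Z0]; split; auto. }
destruct (near_square 0 V (open_near V 0 HV V0)) as (rho & Hrho & Hsq).
destruct (removable_singularity g rho Hrho) as (G & HG & EG).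
- intros p Hp1 Hp0; apply Hg; split; auto.
(* A quarter of [eps] is spent on each factor, which leaves the positive power [|z|^(eps/2)] after
   multiplication by [z]. *)
- destruct (Gs (HVU 0 V0) (eps / 4) ltac:(lra)) as [M1 H1]; destruct (Gf V0 (eps / 4) ltac:(lra)) as [M2 H2].
  apply locally'_near in H1; apply locally'_near in H2.
  intros e He.
  destruct (Rpower_small (eps / 2) (Rabs M1 * Rabs M2) e) as (d & Hd & Hsm); [lra| |easy|].
  { apply Rmult_le_pos; apply Rabs_pos. }
  apply near_imp with (P := fun z : C => ((z <> 0 -> dual_metric_norm h z (s z) <= M1 * Rpower (Cmod z) (- (- a + 1 - eps + eps / 4))) /\
    (z <> 0 -> metric_norm h z (f z) <= M2 * Rpower (Cmod z) (- (a + eps / 4)))) /\ (V z /\ Cmod (z - 0) < d)).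
  2: { apply near_and; [now apply near_and|apply near_and; [now apply open_near|exists d; auto]]. }
  intros z ((A1 & A2) & Vz & Hz) Z0; specialize (A1 Z0); specialize (A2 Z0).
  replace (z - 0)%C with z in Hz by ring; assert (Hm := proj1 (Cmod_gt_0 z) Z0).
  rewrite Cmod_mult; unfold g; rewrite (dual_norm_eval h z (s z) (f z)) by (apply Hp; now split).
  set (p1 := Rpower (Cmod z) (- (- a + 1 - eps + eps / 4))) in *.
  set (p2 := Rpower (Cmod z) (- (a + eps / 4))) in *.
  assert (P1 : 0 < p1) by apply exp_pos; assert (P2 : 0 < p2) by apply exp_pos.
  assert (B1 : dual_metric_norm h z (s z) <= Rabs M1 * p1).
  { eapply Rle_trans; [exact A1|]; apply Rmult_le_compat_r; [lra|apply Rle_abs]. }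
  assert (B2 : metric_norm h z (f z) <= Rabs M2 * p2).
  { eapply Rle_trans; [exact A2|]; apply Rmult_le_compat_r; [lra|apply Rle_abs]. }
  assert (EP : Cmod z * (p1 * p2) = Rpower (Cmod z) (eps / 2)).
  { unfold p1, p2; rewrite <- Rpower_plus; rewrite <- (Rpower_1 (Cmod z)) at 1 by easy.
    rewrite <- Rpower_plus; f_equal; field. }
  assert (N0 := metric_norm_ge_0 h z (f z)).
  apply Rle_trans with (Cmod z * (Rabs M1 * p1 * (Rabs M2 * p2))).
  + apply Rmult_le_compat_l; [lra|].
    apply Rle_trans with (Rabs M1 * p1 * metric_norm h z (f z)); [now apply Rmult_le_compat_r|].
    apply Rmult_le_compat_l; [|easy]; apply Rmult_le_pos; [apply Rabs_pos|lra].
  + replace (Cmod z * (Rabs M1 * p1 * (Rabs M2 * p2))) with (Rabs M1 * Rabs M2 * (Cmod z * (p1 * p2))) by ring.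
    rewrite EP; apply Hsm; lra.
- destruct (HG 0 (square_center 0 rho Hrho)) as [l Hl]; exists l.
  apply (wdiff_ext_near G); [|exact Hl].
  apply (extend0_at g G); [eapply wdiff_ccont, Hl|].
  exists 1; split; [lra|]; intros w _; apply EG.
Qed.

Lemma lim0_extend0 g : ccont (extend0 g) 0 -> lim0 g (extend0 g 0).
Proof.
intros H; apply (lim0_ext (extend0 g)); [|now apply ccont_lim0].
exists 1; split; [lra|]; intros w _; apply extend0_off.
Qed.

Lemma extend0_at_0 g l : lim0 g l -> extend0 g 0 = l.
Proof. intros H; unfold extend0; destruct (Ceq_dec 0 0); [now apply value0_eq|easy]. Qed.

(** The morphism sends a section to the holomorphic extension of its pairing with [s]. Off 0 its
    properties are those of evaluation; at 0 they follow by passing to the limit. *)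
Lemma prolongation_in_dual_sheaf a eps (U : C -> Prop) s : 0 < eps ->
  open U -> Defs.included U Defs.disc ->
  prolongation (dual_bundle L) (dual_metric_norm h) (- a + 1 - eps) U s ->
  dual_sheaf (prolongation L (metric_norm h) a) U s.
Proof.
intros Heps HU HUd Hs; split; [apply Hs|].
set (pair := fun (f : section L) z => eval (s z) (f z)).
assert (Hext : forall (V : C -> Prop) f, open V -> Defs.included V U -> prolongation L (metric_norm h) a V f -> V 0 ->
  exists l, wdiff (extend0 (pair f)) 0 l 0).
{ intros V f HV HVU HF V0; now apply (pairing_extends a eps U V). }
assert (Hlim : forall (V : C -> Prop) f, open V -> Defs.included V U -> prolongation L (metric_norm h) a V f -> V 0 ->
  lim0 (pair f) (extend0 (pair f) 0)).
{ intros V f HV HVU HF V0; destruct (Hext V f HV HVU HF V0) as [l Hl].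
  eapply lim0_extend0, wdiff_ccont, Hl. }
(* The open set can be ignored, because the extension is determined by the values of [f] near the
   point and off 0. *)
exists (fun _ f => extend0 (pair f)); split; [split|].
- intros V f HV HVU HF z Vz; apply ex_derive_wdiff.
  destruct (Ceq_dec z 0) as [->|Z0]; [now apply (Hext V)|].
  assert (Hg : hol (puncture V) (pair f)).
  { apply pairing_hol.
    - intros w [Vw W0]; apply (puncture_disc U HUd); split; auto.
    - intros w Hw; now apply open_near; [apply open_puncture|].
    - apply (holomorphic_section_mono (dual_bundle L) (puncture U)); [|apply Hs].
      intros w [Vw W0]; split; auto.
    - apply HF. }
  destruct (Hg z (conj Vz Z0)) as [l Hl]; exists l; apply (wdiff_ext_near (pair f)); [|exact Hl].
  eapply near_imp; [|apply (neq_0_near z Z0)]; intros w W; symmetry; now apply extend0_off.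
- intros V W f g HV HW HVU HWV HF HG Hfg z Wz.
  destruct (Ceq_dec z 0) as [->|Z0].
  + apply extend0_at_0, (lim0_ext (pair g)).
    * eapply near_imp; [|apply (open_near W 0 HW Wz)]; intros w Ww W0; unfold pair.
      rewrite (Hfg w); [easy|now split].
    * apply (Hlim W); auto; intros w Hw; auto.
  + rewrite !extend0_off by easy; unfold pair; rewrite (Hfg z); [easy|now split].
- intros V f g HV HVU HF HG z Vz; destruct (Ceq_dec z 0) as [->|Z0].
  + apply extend0_at_0.
    assert (H1 := Hlim V f HV HVU HF Vz); assert (H2 := Hlim V g HV HVU HG Vz).
    intros e He; eapply near_imp; [|apply (near_and _ _ _ (H1 (e / 2) ltac:(lra)) (H2 (e / 2) ltac:(lra)))].
    intros w [A B] W0; specialize (A W0); specialize (B W0).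
    unfold pair at 1, section_plus; rewrite eval_plus.
    replace (_ - _)%C with ((pair f w - extend0 (pair f) 0) + (pair g w - extend0 (pair g) 0))%C
      by (unfold pair; ring).
    eapply Rle_lt_trans; [apply Cmod_triangle|]; lra.
  + rewrite !extend0_off by easy; unfold pair, section_plus; apply eval_plus.
- intros V c f HV HVU Hc HF z Vz; destruct (Ceq_dec z 0) as [->|Z0].
  + destruct (proj1 (ex_derive_wdiff c (RtoC 0)) (Hc 0 Vz)) as [lc Hlc].
    destruct (Hext V f HV HVU HF Vz) as [l Hl].
    assert (Cc := ccont_mult _ _ _ (wdiff_ccont _ _ _ _ Hlc) (wdiff_ccont _ _ _ _ Hl)).
    apply extend0_at_0, (lim0_ext (fun w => c w * extend0 (pair f) w)%C); [|exact (ccont_lim0 _ Cc)].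
    exists 1; split; [lra|]; intros w _ W0; rewrite extend0_off by easy.
    unfold pair, section_scal; now rewrite eval_scal.
  + rewrite !extend0_off by easy; unfold pair, section_scal; apply eval_scal.
- intros V f HV HVU HF z Vz; apply extend0_off; apply (HVU z Vz).
Qed.

End Inclusions.

Theorem corollary1p7 :
  forall (L : line_bundle punctured_disc) (h : hermitian_metric L) (K : R),
    0 < K -> curvature_bounded h K ->
    forall a : R, exists eps0 : R, 0 < eps0 /\
      forall eps : R, 0 < eps < eps0 ->
        same_subsheaf
          (dual_sheaf (prolongation L (metric_norm h) a))
          (prolongation (dual_bundle L) (dual_metric_norm h) (- a + 1 - eps)).
Proof.
intros L h K HK HC a.
destruct (generator_existence L h K a HK HC) as (f & r & sg & Hr & [Hsg1 Hsg2] & Hol & Hgr).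
(* [eps0] is the distance from [sg] to the excluded end of its interval. *)
exists (- a + 1 - sg); split; [lra|]; intros eps [He1 He2] U HU HUd s; split.
- now apply (dual_sheaf_in_prolongation h a r sg f).
- now apply prolongation_in_dual_sheaf.
Qed.
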